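(* Let $k\geq 2$ be a fixed even integer. There exist arbitrarily large $q$ and odd primitive characters $\chi\pmod q$ of order $k$ such that $$M(\chi)\geq\left(\frac{e^{\gamma}}{\pi}+o(1)\right)\sqrt{q}\,\log\log q.$$ Moreover, there exist arbitrarily large $q$ and even primitive characters $\chi\pmod q$ of order $k$ such that $$M(\chi)\geq\left(\frac{e^{\gamma}}{\pi\sqrt{3}}+o(1)\right)\sqrt{q}\,\log\log q.$$
   Context: For a primitive Dirichlet character $\chi\pmod q$, $M(\chi):=\max_{x}\left|\sum_{n\leq x}\chi(n)\right|$. The character $\chi$ is odd if $\chi(-1)=-1$ and even if $\chi(-1)=1$. The order of $\chi$ is its order in the group of characters modulo $q$. $\gamma$ is the Euler–Mascheroni constant. The terms $o(1)$ tend to $0$ as $q\to\infty$ along the respective family of characters, with $k$ fixed. *)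

(* Defs.v *)
From mathcomp Require Import all_boot all_order all_algebra.
From mathcomp Require Import complex.
From mathcomp Require Import all_classical all_reals all_analysis.
Set Implicit Arguments.
Unset Strict Implicit.
Unset Printing Implicit Defensive.
Import Order.TTheory GRing.Theory Num.Theory.
Import numFieldNormedType.Exports.
Local Open Scope classical_set_scope.
Local Open Scope ring_scope.

(* A Dirichlet character modulo q, extended by 0 to the integers not coprime  *)
(* to q. The value chi 1 = 1 follows from the last two clauses.               *)
Definition dirichlet_character (R : realType) (q : nat) (chi : int -> R[i]) :
    Prop :=
  [/\ (0 < q)%N,
      forall n : int, chi (n + q%:Z) = chi n,
      forall m n : int, chi (m * n) = chi m * chi n &
      forall n : int, (chi n != 0) = coprimez n q%:Z].

Definition principal_character (R : realType) (q : nat) : int -> R[i] :=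
  fun n => (coprimez n q%:Z)%:R.

(* chi, of modulus q, is induced by psi. *)
Definition induced_by (R : realType) (q : nat) (chi psi : int -> R[i]) : Prop :=
  forall n : int, coprimez n q%:Z -> chi n = psi n.

Definition primitive_character (R : realType) (q : nat) (chi : int -> R[i]) :
    Prop :=
  dirichlet_character q chi /\
  forall (d : nat) (psi : int -> R[i]), (d %| q)%N -> (d < q)%N ->
    dirichlet_character d psi -> ~ induced_by q chi psi.

(* The group law on characters modulo q is the pointwise product, with        *)
(* identity the principal character.                                          *)
Definition character_order (R : realType) (q : nat) (chi : int -> R[i])
    (k : nat) : Prop :=
  [/\ (0 < k)%N,
      forall n : int, chi n ^+ k = principal_character R q n &
      forall m : nat, (0 < m < k)%N ->
        ~ (forall n : int, chi n ^+ m = principal_character R q n)].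

Definition odd_character (R : realType) (chi : int -> R[i]) : Prop :=
  chi (- 1) = - 1.

Definition even_character (R : realType) (chi : int -> R[i]) : Prop :=
  chi (- 1) = 1.

(* M(chi). For a nonprincipal character the partial sums are periodic in x,   *)
(* hence take finitely many values, and the supremum is a maximum.            *)
Definition max_character_sum (R : realType) (chi : int -> R[i]) : R :=
  sup [set ComplexField.Normc.normc (\sum_(1 <= n < x.+1) chi n%:Z)
      | x in [set: nat]].

Definition euler_gamma (R : realType) : R :=
  limn (fun n : nat => (\sum_(1 <= i < n.+1) (i%:R : R)^-1) - ln (n%:R : R)).

(* Main.v *)
(* Fix y and let xi be a character of order k that equals 1 at every prime p <= y: by
   pigeonhole it can be found among products of characters to prime moduli = 1 (mod k), with
   a modulus q1 whose log is only y (log y)^O(1). Let m = 1 in the odd case and m = 3 in the even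
   case, and let D run over an arithmetic progression of integers = m (or = - m) modulo
   8 q1 prod_{p <= y} p; by reciprocity (p/D) = (p/m) for p <= y. The primitive character chi
   inducing xi (./D) has order k, and theta = chi (./m) is odd, primitive modulo Q = m q, and
   equal to 1 at all y-smooth integers prime to m. The first moment (1/Q) sum n theta(n) is at
   most M(chi) if m = 1, and 2 M(chi) if m = 3; by Gauss sums it is also
   (sqrt Q / pi) |sum_{n <= N} theta(n)/n| + O(sqrt Q). On average over D the integers n that
   are not y-smooth contribute little to the latter sum, because the symbols (n/D) of a
   nonsquare n cancel. So for some D it is at least the product of the (1 - 1/p)^(-1) over
   the p <= y not dividing m, up to lower order. Since log log q is asymptotic to log y, and since only
   arbitrarily large q are wanted, it remains to know Mertens' product for infinitely many y
   and from below, which follows from comparing it with zeta(s) as s -> 1. *)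

(* The difference sits at integers [n] divisible by a prime of [q1] or by a prime whose square
   divides [D]; weighted by 1/n and averaged over [D], these cost O(1). This is why the primes of
   [q1] exceed y^3: there are up to k (y + 1) of them and the harmonic sum up to [N] is bounded by
   about y (log y)^5, so that y^2 would not suffice for this bound. [N] is both the number of moduli
   averaged and the length of the sum over [n]: a nonsmooth [n] with nonsquare rough part
   contributes at most [n] to the sum over [D], hence 1 after weighting, hence O(1) on average. [N]
   must exceed a power of y! for the smooth sum to reach the Euler product, and be at least Q^(3/4)
   for Polya-Vinogradov to control the tail, yet keep log q within y (log y)^O(1). The Jacobi symbol
   is built on Gauss's count for composite moduli, so that reciprocity is available at once for
   every [D]. *)
Require Import Defs.
From mathcomp Require Import all_boot all_order all_algebra.
From mathcomp Require Import fingroup cyclic all_field complex.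
From mathcomp Require Import zify ring lra.
From mathcomp Require Import all_classical all_reals all_analysis.
Set Implicit Arguments.
Unset Strict Implicit.
Unset Printing Implicit Defensive.
Import Order.TTheory GRing.Theory Num.Theory.
Import numFieldNormedType.Exports.

(** * The Jacobi symbol *)

Section GaussSchering.
Local Open Scope nat_scope.

(** The condition says that the residue of [a] of least absolute value is negative; [fold_half] is
    that absolute value. *)
Definition upper_half (D a : nat) : bool := D < (a %% D).*2.
Definition fold_half (D a : nat) : nat :=
  if upper_half D a then D - a %% D else a %% D.
(* Gauss's lemma in Schering's extension to composite moduli: for [D] odd and [a] coprime to
   [D], this is the parity that defines the Jacobi symbol of [a] over [D]. *)
Definition half_sign (D a : nat) : bool :=
  \big[addb/false]_(1 <= j < D./2.+1) upper_half D (a * j).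

Lemma modn_coprime_mul_gt0 D a j : 1 < D -> coprime a D -> 0 < j < D -> 0 < (a * j) %% D.
Proof.
move=> D1 cop /andP[j0 jD]; rewrite lt0n; apply/negP => /eqP H.
have : D %| a * j by rewrite /dvdn H.
rewrite Gauss_dvdr; last by rewrite coprime_sym.
by move=> /dvdn_leq -/(_ j0); rewrite leqNgt jD.
Qed.

Lemma half_range D j : odd D -> 1 <= j < D./2.+1 -> 0 < j < D.
Proof. lia. Qed.

Lemma fold_half_range D a : odd D -> 0 < a %% D -> 1 <= fold_half D a < D./2.+1.
Proof.
move=> oD a0; have := ltn_pmod a (odd_gt0 oD).
rewrite /fold_half /upper_half; case: ifP; lia.
Qed.

(** If two folded residues agree, then [D] divides a (i - j) or a (i + j). As 0 < i + j < D,
    coprimality leaves only i = j, and an injective map of a finite range into itself permutes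
    it. *)
Lemma fold_half_perm D a : odd D -> coprime a D ->
  perm_eq [seq fold_half D (a * j) | j <- index_iota 1 D./2.+1]
          (index_iota 1 D./2.+1).
Proof.
move=> oD cop.
have [D1|D1] := leqP D 1.
  have -> : D = 1 by lia.
  by [].
have cop' : coprime D a by rewrite coprime_sym.
set s := index_iota _ _.
have rg j : j \in s -> 0 < (a * j) %% D.
  rewrite mem_index_iota => /(half_range oD) jr.
  exact: modn_coprime_mul_gt0.
have us : uniq [seq fold_half D (a * j) | j <- s].
  rewrite map_inj_in_uniq ?iota_uniq // => i j is_ js.
  have /= := rg _ is_; have /= := rg _ js.
  move: is_ js; rewrite !mem_index_iota => ir0 jr0.
  move=> aj ai.
  have li : (a * i) %% D < D by rewrite ltn_mod; lia.
  have lj : (a * j) %% D < D by rewrite ltn_mod; lia.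
  have opp : (a * i) %% D + (a * j) %% D = D -> i = j.
    move=> E; have : D %| a * (i + j).
      rewrite mulnDr /dvdn -modnDm E modnn //.
    rewrite Gauss_dvdr // => H; have p : 0 < i + j by lia.
    by have := dvdn_leq p H; lia.
  have same : (a * i) %% D = (a * j) %% D -> i = j.
    move=> E; have [ij|ji] := leqP i j.
      have : D %| a * (j - i) by rewrite mulnBr -eqn_mod_dvd ?leq_mul // E.
      rewrite Gauss_dvdr // => H; have [|p] := posnP (j - i); first lia.
      by have := dvdn_leq p H; lia.
    have : D %| a * (i - j) by rewrite mulnBr -eqn_mod_dvd ?leq_mul ?E // ltnW.
    rewrite Gauss_dvdr // => H.
    have p : 0 < i - j by lia.
    by have := dvdn_leq p H; lia.
  rewrite /fold_half; case: ifP => Ui; case: ifP => Uj E.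
  - by apply: same; lia.
  - by apply: opp; lia.
  - by apply: opp; lia.
  - exact: same.
have sub : {subset [seq fold_half D (a * j) | j <- s] <= s}.
  move=> x /mapP[j js ->]; rewrite mem_index_iota; apply: fold_half_range => //.
  exact: rg.
have [|_ e] := uniq_min_size us sub; first by rewrite size_map.
by apply: uniq_perm; rewrite ?iota_uniq.
Qed.

Lemma half_sign_reindex D a (F : nat -> bool) : odd D -> coprime a D ->
  \big[addb/false]_(1 <= j < D./2.+1) F (fold_half D (a * j)) =
  \big[addb/false]_(1 <= j < D./2.+1) F j.
Proof.
move=> oD cop; rewrite -(big_map (fun j => fold_half D (a * j)) xpredT F).
by apply: perm_big; exact: fold_half_perm.
Qed.

(** Replacing [b] by [D - b] exchanges the two halves for a b as well. Summed over [j] and reindexed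
    by [fold_half_perm], this cocycle identity gives the multiplicativity of [half_sign] without
    factoring [D]. *)
Lemma upper_half_fold D a b : odd D -> coprime a D -> 0 < b %% D ->
  upper_half D (a * b) = upper_half D b (+) upper_half D (a * fold_half D b).
Proof.
move=> oD cop b0.
have D0 := odd_gt0 oD.
have bD := ltn_pmod b D0.
rewrite /fold_half; case: ifP => /= Ub.
  rewrite /upper_half -(modnMmr a b).
  have D1 : 1 < D by lia.
  have p1 : 0 < (a * (b %% D)) %% D by apply: modn_coprime_mul_gt0 => //; lia.
  have p2 : 0 < (a * (D - b %% D)) %% D by apply: modn_coprime_mul_gt0 => //; lia.
  have E : ((a * (b %% D)) %% D + (a * (D - b %% D)) %% D) %% D = 0.
    by rewrite modnDm -mulnDr subnKC ?modnMl //; lia.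
  have l1 := ltn_pmod (a * (b %% D)) D0.
  have l2 := ltn_pmod (a * (D - b %% D)) D0.
  have : (a * (b %% D)) %% D + (a * (D - b %% D)) %% D = D.
    have [lt|ge] := ltnP ((a * (b %% D)) %% D + (a * (D - b %% D)) %% D) D.
      by move: E; rewrite modn_small //; lia.
    move: E; rewrite -(subnK ge) modnDr modn_small; lia.
  lia.
by rewrite /upper_half modnMmr.
Qed.

Lemma half_signM D a b : odd D -> coprime a D -> coprime b D ->
  half_sign D (a * b) = half_sign D a (+) half_sign D b.
Proof.
move=> oD ca cb.
have [D1|D1] := leqP D 1.
  have -> : D = 1 by lia.
  by rewrite /half_sign !big_nil.
rewrite /half_sign addbC -(half_sign_reindex (fun j => upper_half D (a * j)) oD cb).
rewrite -big_split; apply: eq_big_nat => j /(half_range oD) jr.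
by rewrite -mulnA upper_half_fold //; apply: modn_coprime_mul_gt0.
Qed.

Lemma half_sign_mod D a : half_sign D (a %% D) = half_sign D a.
Proof. by apply: eq_bigr => j _; rewrite /upper_half modnMml. Qed.

Lemma half_sign_opp D a : odd D -> D %| a.+1 -> half_sign D a = odd D./2.
Proof.
move=> oD dv; rewrite /half_sign.
transitivity (\big[addb/false]_(1 <= j < D./2.+1) true).
  apply: eq_big_nat => j jh; have jr := half_range oD jh; rewrite /upper_half.
  have D1 : 1 < D by lia.
  have ca : coprime a D.
    by apply: (coprime_dvdr dv); rewrite coprimenS.
  have p := modn_coprime_mul_gt0 D1 ca jr.
  have l := ltn_pmod (a * j) (odd_gt0 oD).
  have E : ((a * j) %% D + j) %% D = 0.
    rewrite modnDml -mulSnr; apply/eqP; exact: dvdn_mulr.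
  have : (a * j) %% D + j = D.
    have [lt|ge] := ltnP ((a * j) %% D + j) D.
      by move: E; rewrite modn_small //; lia.
    move: E; rewrite -(subnK ge) modnDr modn_small; lia.
  lia.
by rewrite big_const_nat subn1 /=; elim: (D./2) => //= n ->.
Qed.

Lemma half_sign1 D : odd D -> half_sign D 1 = false.
Proof.
move=> oD; apply: big1_seq => j; rewrite mem_index_iota /= => jr.
rewrite /upper_half mul1n modn_small; lia.
Qed.

Lemma odd_sum_nat (a b : nat) (F : nat -> nat) :
  odd (\sum_(a <= i < b) F i) = \big[addb/false]_(a <= i < b) odd (F i).
Proof. by rewrite (big_morph odd oddD erefl). Qed.

(** Eisenstein's argument: modulo 2, with [n] and [D] odd, each [j] is the quotient plus the folded
    residue plus the half indicator of n j. The folded residues run over the same [j], so their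
    parities cancel. *)
Lemma half_sign_floor D n : odd D -> odd n -> coprime n D ->
  half_sign D n = odd (\sum_(1 <= j < D./2.+1) (n * j) %/ D).
Proof.
move=> oD on cop; rewrite odd_sum_nat.
have D0 := odd_gt0 oD.
have H1 : \big[addb/false]_(1 <= j < D./2.+1) odd j =
  \big[addb/false]_(1 <= j < D./2.+1)
    (odd ((n * j) %/ D) (+) odd (fold_half D (n * j)) (+) upper_half D (n * j)).
  apply: eq_big_nat => j jr.
  have : odd (n * j) = odd j by rewrite oddM on.
  rewrite {1}(divn_eq (n * j) D) oddD oddM oD andbT => <-.
  rewrite /fold_half; case: ifP => U; last by rewrite addbF.
  rewrite oddB ?oD; last by rewrite ltnW // ltn_pmod.
  by do 2!case: (odd _).
rewrite !big_split /= (half_sign_reindex odd oD cop) in H1.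
have cancel_sign (a q u : bool) : a = q (+) a (+) u -> u = q by case: a q u => [] [] [].
exact: cancel_sign H1.
Qed.

Lemma floor_lattice D n j : odd D -> odd n -> coprime n D -> 1 <= j < D./2.+1 ->
  (n * j) %/ D = \sum_(1 <= i < n./2.+1) (i * D < n * j).
Proof.
move=> oD on cop jr.
have D0 := odd_gt0 oD.
have jr0 := half_range oD jr.
have b : (n * j) %/ D < n./2.+1.
  rewrite ltn_divLR //.
  have : n * j * 2 <= n * D.-1 by rewrite -mulnA leq_mul2l; lia.
  have : n * D.-1 < n./2.+1.*2 * D.
    apply: (@leq_trans (n * D)); first by rewrite ltn_mul2l; lia.
    by rewrite leq_mul2r; lia.
  lia.
have D1 : 1 < D by lia.
have ne i : (i * D < n * j) = (i <= (n * j) %/ D).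
  rewrite leq_divRL // ltn_neqAle; case: eqP => //= E.
  have : (n * j) %% D = 0 by rewrite -E modnMl.
  have := modn_coprime_mul_gt0 D1 cop jr0; lia.
rewrite (eq_bigr (fun i => nat_of_bool (i <= (n * j) %/ D))); last by move=> i _; rewrite ne.
rewrite (@big_cat_nat _ _ _ ((n * j) %/ D).+1) //=.
rewrite (@eq_big_nat _ _ _ _ _ _ (fun=> 1)); last by move=> i ir; have -> : i <= (n * j) %/ D by lia.
rewrite sum_nat_const_nat muln1 subn1 /= big_nat_cond big1 ?addn0 // => i /andP[ir _].
have -> //: i <= (n * j) %/ D = false by lia.
Qed.

(** Both floor sums count lattice points in a rectangle with sides [D./2] and [n./2], on the two
    sides of its diagonal line; coprimality keeps that line free of lattice points, so together they
    fill the rectangle. *)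
Lemma half_sign_reciprocity D n : odd D -> odd n -> coprime n D ->
  half_sign D n (+) half_sign n D = odd D./2 && odd n./2.
Proof.
move=> oD on cop.
have cop' : coprime D n by rewrite coprime_sym.
rewrite !half_sign_floor // -oddD -oddM; congr (odd _).
rewrite (@eq_big_nat _ _ _ 1 D./2.+1 _ _ (fun j jr => floor_lattice oD on cop jr)).
rewrite (@eq_big_nat _ _ _ 1 n./2.+1 _ _ (fun j jr => floor_lattice on oD cop' jr)).
rewrite exchange_big /= [X in _ + X = _]exchange_big /=.
rewrite [X in _ + X]exchange_big /= -big_split /=.
rewrite (@eq_big_nat _ _ _ _ _ _ (fun=> D./2)).
  by rewrite sum_nat_const_nat subn1 mulnC.
move=> i ir; rewrite -big_split /=.
rewrite (@eq_big_nat _ _ _ _ _ _ (fun=> 1)).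
  by rewrite sum_nat_const_nat subn1 muln1.
move=> j jr; rewrite (mulnC D i) (mulnC j n).
case: ltngtP => // E.
have jr0 := half_range oD jr.
have := modn_coprime_mul_gt0 _ cop jr0.
rewrite -E modnMl; lia.
Qed.

End GaussSchering.

(** * Complete residue systems *)

Section Residues.
Local Open Scope nat_scope.

Lemma affine_residues_perm n c L : 0 < n -> coprime L n ->
  perm_eq [seq (c + L * j) %% n | j <- index_iota 0 n] (index_iota 0 n).
Proof.
move=> n0 cop; have cop' : coprime n L by rewrite coprime_sym.
have us : uniq [seq (c + L * j) %% n | j <- index_iota 0 n].
  rewrite map_inj_in_uniq ?iota_uniq // => i j.
  rewrite !mem_index_iota /= => i_n j_n /eqP; rewrite eqn_modDl => E.
  wlog ij : i j i_n j_n E / i <= j.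
    move=> H; have [ij|ji] := leqP i j; first exact: H.
    by apply/esym/H => //; [rewrite eq_sym | exact: ltnW].
  move: E; rewrite eq_sym eqn_mod_dvd ?leq_mul // -mulnBr Gauss_dvdr // => H.
  have [|p] := posnP (j - i); first lia.
  by have := dvdn_leq p H; lia.
apply: uniq_perm; rewrite ?iota_uniq //.
have sub : {subset [seq (c + L * j) %% n | j <- index_iota 0 n] <= index_iota 0 n}.
  by move=> x /mapP[j _ ->]; rewrite mem_index_iota ltn_mod.
by have [|_ e] := uniq_min_size us sub; rewrite ?size_map.
Qed.

Lemma sum_affine_residues (V : nmodType) (f : nat -> V) n c L :
  0 < n -> coprime L n -> (forall x, f (x %% n) = f x) ->
  (\sum_(0 <= j < n) f (c + L * j)%N = \sum_(0 <= x < n) f x)%R.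
Proof.
move=> n0 cop per; rewrite -[RHS](perm_big _ (affine_residues_perm c n0 cop)) /=.
by rewrite big_map; apply: eq_bigr => j _; rewrite per.
Qed.

Lemma norm_periodic_sum (f : nat -> int) n K : 0 < n ->
  (forall x, f (x + n) = f x) -> (forall x, `|f x|%R <= 1)%R ->
  (\sum_(0 <= j < n) f j = 0)%R -> (`|\sum_(0 <= j < K) f j| <= n%:Z)%R.
Proof.
move=> n0 per b z.
rewrite (divn_eq K n).
have -> : (\sum_(0 <= j < K %/ n * n + K %% n) f j = \sum_(0 <= j < K %% n) f j)%R.
  elim: (K %/ n) => [|q IH]; first by rewrite mul0n add0n.
  rewrite (@big_cat_nat _ _ _ n) //=; last by rewrite mulSn -addnA leq_addr.
  rewrite z add0r -{1}[n in LHS]add0n big_addn mulSn -addnA addKn -IH.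
  by apply: eq_bigr => i _; rewrite per.
apply: (le_trans (ler_norm_sum _ _ _)).
apply: (@le_trans _ _ (\sum_(0 <= j < K %% n) 1)%R); first by apply: ler_sum => i _.
by rewrite sumr_const_nat subn0 natz lez_nat ltnW // ltn_mod.
Qed.

End Residues.

Section Jacobi.
Local Open Scope ring_scope.

(** For odd [D] this is the Jacobi symbol (a/D); the modulus is the first argument. *)
Definition jac (D a : nat) : int := if coprime a D then (-1) ^+ half_sign D a else 0.

Lemma jacM D a b : odd D -> jac D (a * b) = jac D a * jac D b.
Proof.
move=> oD; rewrite /jac coprimeMl.
case: ifP => [/andP[ca cb]|]; first by rewrite half_signM // ca cb signr_addb.
by case: (coprime a D); case: (coprime b D); rewrite /= ?mulr0 ?mul0r.
Qed.

Lemma jac_mod D a : jac D (a %% D) = jac D a.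
Proof. by rewrite /jac half_sign_mod coprime_modl. Qed.

Lemma jac_eqmod D a b : a = b %[mod D] -> jac D a = jac D b.
Proof. by rewrite -(jac_mod D a) -(jac_mod D b) => ->. Qed.

Lemma jac1 D : odd D -> jac D 1 = 1.
Proof. by move=> oD; rewrite /jac coprime1n half_sign1. Qed.

Lemma jac1l a : jac 1 a = 1.
Proof. by rewrite /jac coprimen1 /half_sign big_nil. Qed.

Lemma jac_coprime D a : (jac D a != 0) = coprime a D.
Proof. by rewrite /jac; case: ifP => // _; rewrite signr_eq0. Qed.

Lemma jac_sqr D a : jac D a ^+ 2 = (coprime a D)%:R.
Proof. by rewrite /jac; case: ifP; rewrite ?sqrr_sign ?expr0n. Qed.

Lemma jac_norm D a : `|jac D a| <= 1.
Proof. by rewrite /jac; case: ifP; rewrite ?normr_sign ?normr0. Qed.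

Lemma jac_opp D a : odd D -> (D %| a.+1)%N -> jac D a = (-1) ^+ D./2.
Proof.
move=> oD dv; rewrite /jac.
have -> : coprime a D by apply: (coprime_dvdr dv); rewrite coprimenS.
by rewrite half_sign_opp // signr_odd.
Qed.

Lemma jac_reciprocity D n : odd D -> odd n ->
  jac D n = (-1) ^+ (odd D./2 && odd n./2) * jac n D.
Proof.
move=> oD on; rewrite /jac (coprime_sym D n); case: ifP => cop; last by rewrite mulr0.
rewrite -(half_sign_reciprocity oD on cop) signr_addb.
by case: (half_sign D n); case: (half_sign n D).
Qed.

(** For n = 1 modulo 4 reciprocity carries no sign, so multiplicativity in the modulus is [jacM]
    read across it. The test integers that detect prime factors are chosen in this class. *)
Lemma jacMl D e n : odd D -> odd e -> n = 1 %[mod 4] ->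
  jac (D * e) n = jac D n * jac e n.
Proof.
move=> oD oe n1.
have [on n2] : odd n /\ ~~ odd n./2 by split; lia.
rewrite !(jac_reciprocity _ on) ?oddM ?oD ?oe // (negbTE n2) !andbF !mul1r.
exact: jacM.
Qed.

Lemma euler_half_sign (p a : nat) : prime p -> odd p -> coprime a p ->
  (a%:R : 'F_p) ^+ p./2 = (-1) ^+ half_sign p a.
Proof.
move=> pr op cop.
have ch : p \in [pchar 'F_p] by rewrite pchar_Fp.
have D0 := odd_gt0 op.
have h0 : \prod_(1 <= j < p./2.+1) (j%:R : 'F_p) != 0.
  rewrite prodf_seq_neq0; apply/allP => j; rewrite mem_index_iota => jr /=.
  rewrite -(dvdn_pcharf ch); apply/negP => /dvdn_leq; lia.
apply: (mulIf h0).
transitivity (\prod_(1 <= j < p./2.+1) ((a * j)%:R : 'F_p)).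
  under [RHS]eq_bigr do rewrite natrM.
  by rewrite big_split /= prodr_const_nat subn1.
transitivity (\prod_(1 <= j < p./2.+1)
   ((-1) ^+ upper_half p (a * j) * (fold_half p (a * j))%:R : 'F_p)).
  apply: eq_bigr => j _.
  have -> : ((a * j)%:R : 'F_p) = ((a * j) %% p)%:R.
    by rewrite {1}(divn_eq (a * j) p) natrD natrM pchar_Fp_0 // mulr0 add0r.
  rewrite /fold_half; case: ifP => U; last by rewrite mul1r.
  rewrite natrB; last by rewrite ltnW // ltn_mod.
  by rewrite pchar_Fp_0 // sub0r expr1 mulrNN mul1r.
rewrite big_split /= -(big_map (fun j => fold_half p (a * j)) xpredT (fun i => i%:R : 'F_p)).
rewrite (perm_big _ (fold_half_perm op cop)) /=; congr (_ * _).
by rewrite /half_sign; elim/big_rec2 : _ => // i x y _ ->; rewrite signr_addb.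
Qed.

Lemma exists_nonresidue p : prime p -> odd p -> exists2 g, coprime g p & half_sign p g.
Proof.
move=> pr op; apply: contrapT => H.
have all1 (x : 'F_p) : x != 0 -> x ^+ p./2 = 1.
  move=> x0; have cop : coprime x p.
    rewrite coprime_sym prime_coprime //.
    apply/negP => /dvdn_leq.
    have xp : (x < p)%N by have := ltn_ord x; rewrite [X in (_ < X)%N]Fp_cast.
    have : x != 0%N :> nat by [].
    lia.
  rewrite -[x]natr_Zp euler_half_sign //; case E: (half_sign p x) => //.
  by exfalso; apply: H; exists (x : nat).
have h0 : (0 < p./2)%N by have := prime_gt1 pr; lia.
have sz : size ('X^(p./2) - 1%:P : {poly 'F_p}) = p./2.+1 by rewrite size_XnsubC.
have nz : ('X^(p./2) - 1%:P : {poly 'F_p}) != 0 by rewrite -size_poly_eq0 sz.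
have := max_poly_roots nz (rs := enum [pred x : 'F_p | x != 0]).
rewrite sz enum_uniq -cardE => /(_ _ isT).
rewrite (eq_card (B := predC1 0)); last by move=> x; rewrite !inE.
rewrite cardC1 card_Fp // => K.
have /K : all (root ('X^(p./2) - 1%:P)) (enum [pred x : 'F_p | x != 0]).
  apply/allP => x; rewrite mem_enum inE => x0.
  by rewrite rootE !hornerE all1 // subrr.
lia.
Qed.

Lemma half_sign_coprimeMl D e n : odd D -> odd e -> n = 1 %[mod 4] ->
  coprime n (D * e) -> half_sign (D * e) n = half_sign D n (+) half_sign e n.
Proof.
move=> oD oe n1; rewrite coprimeMr => /andP[cD ce].
have := jacMl oD oe n1; rewrite /jac coprimeMr cD ce /= -signr_addb.
by case: (half_sign _ _) => //; case: (_ (+) _).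
Qed.

(** The Chinese remainder theorem prescribes a nonresidue modulo [p] and 1 modulo everything else,
    so that only the odd power of [p] contributes to the sign. With [W = 1] this shows that a symbol
    is nontrivial; with [W] the modulus of [xi] it shows that [p] divides a conductor. *)
Lemma exists_sign_flip p a e W : prime p -> odd p -> odd a -> odd e ->
  ~~ (p %| e)%N -> (0 < W)%N -> ~~ (p %| W)%N ->
  exists n, [/\ n = 1 %[mod 4 * W * e], coprime n (p ^ a * e) & half_sign (p ^ a * e) n].
Proof.
move=> pr op oa oe pe W0 pW.
have [g cg sg] := exists_nonresidue pr op.
have cp : coprime (4 * W * e) p.
  rewrite coprime_sym !coprimeMr !prime_coprime // pe pW !andbT.
  apply/negP => dv; have p4 := @dvdn_leq p 4 isT dv.
  have p3 : p = 3 by have := prime_gt1 pr; lia.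
  by rewrite p3 in dv.
pose n := chinese (4 * W * e) p 1 g.
have n1 : n = 1 %[mod 4 * W * e] by exact: chinese_modl.
have ng : n = g %[mod p] by exact: chinese_modr.
have dv d : (d %| 4 * W * e)%N -> n = 1 %[mod d].
  by move=> dd; rewrite -(modn_dvdm n dd) -(modn_dvdm 1 dd) n1.
have n4 : n = 1 %[mod 4] by apply: dv; rewrite -mulnA dvdn_mulr.
have ne : n = 1 %[mod e] by apply: dv; rewrite dvdn_mull.
have cnp : coprime n p by rewrite -coprime_modl ng coprime_modl.
have cne : coprime n e by rewrite -coprime_modl ne coprime_modl coprime1n.
have cnpa b : coprime n (p ^ b) by apply: coprimeXr.
exists n; split => //; first by rewrite coprimeMr cnpa.
rewrite half_sign_coprimeMl ?oddX ?op ?orbT //; last by rewrite coprimeMr cnpa.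
have -> : half_sign e n = false by rewrite -half_sign_mod ne half_sign_mod half_sign1.
rewrite addbF.
have key b : half_sign (p ^ b) n = odd b.
  elim: b => [|b IH]; first by rewrite /half_sign big_nil.
  rewrite expnS half_sign_coprimeMl ?oddX ?op ?orbT ?coprimeMr ?cnp ?cnpa // IH.
  by rewrite -half_sign_mod ng half_sign_mod sg.
by rewrite key.
Qed.

Lemma odd_logn_nonsquare n : (0 < n)%N -> (forall t, n <> t ^ 2)%N ->
  exists2 p, prime p & odd (logn p n).
Proof.
move=> n0 nsq; apply: contrapT => H.
have ev p : ~~ odd (logn p n).
  apply/negP => o; apply: H; exists p => //.
  by apply: contraLR o => np; rewrite lognE (negbTE np).
pose t := (\prod_(p <- primes n) p ^ (logn p n)./2)%N.
apply: (nsq t); rewrite {1}(prod_prime_decomp n0) prime_decompE big_map /=.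
rewrite /t -mulnn -big_split /=; apply: eq_bigr => p _.
by rewrite -expnD addnn; congr (_ ^ _)%N; have := ev p; lia.
Qed.

(* Reciprocity moves the summation variable to the upper argument, where it runs over
   all residues modulo [n], and a nonsquare [n] carries a nontrivial symbol. *)
Lemma jac_lower_progression_sum n c L K : odd n -> odd c -> (4 %| L)%N ->
  coprime L n -> (forall t, n <> t ^ 2)%N ->
  `|\sum_(0 <= j < K) jac (c + L * j) n| <= n%:Z.
Proof.
move=> on oc L4 cL nsq.
have n0 := odd_gt0 on.
have oD j : odd (c + L * j) by rewrite oddD oddM oc; have -> : odd L = false by lia.
have D2 j : odd (c + L * j)./2 = odd c./2.
  have : (4 %| L * j)%N by rewrite dvdn_mulr.
  move: (L * j)%N => x; lia.
(* Since 4 divides [L], all lower arguments lie in one class modulo 4 and the reciprocity sign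
   factors out of the sum. *)
rewrite (eq_bigr (fun j => (-1) ^+ (odd c./2 && odd n./2) * jac n (c + L * j))); last first.
  by move=> j _; rewrite jac_reciprocity // D2.
rewrite -mulr_sumr normrM normr_sign mul1r.
apply: norm_periodic_sum => // [x|x|].
- by rewrite mulnDr addnA addnC -jac_mod modnMDl jac_mod.
- exact: jac_norm.
rewrite sum_affine_residues //; last by move=> x; rewrite jac_mod.
have [p pr opl] := odd_logn_nonsquare n0 nsq.
have pn : (p %| n)%N by move: opl; rewrite lognE; case: ifP => // /and3P[].
have [e pe En] := pfactor_coprime pr n0.
have op : odd p by move/dvdnP: pn on => [u ->]; rewrite oddM => /andP[].
have oe : odd e by move: on; rewrite En oddM => /andP[].
have pe' : ~~ (p %| e)%N by rewrite -prime_coprime.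
have [g [_ cg sg]] := exists_sign_flip pr op opl oe pe' (ltn0Sn 0) (W := 1) ltac:(by rewrite dvdn1; case: eqP pr => [->|]).
rewrite mulnC -En in cg sg.
have jg : jac n g = -1 by rewrite /jac cg sg.
have : \sum_(0 <= x < n) jac n x = - \sum_(0 <= x < n) jac n x.
  rewrite -sumrN -(sum_affine_residues (f := jac n) 0%N n0 cg).
    by apply: eq_bigr => j _; rewrite add0n jacM // jg mulN1r.
  by move=> x; rewrite jac_mod.
by move/eqP; rewrite -subr_eq0 opprK -mulr2n mulrn_eq0 /= => /eqP.
Qed.

Lemma half_sign2 D : odd D -> half_sign D 2 = odd (D./2 - D %/ 4).
Proof.
move=> oD; rewrite /half_sign.
have le : ((D %/ 4).+1 <= D./2.+1)%N by lia.
rewrite (@big_cat_nat _ _ _ (D %/ 4).+1) //= big_nat_cond big1 ?addFb; last first.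
  move=> j /andP[jr _]; rewrite /upper_half modn_small; lia.
transitivity (\big[addb/false]_((D %/ 4).+1 <= j < D./2.+1) true).
  apply: eq_big_nat => j jr; rewrite /upper_half modn_small; lia.
by rewrite big_const_nat subSS; elim: (_ - _)%N => //= n ->.
Qed.

Lemma odd_half_eqmod a b : a = b %[mod 4] -> odd a./2 = odd b./2.
Proof. lia. Qed.

Lemma odd_half_addmod a b : odd a -> odd b -> (4 %| a + b)%N -> odd a./2 = ~~ odd b./2.
Proof. lia. Qed.

(** The class modulo 8 settles p = 2, and reciprocity settles odd [p]. When D = - m, the symbol of -
    1 over [p] produced by the congruence compensates the change of the reciprocity sign, since
    [D./2] and [m./2] have opposite parities. *)
Lemma jac_prime_congr m D p : odd m -> odd D -> prime p ->
  (D = m %[mod 8 * p] \/ (8 * p %| D + m)%N) -> jac D p = jac m p.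
Proof.
move=> om oD pr H.
have [p2|np2] := eqVneq p 2.
  subst p; rewrite /jac !coprime2n om oD !half_sign2 //; congr (_ ^+ nat_of_bool _).
  by case: H; lia.
have op : odd p by apply: contraR np2 => /(prime_oddPn pr)/eqP.
rewrite !(jac_reciprocity _ op) //.
case: H => [E|dv].
  have Ep : D = m %[mod p].
    by rewrite -(modn_dvdm D (dvdn_mull 8 (dvdnn p))) E modn_dvdm // dvdn_mull.
  have E4 : D = m %[mod 4].
    have d : (4 %| 8 * p)%N by rewrite -[8%N]/(4 * 2)%N -mulnA dvdn_mulr.
    by rewrite -(modn_dvdm D d) E modn_dvdm.
  by rewrite (jac_eqmod Ep) (odd_half_eqmod E4).
have d4 : (4 %| D + m)%N.
  by apply: dvdn_trans dv; rewrite -[8%N]/(4 * 2)%N -mulnA dvdn_mulr.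
have dp : (p %| D + m)%N by apply: dvdn_trans dv; rewrite dvdn_mull.
have p0 := prime_gt0 pr.
have Ep : D = m * p.-1 %[mod p].
  apply/eqP; rewrite -(eqn_modDr m) -mulnSr prednK // modnMl.
  by apply/eqP; move/eqP: dp.
rewrite (jac_eqmod Ep) jacM // (jac_opp (a := p.-1)) ?prednK // -(signr_odd _ p./2).
rewrite (odd_half_addmod oD om d4).
by case: (odd m./2); case: (odd p./2); rewrite /= ?expr0 ?expr1 ?mulr1 ?mul1r ?mulN1r ?mulrN1 ?opprK.
Qed.

End Jacobi.

Local Open Scope ring_scope.

(** * Gauss sums and the first moment of an odd character *)

Section Trigonometry.
Variable R : realType.
Implicit Types x y u v : R.

Lemma sin_MVT x y : x < y ->
  exists2 c, x < c < y & sin y - sin x = cos c * (y - x).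
Proof.
move=> xy; have [c cxy E] := @MVT R sin cos x y xy (fun c _ => is_derive_sin c)
  (continuous_subspaceT (@continuous_sin R)).
by exists c => //; move: cxy; rewrite in_itv.
Qed.

(** This is the decrease of sin x / x on (0, pi/2], cross-multiplied: the mean value theorem and the
    decrease of the cosine compare the slopes of the sine on (0, x) and (x, y). *)
Lemma sin_concave_div x y : 0 < x -> x <= y -> y <= pi / 2 ->
  x * sin y <= y * sin x.
Proof.
move=> x0; rewrite le_eqVlt => /predU1P[->//|xy] ypi.
have [c1 /andP[c10 c1x]] := sin_MVT x0.
rewrite sin0 !subr0 => E1.
have [c2 /andP[c2x c2y] E2] := sin_MVT xy.
have pi0 := @pi_gt0 R.
have le : cos c2 <= cos c1.
  have [H|H] := leP (cos c2) (cos c1) => //.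
  move: H; rewrite ltr_cos ?in_itv /=; lra.
have : 0 <= (y - x) * x * (cos c1 - cos c2).
  by rewrite mulr_ge0 ?mulr_ge0 ?subr_ge0 // ltW.
have E3 : sin y = cos c1 * x + cos c2 * (y - x) by rewrite -E1 -E2; ring.
rewrite E3 E1; lra.
Qed.

Lemma jordan_sin x : 0 < x -> x <= pi / 2 -> 2 * x <= pi * sin x.
Proof.
move=> x0 xp; have := sin_concave_div x0 xp (lexx _).
rewrite sin_pihalf; lra.
Qed.

Definition cot_gap u : R := u^-1 - cos u / sin u.

(** The difference of cotangents is sin (v - u) / (sin u sin v), to be compared with (v - u) / (u
    v). This follows from sin u <= u and the decrease of sin x / x applied to v - u <= v. *)
Lemma cot_gap_ndecr u v : 0 < u -> u <= v -> v <= pi / 2 -> cot_gap u <= cot_gap v.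
Proof.
move=> u0; rewrite le_eqVlt => /predU1P[->//|uv] vp.
have pi0 := @pi_gt0 R.
have v0 : 0 < v by exact: lt_trans uv.
have su : 0 < sin u by apply: sin_gt0_pi; lra.
have sv : 0 < sin v by apply: sin_gt0_pi; lra.
have d0 : 0 < v - u by lra.
have K1 : (v - u) * sin v <= v * sin (v - u) by apply: sin_concave_div; lra.
have K2 : sin u <= u.
  have [c _] := sin_MVT u0; rewrite sin0 !subr0 => ->.
  by rewrite ler_piMl ?cos_le1 // ltW.
have K3 : (v - u) * sin v * sin u <= v * sin (v - u) * u.
  by apply: ler_pM => //; [rewrite mulr_ge0 // ltW | exact: ltW].
have E : cos u / sin u - cos v / sin v = sin (v - u) / (sin u * sin v).
  rewrite sinB; field; lra.
rewrite /cot_gap -subr_ge0.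
have -> : v^-1 - cos v / sin v - (u^-1 - cos u / sin u) =
  (cos u / sin u - cos v / sin v) - (v - u) / (u * v) by field; lra.
rewrite E subr_ge0 ler_pdivrMr ?mulr_gt0 // mulrAC ler_pdivlMr ?mulr_gt0 //.
lra.
Qed.

Lemma cot_gap_ge0 u : 0 < u -> u <= pi / 2 -> 0 <= cot_gap u.
Proof.
move=> u0 up; have pi0 := @pi_gt0 R.
have su : 0 < sin u by apply: sin_gt0_pi; lra.
have [c /andP[c0 cu]] := sin_MVT u0; rewrite sin0 !subr0 => Es.
have le : cos u <= cos c.
  have [H|H] := leP (cos u) (cos c) => //.
  move: H; rewrite ltr_cos ?in_itv /=; lra.
rewrite /cot_gap subr_ge0 ler_pdivrMr // mulrC ler_pdivlMr // Es.
by rewrite ler_wpM2r // ltW.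
Qed.

Lemma cot_gap_le1 u : 0 < u -> u <= pi / 2 -> cot_gap u <= 1.
Proof.
move=> u0 up; have pi2 := @pi_ge2 R.
apply: (le_trans (cot_gap_ndecr u0 up (lexx _))).
rewrite /cot_gap cos_pihalf mul0r subr0 invf_le1; lra.
Qed.

End Trigonometry.

Section ComplexNorm.
Variable R : realType.
Local Notation C := R[i].
Local Notation Re := (@complex.Re R).
Definition cabs (z : C) : R := ComplexField.Normc.normc z.

Lemma cabs0 : cabs 0 = 0. Proof. exact: ComplexField.Normc.normc0. Qed.
Lemma cabs1 : cabs 1 = 1. Proof. exact: ComplexField.Normc.normc1. Qed.
Lemma cabsM x y : cabs (x * y) = cabs x * cabs y.
Proof. exact: ComplexField.Normc.normcM. Qed.
Lemma cabs_ge0 x : 0 <= cabs x. Proof. by case: x => a b; exact: sqrtr_ge0. Qed.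
Lemma cabsD x y : cabs (x + y) <= cabs x + cabs y. Proof. exact: le_normcD. Qed.
Lemma cabsN x : cabs (- x) = cabs x. Proof. exact: normcN. Qed.
Lemma cabsB x y : cabs (x - y) <= cabs x + cabs y.
Proof. by rewrite -(cabsN y); exact: cabsD. Qed.
Lemma cabs_sub_le x y : cabs x - cabs y <= cabs (x - y).
Proof. by rewrite lerBlDr -{1}(subrK y x); exact: cabsD. Qed.
Lemma cabsX x n : cabs (x ^+ n) = cabs x ^+ n.
Proof. by elim: n => [|n IH]; rewrite ?expr0 ?cabs1 // !exprS cabsM IH. Qed.
Lemma cabs_eq0 x : cabs x = 0 -> x = 0. Proof. exact: ComplexField.Normc.eq0_normc. Qed.
Lemma cabsJ x : cabs (x^*)%C = cabs x.
Proof. by case: x => a b; rewrite /cabs /= sqrrN. Qed.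
Lemma cabs_real (x : R) : cabs (x%:C)%C = `|x|.
Proof. by rewrite /cabs /= expr0n addr0 sqrtr_sqr. Qed.
Lemma cabs_nat n : cabs (n%:R) = n%:R.
Proof. by rewrite -(rmorph_nat (real_complex R)) cabs_real normr_nat. Qed.
Lemma cabs_sqr x : (x * x^*)%C = ((cabs x ^+ 2)%:C)%C.
Proof.
case: x => a b; rewrite /cabs /= sqr_sqrtr ?addr_ge0 ?sqr_ge0 //.
by apply/eqP; rewrite eq_complex /=; apply/andP; split; apply/eqP; ring.
Qed.
Lemma Re_le_cabs x : Re x <= cabs x.
Proof.
case: x => a b; rewrite /cabs /=; apply: (le_trans (ler_norm a)).
by rewrite -sqrtr_sqr ler_wsqrtr // lerDl sqr_ge0.
Qed.
Lemma ReD (x y : C) : Re (x + y) = Re x + Re y.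
Proof. by case: x => a b; case: y => c d. Qed.
Lemma Re_sum (I : Type) (r : seq I) (P : pred I) (F : I -> C) :
  Re (\sum_(i <- r | P i) F i) = \sum_(i <- r | P i) Re (F i).
Proof. by apply: (big_morph Re ReD). Qed.
Lemma Re_realM (a : R) (z : C) : Re ((a%:C)%C * z) = a * Re z.
Proof. by case: z => x y /=; rewrite mul0r subr0. Qed.

Lemma cabs_sum (I : Type) (r : seq I) (P : pred I) (F : I -> C) :
  cabs (\sum_(i <- r | P i) F i) <= \sum_(i <- r | P i) cabs (F i).
Proof.
elim/big_rec2 : _ => [|i x y _ H]; first by rewrite cabs0.
by apply: (le_trans (cabsD _ _)); rewrite lerD2l.
Qed.

Lemma abel_bound (g : nat -> C) (c : nat -> R) (V : R) x y :
  (forall n, (x <= n)%N -> cabs (\sum_(x <= a < n) g a) <= V) ->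
  (forall a, (x <= a < y)%N -> 0 <= c a) ->
  (forall a, (x <= a)%N -> (a.+1 < y)%N -> c a.+1 <= c a) ->
  (x < y)%N ->
  cabs (\sum_(x <= a < y) g a * ((c a)%:C)%C) <= V * c x.
Proof.
move=> HV c0 cd; case: y c0 cd => // y c0 cd; rewrite ltnS => xy.
have E : \sum_(x <= a < y.+1) g a * ((c a)%:C)%C =
  (\sum_(x <= a < y.+1) g a) * ((c y)%:C)%C +
  \sum_(x <= a < y) (\sum_(x <= b < a.+1) g b) * ((c a - c a.+1)%:C)%C.
  clear c0 cd HV; elim: y xy => [|y IH] xy.
    move: xy; rewrite leqn0 => /eqP->.
    by rewrite !big_nat1 big_geq // addr0.
  move: xy; rewrite leq_eqVlt => /predU1P[->|]; last rewrite ltnS => xy.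
    by rewrite !big_nat1 [X in _ + X]big_geq // addr0.
  rewrite big_nat_recr /=; last exact: leqW.
  rewrite IH // [X in _ = _ + X]big_nat_recr //=.
  rewrite [X in _ = X * _ + _]big_nat_recr /=; last exact: leqW.
  by rewrite rmorphB /=; ring.
rewrite E; apply: (le_trans (cabsD _ _)).
have V0 : 0 <= V by apply: (le_trans _ (HV x (leqnn x))); exact: cabs_ge0.
have -> : V * c x = V * c y + \sum_(x <= a < y) V * (c a - c a.+1).
  rewrite -mulr_sumr -mulrDr; congr (_ * _).
  have -> : \sum_(x <= a < y) (c a - c a.+1) = - \sum_(x <= a < y) (c a.+1 - c a).
    by rewrite -sumrN; apply: eq_bigr => i _; rewrite opprB.
  by rewrite telescope_sumr // opprB addrC subrK.
apply: lerD.
  rewrite cabsM cabs_real ger0_norm; last by apply: c0; lia.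
  by apply: ler_wpM2r; [apply: c0; lia | apply: HV; lia].
apply: (le_trans (cabs_sum _ _ _)); rewrite big_nat_cond [leRHS]big_nat_cond.
apply: ler_sum => a /andP[ar _]; rewrite cabsM cabs_real.
have d : 0 <= c a - c a.+1 by rewrite subr_ge0; apply: cd; lia.
by rewrite ger0_norm //; apply: ler_wpM2r => //; apply: HV; lia.
Qed.

End ComplexNorm.

Section UnitRoot.
Variable R : realType.
Local Notation C := R[i].
Variable q : nat.
Hypothesis q0 : (0 < q)%N.

Let phi (n : nat) : R := n%:R * (pi *+ 2 / q%:R).

Definition unit_root : C := Complex (cos (pi *+ 2 / q%:R)) (sin (pi *+ 2 / q%:R)).

Lemma unit_rootX n : unit_root ^+ n = Complex (cos (phi n)) (sin (phi n)).
Proof.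
elim: n => [|n IH]; first by rewrite expr0 /phi mul0r cos0 sin0.
rewrite exprS IH /unit_root /phi; set t := _ / _.
have -> : n.+1%:R * t = n%:R * t + t by rewrite -natr1; ring.
rewrite cosD sinD.
by apply/eqP; rewrite eq_complex /=; apply/andP; split; apply/eqP; ring.
Qed.

Lemma unit_root_order : unit_root ^+ q = 1.
Proof.
rewrite unit_rootX /phi mulrCA mulfV ?mulr1 ?pnatr_eq0 -?lt0n //.
by rewrite cos2pi sin2pi.
Qed.

Lemma unit_root_sub1 n :
  cabs (unit_root ^+ n - 1) = 2 * `|sin (pi * n%:R / q%:R)|.
Proof.
rewrite unit_rootX; set u := pi * _ / _.
have -> : phi n = u *+ 2 by rewrite /phi /u !mulr2n; ring.
rewrite /cabs /= cos_mulr2n sin_mulr2n.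
set c := cos u; set s := sin u.
have cs : c ^+ 2 = 1 - s ^+ 2 by rewrite /c /s cos2sin2.
rewrite cs.
have -> : ((1 - s ^+ 2) *+ 2 - 1 - 1) ^+ 2 + (c * s *+ 2 - 0) ^+ 2 =
  ((2 * s) ^+ 2).
  have -> : (c * s *+ 2 - 0) ^+ 2 = c ^+ 2 * s ^+ 2 * 4 by rewrite !mulr2n; ring.
  by rewrite cs !mulr2n; ring.
by rewrite sqrtr_sqr normrM normr_nat.
Qed.

Lemma unit_root_sub1_neq0 n : (0 < n < q)%N -> unit_root ^+ n - 1 != 0.
Proof.
move=> /andP[n0 nq]; apply/eqP => E.
have := unit_root_sub1 n; rewrite E cabs0 => /esym/eqP.
rewrite mulf_eq0 pnatr_eq0 /= normr_eq0 gt_eqF //.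
apply: sin_gt0_pi; have pi0 := @pi_gt0 R.
rewrite divr_gt0 ?mulr_gt0 ?ltr0n //= ltr_pdivrMr ?ltr0n //.
by rewrite ltr_pM2l // ltr_nat.
Qed.

Lemma unit_root_prim : q.-primitive_root unit_root.
Proof.
rewrite /primitive_root_of_unity q0 /=; apply/forallP => i; apply/eqP.
rewrite unity_rootE -subr_eq0.
have [->|ne] := eqVneq i.+1 q; first by rewrite unit_root_order subrr eqxx.
by apply/negbTE/unit_root_sub1_neq0; have := ltn_ord i; lia.
Qed.

End UnitRoot.

(** * Characters on natural numbers and their Gauss sums *)

Section NatCharacters.
Variable R : realType.
Local Notation C := R[i].

(** Characters are handled on natural numbers, where - 1 becomes [q.-1]; [int_character] carries the
    result back to the integers. *)
Definition natchar (q : nat) (f : nat -> C) : Prop :=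
  [/\ (0 < q)%N, forall n, f (n %% q)%N = f n,
      forall m n, f (m * n)%N = f m * f n & forall n, (f n != 0) = coprime n q].

(* For a character modulo [q] this is primitivity. *)
Definition separating (q : nat) (f : nat -> C) : Prop :=
  forall d, (d %| q)%N -> (d < q)%N ->
  exists n, [/\ n = 1 %[mod d], coprime n q & f n != 1].

Section OneCharacter.
Variables (q : nat) (f : nat -> C).
Hypothesis fchar : natchar q f.

Lemma natchar1 : f 1%N = 1.
Proof.
case: fchar => q0 per mul nz.
have f1 : f 1%N != 0 by rewrite nz coprime1n.
by apply: (mulfI f1); rewrite -mul mulr1.
Qed.

Lemma natcharX m n : f (m ^ n)%N = f m ^+ n.
Proof.
case: fchar => q0 per mul nz; elim: n => [|n IH]; first by rewrite natchar1.
by rewrite expnS exprS mul IH.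
Qed.

Lemma natchar_eqmod a b : a = b %[mod q] -> f a = f b.
Proof. by case: fchar => q0 per _ _ E; rewrite -per E per. Qed.

Lemma natchar_totient n : coprime n q -> f n ^+ totient q = 1.
Proof.
move=> cop; rewrite -natcharX -natchar1; apply: natchar_eqmod.
exact: Euler_exp_totient.
Qed.

Lemma natchar_notcoprime n : ~~ coprime n q -> f n = 0.
Proof. by case: fchar => q0 per mul nz; rewrite -nz negbK => /eqP. Qed.

Lemma natchar_abs n : cabs (f n) = (coprime n q)%:R.
Proof.
case: fchar => q0 per mul nz; have [cop|ncop] := boolP (coprime n q); last first.
  by rewrite natchar_notcoprime // cabs0.
have := congr1 (@cabs R) (natchar_totient cop); rewrite cabsX cabs1 => /eqP.
rewrite pexpr_eq1 ?cabs_ge0 //; last by rewrite totient_gt0.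
by move/eqP.
Qed.

Lemma natchar_abs_le1 n : cabs (f n) <= 1.
Proof. by rewrite natchar_abs lern1; case: coprime. Qed.

Lemma natchar_conjM n : f n * ((f n)^*)%C = (coprime n q)%:R.
Proof.
by rewrite cabs_sqr natchar_abs; case: coprime; rewrite ?expr1n ?expr0n.
Qed.

Lemma natchar_conj : natchar q (fun n => ((f n)^*)%C).
Proof.
case: fchar => q0 per mul nz; split => // [n|m n|n]; first by rewrite per.
  by rewrite mul rmorphM.
by rewrite conjc_eq0 nz.
Qed.

Lemma separating_conj : separating q f -> separating q (fun n => ((f n)^*)%C).
Proof.
move=> sep d dq lt; have [n [n1 cop fn]] := sep d dq lt; exists n; split => //.
by apply: contra fn => /eqP/(congr1 (@conjc R)); rewrite conjcK conjc1 => ->.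
Qed.

End OneCharacter.

Section GaussSum.
Variables (q : nat).
Hypothesis q1 : (1 < q)%N.
Let q0 : (0 < q)%N := ltnW q1.
Let w : C := unit_root R q.

Definition gauss_sum (f : nat -> C) n : C := \sum_(0 <= a < q) f a * w ^+ (a * n).

Lemma unit_root_eqmod a b : a = b %[mod q] -> w ^+ a = w ^+ b.
Proof.
move=> E; rewrite -(expr_mod a (unit_root_order R q0)) E.
by rewrite (expr_mod b (unit_root_order R q0)).
Qed.

Lemma sum_root_of_unity (z : C) : z ^+ q = 1 -> z != 1 -> \sum_(0 <= n < q) z ^+ n = 0.
Proof.
move=> zq z1; have := subrX1 z q; rewrite zq subrr big_mkord => /esym/eqP.
by rewrite mulf_eq0 subr_eq0 (negbTE z1) => /eqP.
Qed.

Variable f : nat -> C.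
Hypothesis fchar : natchar q f.
Hypothesis fsep : separating q f.

Let reindex c (F : nat -> C) : coprime c q -> (forall x, F (x %% q)%N = F x) ->
  \sum_(0 <= a < q) F a = \sum_(0 <= a < q) F (a * c)%N.
Proof.
move=> cop per; rewrite -(sum_affine_residues 0%N q0 cop per).
by apply: eq_bigr => a _; rewrite add0n mulnC.
Qed.

(** For [n] coprime to [q] this is a change of variable. Otherwise primitivity supplies a unit [c]
    with [f c != 1] and c n = n modulo [q]; replacing a by a c multiplies the sum by [f c], so it is
    0. *)
Lemma gauss_sumE n : gauss_sum f n = ((f n)^*)%C * gauss_sum f 1.
Proof.
case: (fchar) => _ per mul nz.
have perF m x : f (x %% q)%N * w ^+ (x %% q * m) = f x * w ^+ (x * m).
  by rewrite per; congr (_ * _); apply: unit_root_eqmod; rewrite modnMml.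
have [cop|ncop] := boolP (coprime n q).
  have -> : gauss_sum f 1 = f n * gauss_sum f n.
    rewrite /gauss_sum (reindex cop); last exact: perF.
    rewrite mulr_sumr; apply: eq_bigr => a _.
    by rewrite mul muln1 mulrA (mulrC (f n)).
  by rewrite mulrA (mulrC _ (f n)) (natchar_conjM fchar) cop mul1r.
rewrite (natchar_notcoprime fchar ncop) rmorph0 mul0r.
pose g := gcdn n q.
have g0 : (0 < g)%N by rewrite gcdn_gt0 q0 orbT.
have gq : (g %| q)%N by exact: dvdn_gcdr.
have g1 : (1 < g)%N by move: ncop; rewrite /coprime -/g; lia.
have [c [c1 cop fc]] : exists c, [/\ c = 1 %[mod q %/ g], coprime c q & f c != 1].
  by apply: fsep; [exact: dvdn_div | exact: ltn_Pdiv].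
have cn : c * n = n %[mod q].
  have /dvdnP[t nt] : (g %| n)%N by exact: dvdn_gcdl.
  have c0 : (0 < c)%N by move: cop; case: (c) => //; rewrite /coprime gcd0n; lia.
  apply/eqP; rewrite -{2}[n]mul1n eqn_mod_dvd ?leq_mul // -mulnBl.
  rewrite -(divnK gq) nt mulnA; apply: dvdn_mul => //; apply: dvdn_mulr.
  by rewrite -eqn_mod_dvd //; apply/eqP.
have : gauss_sum f n = f c * gauss_sum f n.
  rewrite {1}/gauss_sum (reindex cop); last exact: perF.
  rewrite mulr_sumr; apply: eq_bigr => a _.
  rewrite mul mulrA (mulrC (f c)); congr (_ * _); apply: unit_root_eqmod.
  by rewrite -mulnA -modnMmr cn modnMmr.
move/eqP; rewrite -{1}[gauss_sum f n]mul1r -subr_eq0 -mulrBl mulf_eq0 subr_eq0.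
by rewrite eq_sym (negbTE fc) => /eqP.
Qed.

Let w_conj : w * (w^*)%C = 1.
Proof.
rewrite cabs_sqr; have := congr1 (@cabs R) (unit_root_order R q0).
rewrite cabsX cabs1 => /eqP; rewrite pexpr_eq1 ?cabs_ge0 // => /eqP ->.
by rewrite expr1n.
Qed.

(** The second moment of [gauss_sum f n] over [n] is computed twice: by [gauss_sumE] it is [N] times
    the square wanted, by orthogonality it is [N] times [q], where [N] counts the units. *)
Lemma gauss_sum_norm : cabs (gauss_sum f 1) ^+ 2 = q%:R.
Proof.
case: (fchar) => _ per mul nz.
pose N : C := \sum_(0 <= a < q) f a * ((f a)^*)%C.
have N0 : N != 0.
  have -> : N = (\sum_(0 <= a < q) coprime a q)%:R.
    rewrite natr_sum; apply: eq_bigr => a _; exact: natchar_conjM.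
  rewrite pnatr_eq0 -lt0n big_mkord (bigD1 (Ordinal q1)) //= coprime1n.
  by rewrite addSn.
have L : \sum_(0 <= n < q) gauss_sum f n * ((gauss_sum f n)^*)%C =
    N * (gauss_sum f 1 * ((gauss_sum f 1)^*)%C).
  rewrite mulr_suml; apply: eq_bigr => n _; rewrite gauss_sumE rmorphM /= conjcK.
  by ring.
have Rt : \sum_(0 <= n < q) gauss_sum f n * ((gauss_sum f n)^*)%C = N * q%:R.
  transitivity (\sum_(0 <= n < q) \sum_(0 <= a < q) \sum_(0 <= b < q)
     (f a * ((f b)^*)%C) * (w ^+ a * (w^*)%C ^+ b) ^+ n).
    apply: eq_bigr => n _; rewrite {1}/gauss_sum mulr_suml; apply: eq_bigr => a _.
    rewrite /gauss_sum rmorph_sum mulr_sumr; apply: eq_bigr => b _.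
    by rewrite rmorphM rmorphXn /= exprMn -!exprM; ring.
  rewrite exchange_big /= mulr_suml; apply: eq_big_nat => a /= aq.
  rewrite exchange_big /= !big_mkord.
  rewrite (bigD1 (Ordinal aq)) //= [X in _ + X]big1 ?addr0.
    rewrite -mulr_sumr -exprMn w_conj expr1n; congr (_ * _).
    by under eq_bigr do rewrite expr1n; rewrite sumr_const_nat subn0.
  move=> b ba; rewrite -mulr_sumr sum_root_of_unity ?mulr0 //.
    have wbq : (w^*)%C ^+ q = 1.
      by rewrite -[LHS](rmorphXn (@conjc R)) /= (unit_root_order R q0) rmorph1.
    rewrite exprMn exprAC (exprAC _ b) wbq expr1n (unit_root_order R q0).
    by rewrite expr1n mulr1.
  apply: contra ba => /eqP E; apply/eqP/val_inj => /=.
  have : w ^+ a == w ^+ b.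
    rewrite -[X in X == _]mulr1 -(expr1n _ b) -w_conj (mulrC w) exprMn.
    by rewrite mulrA E mul1r.
  by rewrite (eq_prim_root_expr (unit_root_prim R q0)) !modn_small // => /eqP.
move: Rt; rewrite L => /(mulfI N0); rewrite cabs_sqr -(rmorph_nat (real_complex R)).
by move/complexI.
Qed.

End GaussSum.
End NatCharacters.

(** * Polya-Vinogradov and the cotangent formula for the first moment *)

Section PolyaVinogradov.
Variable R : realType.
Local Notation C := R[i].

Definition hsum (n : nat) : R := \sum_(1 <= a < n.+1) (a%:R)^-1.

Lemma hsum_ge0 n : 0 <= hsum n.
Proof. by apply: sumr_ge0 => i _; rewrite invr_ge0 ler0n. Qed.

Lemma sum_half_split (V : nmodType) (q : nat) (F : nat -> V) : odd q ->
  \sum_(1 <= a < q) F a = \sum_(1 <= a < q./2.+1) (F a + F (q - a)%N).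
Proof.
move=> oq; rewrite (@big_cat_nat _ _ _ q./2.+1) /=; [|lia|lia].
rewrite big_split /=; congr (_ + _); rewrite [RHS]big_nat_rev /=.
transitivity (\sum_(1 + q./2 <= a < q./2.+1 + q./2) F a); first by congr bigop; congr index_iota; lia.
rewrite big_addn addnK; apply: eq_big_nat => i ir; congr F; lia.
Qed.

(** If z^N = 1 and z is not 1, the plain geometric sum vanishes and the sum of n z^n becomes N / (z
    - 1), the kernel of the first moment. *)
Lemma weighted_geometric (z : C) N :
  (z - 1) * (\sum_(0 <= n < N) n%:R * z ^+ n) + \sum_(0 <= n < N) z ^+ n.+1 =
  N%:R * z ^+ N.
Proof.
elim: N => [|N IH]; first by rewrite !big_geq // mulr0 mul0r addr0.
by rewrite !big_nat_recr //= mulrDr addrACA IH -natr1 exprS; ring.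
Qed.

Variables (q : nat) (f : nat -> C).
Hypothesis q1 : (1 < q)%N.
Hypothesis fchar : natchar q f.
Hypothesis fsep : separating q f.
Let q0 : (0 < q)%N := ltnW q1.
Let w : C := unit_root R q.
Let g : nat -> C := fun n => ((f n)^*)%C.
Let tau := gauss_sum q g 1.

Lemma sqrtq_gt0 : 0 < Num.sqrt (q%:R : R).
Proof. by rewrite sqrtr_gt0 ltr0n. Qed.

Let abs_tau : cabs tau = Num.sqrt q%:R.
Proof.
rewrite -(gauss_sum_norm q1 (natchar_conj fchar) (separating_conj fsep)).
by rewrite sqrtr_sqr ger0_norm ?cabs_ge0.
Qed.

Let tau_inversion n : tau * f n = \sum_(1 <= a < q) g a * (w ^+ a) ^+ n.
Proof.
have := gauss_sumE q1 (natchar_conj fchar) (separating_conj fsep) n.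
rewrite conjcK mulrC => <-; rewrite /gauss_sum big_ltn //.
have -> : ((f 0%N)^*)%C = 0.
  rewrite (natchar_notcoprime fchar) ?rmorph0 //.
  by rewrite /coprime gcd0n; lia.
by rewrite mul0r add0r; apply: eq_bigr => a _; rewrite exprM.
Qed.

Let char0 : f 0%N = 0.
Proof. by rewrite (natchar_notcoprime fchar) // /coprime gcd0n; lia. Qed.

(** Jordan's inequality applies when a <= q/2, and after reflection to q - a otherwise; keeping both
    reciprocals makes one formula valid on the whole range. *)
Lemma unit_root_sub1_lower a : (0 < a < q)%N ->
  2 / cabs (w ^+ a - 1) <= q%:R / 2 * ((a%:R)^-1 + ((q - a)%:R)^-1).
Proof.
have jord b : (0 < b)%N -> (2 * b <= q)%N ->
    2 / (2 * `|sin (pi * b%:R / q%:R : R)|) <= q%:R / 2 * (b%:R)^-1.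
  move=> b0 bq; have pi0 := @pi_gt0 R.
  have qR : 0 < q%:R :> R by rewrite ltr0n.
  have bR : 0 < b%:R :> R by rewrite ltr0n.
  set u := pi * _ / _.
  have u0 : 0 < u by rewrite divr_gt0 // mulr_gt0.
  have up : u <= pi / 2.
    rewrite ler_pdivrMr // mulrAC ler_pdivlMr // -mulrA ler_pM2l //.
    by rewrite -natrM ler_nat mulnC.
  have J := jordan_sin u0 up.
  have s0 : 2 * b%:R / q%:R <= sin u.
    rewrite -(ler_pM2l pi0); apply: le_trans J; rewrite /u; lra.
  have sp : 0 < sin u by apply: lt_le_trans s0; rewrite divr_gt0 // mulr_gt0.
  rewrite gtr0_norm //.
  have -> : 2 / (2 * sin u) = (sin u)^-1 by field; rewrite lt0r_neq0.
  have -> : q%:R / 2 / b%:R = (2 * b%:R / q%:R)^-1 :> R by field; rewrite !lt0r_neq0.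
  by rewrite lef_pV2 ?posrE // divr_gt0 // mulr_gt0.
move=> aq; rewrite unit_root_sub1 // mulrDr.
have pos b : (0 : R) <= q%:R / 2 * (b%:R)^-1.
  by rewrite mulr_ge0 ?divr_ge0 ?invr_ge0 ?ler0n.
have [le|gt] := leqP (2 * a) q.
  by rewrite -[leLHS]addr0; apply: lerD; [apply: jord; lia | exact: pos].
have -> : sin (pi * a%:R / q%:R : R) = sin (pi * (q - a)%:R / q%:R).
  rewrite natrB; last by lia.
  have -> : pi * (q%:R - a%:R) / q%:R = - (pi * a%:R / q%:R) + pi :> R.
    by field; rewrite pnatr_eq0; lia.
  by rewrite sinDpi sinN opprK.
by rewrite -[leLHS]add0r; apply: lerD; [exact: pos | apply: jord; lia].
Qed.

(** After multiplication by the Gauss sum, of modulus sqrt q, the inner sums are geometric with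
    ratio [w ^+ a], hence at most 2 / |w^a - 1| in absolute value. *)
Lemma polya_vinogradov x :
  cabs (\sum_(0 <= n < x) f n) <= Num.sqrt q%:R * hsum q.
Proof.
rewrite -(ler_pM2l sqrtq_gt0) mulrA -expr2 sqr_sqrtr ?ler0n // -{1}abs_tau -cabsM.
have -> : tau * \sum_(0 <= n < x) f n =
    \sum_(1 <= a < q) g a * \sum_(0 <= n < x) (w ^+ a) ^+ n.
  rewrite mulr_sumr; under eq_bigr do rewrite tau_inversion.
  by rewrite exchange_big /=; apply: eq_bigr => a _; rewrite mulr_sumr.
apply: (le_trans (cabs_sum _ _ _)).
apply: (@le_trans _ _ (\sum_(1 <= a < q) q%:R / 2 * ((a%:R)^-1 + ((q - a)%:R)^-1))).
  rewrite big_nat_cond [leRHS]big_nat_cond; apply: ler_sum => a /andP[aq _].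
  rewrite cabsM cabsJ; apply: (@le_trans _ _ (2 / cabs (w ^+ a - 1))); last first.
    exact: unit_root_sub1_lower.
  have d0 : 0 < cabs (w ^+ a - 1).
    rewrite lt_neqAle cabs_ge0 andbT eq_sym; apply: contra (unit_root_sub1_neq0 R q0 aq).
    by move=> /eqP/cabs_eq0 ->.
  apply: (@le_trans _ _ (1 * cabs (\sum_(0 <= n < x) (w ^+ a) ^+ n))).
    by apply: ler_wpM2r; [exact: cabs_ge0 | exact: (natchar_abs_le1 fchar)].
  rewrite mul1r ler_pdivlMr // -cabsM mulrC big_mkord -subrX1.
  have aw : cabs w = 1.
    have := congr1 (@cabs R) (unit_root_order R q0).
    by rewrite cabsX cabs1 => /eqP; rewrite pexpr_eq1 ?cabs_ge0 // => /eqP.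
  by apply: (le_trans (cabsB _ _)); rewrite !cabsX aw !expr1n cabs1.
have le1 : \sum_(1 <= a < q) (a%:R : R)^-1 <= hsum q.
  by rewrite /hsum big_nat_recr //= lerDl invr_ge0 ler0n.
rewrite -mulr_sumr big_split /=.
have -> : \sum_(1 <= a < q) ((q - a)%:R : R)^-1 = \sum_(1 <= a < q) (a%:R)^-1.
  by rewrite [LHS]big_nat_rev /=; apply: eq_big_nat => i ir; congr (_%:R^-1); lia.
have qR : 0 <= q%:R :> R by rewrite ler0n.
rewrite -mulrA ler_wpM2l //; lra.
Qed.

Lemma char_tail_bound (x y : nat) : (0 < x)%N ->
  cabs (\sum_(x <= a < y) f a * (((a%:R)^-1)%:C)%C) <=
  2 * (Num.sqrt q%:R * hsum q) / x%:R.
Proof.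
move=> x0; have V0 : 0 <= Num.sqrt q%:R * hsum q.
  by rewrite mulr_ge0 ?sqrtr_ge0 ?hsum_ge0.
have [xy|yx] := ltnP x y; last first.
  by rewrite big_geq // cabs0; apply: divr_ge0; [exact: mulr_ge0 | exact: ler0n].
apply: abel_bound xy => [n xn|a _|a xa _].
- have -> : \sum_(x <= a < n) f a = \sum_(0 <= a < n) f a - \sum_(0 <= a < x) f a.
    by rewrite (@big_cat_nat _ _ _ x 0 n) //= addrAC subrr add0r.
  apply: (le_trans (cabsB _ _)).
  by have := polya_vinogradov n; have := polya_vinogradov x; lra.
- by rewrite invr_ge0 ler0n.
- by rewrite lef_pV2 ?posrE ?ltr0n ?ler_nat //; lia.
Qed.

Hypothesis qodd : odd q.
Hypothesis fodd : f q.-1 = -1.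

Let ang a : R := pi * a%:R / q%:R.

(** With u = pi a / q this is 1 / (e^(2 i u) - 1) = - 1/2 - (i/2) cot u. The real part is the same
    for a and q - a, so an odd character removes it. *)
Let inv_root_sub1 a : (0 < a < q)%N ->
  (w ^+ a - 1)^-1 = Complex (- 2^-1) (- (cos (ang a) / sin (ang a)) / 2).
Proof.
move=> aq; have pi0 := @pi_gt0 R.
have s0 : sin (ang a) != 0.
  apply/lt0r_neq0/sin_gt0_pi; rewrite /ang divr_gt0 ?mulr_gt0 ?ltr0n //=; last by lia.
  by rewrite ltr_pdivrMr ?ltr0n // ltr_pM2l // ltr_nat; lia.
apply: (mulfI (unit_root_sub1_neq0 R q0 aq)).
rewrite mulfV ?unit_root_sub1_neq0 // unit_rootX.
have -> : a%:R * (pi *+ 2 / q%:R) = ang a *+ 2 by rewrite /ang !mulr2n; ring.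
rewrite cos_mulr2n sin_mulr2n !mulr2n.
have cs := cos2Dsin2 (ang a); set c := cos _ in cs *; set s := sin _ in cs s0 *.
apply/eqP; rewrite eq_complex /=; apply/andP; split; apply/eqP.
  by field.
have -> : (c ^+ 2 + c ^+ 2 - 1 - 1) = - (s ^+ 2 + s ^+ 2) by lra.
by field.
Qed.

Let g_reflect a : (a <= q)%N -> g (q - a)%N = - g a.
Proof.
move=> aq; case: (fchar) => _ per mul nz; rewrite /g -rmorphN; congr (conjc _).
have -> : f (q - a)%N = f (q.-1 * a)%N.
  apply: (natchar_eqmod fchar); apply/eqP; rewrite -(eqn_modDr a) subnK // -mulSnr.
  by rewrite prednK // modnn modnMr.
by rewrite mul fodd mulN1r.
Qed.

(** Inserting the finite Fourier expansion of [f] turns the sum of n f(n) into q times the sum of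
    g(a) / (w^a - 1), up to [tau]; pairing a with q - a, where the odd [g] changes sign, leaves only
    cotangents over the half range. *)
Let sum_cot : cabs (\sum_(0 <= n < q) n%:R * f n) * Num.sqrt q%:R =
  q%:R * cabs (\sum_(1 <= a < q./2.+1) g a * ((cos (ang a) / sin (ang a))%:C)%C).
Proof.
rewrite mulrC -{1}abs_tau -cabsM.
have -> : tau * \sum_(0 <= n < q) n%:R * f n =
    q%:R * \sum_(1 <= a < q) g a * (w ^+ a - 1)^-1.
  rewrite mulr_sumr.
  under eq_bigr do rewrite mulrCA tau_inversion mulr_sumr.
  rewrite exchange_big /= mulr_sumr; apply: eq_big_nat => a aq.
  under eq_bigr do rewrite mulrCA.
  rewrite -mulr_sumr mulrCA; congr (_ * _).
  have nz := unit_root_sub1_neq0 R q0 aq.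
  apply: (mulfI nz); rewrite mulrCA mulfV // mulr1.
  have wq : (w ^+ a) ^+ q = 1 by rewrite exprAC (unit_root_order R q0) expr1n.
  have := weighted_geometric (w ^+ a) q; rewrite wq mulr1 => <-.
  rewrite [X in _ = _ + X](_ : _ = 0) ?addr0 //.
  under eq_bigr do rewrite exprS.
  by rewrite -mulr_sumr sum_root_of_unity ?mulr0 // -subr_eq0.
rewrite cabsM cabs_nat sum_half_split //.
congr (_ * _).
have -> : \sum_(1 <= a < q./2.+1) (g a * (w ^+ a - 1)^-1 +
      g (q - a)%N * (w ^+ (q - a) - 1)^-1) =
    (Complex 0 (- 1)) * \sum_(1 <= a < q./2.+1) g a * ((cos (ang a) / sin (ang a))%:C)%C.
  rewrite mulr_sumr; apply: eq_big_nat => a ar.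
  rewrite g_reflect; last by lia.
  rewrite !inv_root_sub1; [|lia|lia].
  have -> : ang (q - a) = - ang a + pi.
    by rewrite /ang natrB; [field; rewrite pnatr_eq0; lia | lia].
  rewrite sinDpi cosDpi sinN cosN opprK.
  set c := cos _; set s := sin _.
  rewrite [- g a * _]mulNr -mulrBr [RHS]mulrCA; congr (_ * _).
  apply/eqP; rewrite eq_complex /=; apply/andP; split; apply/eqP; first by ring.
  by rewrite !mulNr; move: (c / s) => t; field.
by rewrite cabsM /cabs /= expr0n add0r sqrrN expr1n sqrtr1 mul1r.
Qed.

(* [cot u] and [1 / u] differ by a bounded monotone function on (0, pi/2], so that the
   closed formula for the first moment is the truncated L-value up to lower order. *)
Lemma first_moment_lower N : (0 < N)%N ->
  Num.sqrt q%:R / pi * (cabs (\sum_(1 <= a < N.+1) f a * (((a%:R)^-1)%:C)%C)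
     - 2 * (Num.sqrt q%:R * hsum q) / (minn N q./2).+1%:R) - 2 * hsum q <=
  cabs (\sum_(0 <= n < q) n%:R * f n) / q%:R.
Proof.
move=> N0; have pi0 := @pi_gt0 R.
have qR : 0 < q%:R :> R by rewrite ltr0n.
have sq := sqrtq_gt0.
have V0 : 0 <= Num.sqrt q%:R * hsum q by rewrite mulr_ge0 ?hsum_ge0 ?sqrtr_ge0.
set V := Num.sqrt _ * _ in V0 *.
set h := q./2.
have qq : q%:R = Num.sqrt q%:R * Num.sqrt q%:R :> R by rewrite -expr2 sqr_sqrtr // ltW.
have hq : (h < q)%N by rewrite /h; lia.
pose Sg (n : nat) : C := \sum_(1 <= a < n) g a.
have Sg_le n : cabs (\sum_(1 <= a < n) g a) <= V.
  have [n1|n1] := leqP n 1; first by rewrite big_geq // cabs0.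
  have := polya_vinogradov n; rewrite big_ltn ?char0 ?add0r; last by lia.
  by rewrite -[in X in X -> _]cabsJ rmorph_sum.
pose T := \sum_(1 <= a < h.+1) f a * (((a%:R)^-1)%:C)%C.
have step1 : cabs (\sum_(1 <= a < N.+1) f a * (((a%:R)^-1)%:C)%C)
     - 2 * V / (minn N h).+1%:R <= cabs T.
  rewrite lerBlDr.
  have [Nh|hN] := leqP N h.
    have E : T = \sum_(1 <= a < N.+1) f a * (((a%:R)^-1)%:C)%C +
               \sum_(N.+1 <= a < h.+1) f a * (((a%:R)^-1)%:C)%C.
      by rewrite /T (@big_cat_nat _ _ _ N.+1).
    have := char_tail_bound h.+1 (ltn0Sn N); rewrite -/V => tl.
    have := cabsB T (\sum_(N.+1 <= a < h.+1) f a * (((a%:R)^-1)%:C)%C).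
    by rewrite {1}E addrK => /le_trans; apply; rewrite lerD2l.
  have -> : \sum_(1 <= a < N.+1) f a * (((a%:R)^-1)%:C)%C =
      T + \sum_(h.+1 <= a < N.+1) f a * (((a%:R)^-1)%:C)%C.
    by rewrite /T -(@big_cat_nat _ _ _ h.+1) //; lia.
  by apply: (le_trans (cabsD _ _)); rewrite lerD2l; exact: char_tail_bound.
have TJ : cabs T = cabs (\sum_(1 <= a < h.+1) g a * (((a%:R)^-1)%:C)%C).
  rewrite -[LHS]cabsJ /T rmorph_sum; congr cabs; apply: eq_bigr => a _.
  by rewrite rmorphM /= oppr0.
pose A : C := \sum_(1 <= a < h.+1) g a * ((cos (ang a) / sin (ang a))%:C)%C.
pose D : C := \sum_(1 <= a < h.+1) g a * ((cot_gap (ang a))%:C)%C.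
have angr a : (1 <= a < h.+1)%N -> 0 < ang a /\ ang a <= pi / 2.
  move=> ar; split; first by rewrite divr_gt0 ?mulr_gt0 ?ltr0n //; lia.
  rewrite /ang ler_pdivrMr // mulrAC ler_pdivlMr // -mulrA ler_pM2l //.
  by rewrite -natrM ler_nat; move: ar; rewrite /h; lia.
have AE : A = ((q%:R / pi)%:C)%C * (\sum_(1 <= a < h.+1) g a * (((a%:R)^-1)%:C)%C) - D.
  rewrite mulr_sumr -sumrB; apply: eq_big_nat => a ar.
  rewrite mulrCA -mulrBr -rmorphM -rmorphB /=; congr (_ * (real_complex R _)).
  rewrite /cot_gap opprB addrCA.
  have -> : q%:R / pi / a%:R - (ang a)^-1 = 0 :> R.
    have a0 : a%:R != 0 :> R by rewrite pnatr_eq0; lia.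
    have key (x y z : R) : x != 0 -> y != 0 -> z != 0 -> x / y / z - (y * z / x)^-1 = 0.
      by move=> *; field; apply/and3P.
    by apply: key a0; apply: lt0r_neq0.
  by rewrite addr0.
have [h0|h0] := posnP h; first by exfalso; rewrite /h in h0; lia.
(* [abel_bound] wants decreasing weights, whereas [cot_gap] increases within [0, 1]; so it is
   applied to 1 - [cot_gap], and the constant 1 costs one more [V]. *)
have DV : cabs D <= 2 * V.
  have -> : D = \sum_(1 <= a < h.+1) g a -
      \sum_(1 <= a < h.+1) g a * ((1 - cot_gap (ang a))%:C)%C.
    by rewrite -sumrB; apply: eq_bigr => a _; rewrite (rmorphB (real_complex R) 1) mulrBr mulr1 opprB addrC subrK.
  apply: (le_trans (cabsB _ _)).
  have -> : 2 * V = V + V by ring.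
  apply: lerD => //.
  have ab : cabs (\sum_(1 <= a < h.+1) g a * ((1 - cot_gap (ang a))%:C)%C) <=
      V * (1 - cot_gap (ang 1%N)).
    apply: (abel_bound (c := fun a => 1 - cot_gap (ang a))) => [n _|a ar|a a0 ah|]; last by lia.
    - exact: Sg_le.
    - by have [? ?] := angr a ar; rewrite subr_ge0; exact: cot_gap_le1.
    - have [? ?] : 0 < ang a /\ ang a <= pi / 2 by apply: angr; lia.
      have [? ?] : 0 < ang a.+1 /\ ang a.+1 <= pi / 2 by apply: angr; lia.
      rewrite lerB //; apply: cot_gap_ndecr => //.
      by rewrite /ang -!mulrA ler_pM2l // ler_pM2r ?invr_gt0 // ler_nat.
  apply: (le_trans ab); rewrite -[leRHS]mulr1 ler_wpM2l //.
  have [? ?] : 0 < ang 1%N /\ ang 1%N <= pi / 2 by apply: angr; lia.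
  by rewrite lerBlDr lerDl; exact: cot_gap_ge0.
have main : q%:R / pi * cabs T - 2 * V <= cabs A.
  rewrite AE; apply: le_trans (cabs_sub_le _ _).
  have qp : 0 <= q%:R / pi :> R by apply: divr_ge0; exact: ltW.
  rewrite cabsM cabs_real (ger0_norm qp) -TJ.
  exact: lerB.
have EA : cabs (\sum_(0 <= n < q) n%:R * f n) / q%:R = cabs A / Num.sqrt q%:R.
  apply: (mulIf (lt0r_neq0 sq)); rewrite divfK ?lt0r_neq0 // mulrAC sum_cot -/A.
  by rewrite mulrAC mulfV ?mul1r // lt0r_neq0.
rewrite EA ler_pdivlMr //.
apply: le_trans main; rewrite mulrBl lerB //; last first.
  by rewrite /V; lra.
rewrite mulrAC [Num.sqrt _ / pi * _]mulrAC -qq.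
by rewrite ler_wpM2l // divr_ge0 // ltW.
Qed.

End PolyaVinogradov.

(** * Conductors *)

Section Conductor.
Variable R : realType.
Local Notation C := R[i].

Lemma coprime_no_prime m n :
  (forall p, prime p -> (p %| m)%N -> (p %| n)%N -> False) -> (0 < n)%N -> coprime m n.
Proof.
move=> H n0; apply/negPn/negP => nc.
have g1 : (1 < gcdn m n)%N.
  by rewrite ltn_neqAle eq_sym nc gcdn_gt0 n0 orbT.
apply: (H (pdiv (gcdn m n))); first exact: pdiv_prime.
  by apply: dvdn_trans (pdiv_dvd _) (dvdn_gcdl _ _).
by apply: dvdn_trans (pdiv_dvd _) (dvdn_gcdr _ _).
Qed.

Lemma coprime_eqmod d a b : a = b %[mod d] -> coprime a d = coprime b d.
Proof. by move=> E; rewrite -coprime_modl E coprime_modl. Qed.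

Lemma lift_coprime d q n : (0 < q)%N -> (d %| q)%N -> coprime n d ->
  exists2 n', n' = n %[mod d] & coprime n' q.
Proof.
move=> q0 dq cop; have d0 : (0 < d)%N by apply: dvdn_gt0 dq.
pose e := partn q (\pi(d)^')%N.
have ce : coprime d e.
  by apply: (@pnat_coprime \pi(d)); [rewrite pnat_pi | exact: part_pnat].
exists (chinese d e n 1); first exact: chinese_modl.
apply: coprime_no_prime => // p pr pn pq.
have [pd|npd] := boolP (p %| d)%N.
  have : (p %| gcdn (chinese d e n 1) d)%N by rewrite dvdn_gcd pn.
  rewrite (eqP (_ : coprime _ d)) ?dvdn1; first by case: eqP pr => [->|].
  by rewrite (coprime_eqmod (b := n)) //; exact: chinese_modl.
have pe : (p %| e)%N.
  have : (p %| partn q (\pi(d)) * e)%N by rewrite partnC.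
  rewrite Euclid_dvdM // => /orP[] // /(pnat_dvd) /(_ (part_pnat _ _)).
  by rewrite pnatE // inE /= mem_primes pr d0 (negbTE npd).
have : (p %| gcdn (chinese d e n 1) e)%N by rewrite dvdn_gcd pn.
rewrite (eqP (_ : coprime _ e)) ?dvdn1; first by case: eqP pr => [->|].
rewrite (coprime_eqmod (b := 1%N)) ?coprime1n //; exact: chinese_modr.
Qed.

Lemma natchar_cancel q (f : nat -> C) a b : natchar q f -> coprime a q -> coprime b q ->
  f (a * b ^ (totient q).-1)%N = 1 -> f a = f b.
Proof.
move=> fc ca cb E; case: (fc) => q0 per mul nz.
have E2 : f (b * b ^ (totient q).-1)%N = 1.
  by rewrite -expnS prednK ?totient_gt0 // (natcharX fc) (natchar_totient fc cb).
have z : f (b ^ (totient q).-1)%N != 0 by rewrite nz coprimeXl.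
by apply: (mulIf z); rewrite -!mul E E2.
Qed.

(** The conductor is the least divisor [d] of [q] such that [f] is 1 on the units modulo [q]
    congruent to 1 modulo [d]. On units [f] then depends only on the class modulo [d], [f'] is its
    value at any lift coprime to [q], and minimality gives [separating]. *)
Lemma conductor_exists q (f : nat -> C) : natchar q f ->
  exists d f', [/\ (d %| q)%N, natchar d f', separating d f' &
    forall n, coprime n q -> f' n = f n].
Proof.
move=> fc; case: (fc) => q0 per mul nz.
pose P d := (d %| q)%N && `[< forall n, n = 1 %[mod d] -> coprime n q -> f n = 1 >].
have exP : exists d, P d.
  exists q; rewrite /P dvdnn /=; apply/asboolP => n n1 _.
  by rewrite (natchar_eqmod fc n1) (natchar1 fc).
case: (ex_minnP exP) => d /andP[dq /asboolP Pd] dmin.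
have d0 : (0 < d)%N by apply: dvdn_gt0 dq.
have wd a b : a = b %[mod d] -> coprime a q -> coprime b q -> f a = f b.
  move=> ab ca cb; apply: (natchar_cancel fc ca cb); apply: Pd.
    rewrite -modnMml ab modnMml -expnS prednK ?totient_gt0 //.
    rewrite -(modn_dvdm _ dq) Euler_exp_totient // modn_dvdm //.
  by rewrite coprimeMl ca coprimeXl.
pose L n n' := n' = n %[mod d] /\ coprime n' q.
have lifts n : {n' | coprime n d -> L n n'}.
  apply: cid; have [cop|nc] := boolP (coprime n d); last by exists 0%N.
  by have [n' ? ?] := lift_coprime q0 dq cop; exists n'.
pose f' n := if coprime n d then f (sval (lifts n)) else 0.
have copd n : coprime n q -> coprime n d by apply: coprime_dvdr.
have f'E n n' : coprime n d -> n' = n %[mod d] -> coprime n' q -> f' n = f n'.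
  move=> cop E cq; rewrite /f'; case: (lifts n) => n'' /= H; rewrite cop.
  by have [E2 cq2] := H cop; apply: wd => //; rewrite E E2.
have f'0 n : ~~ coprime n d -> f' n = 0.
  by move=> nc; rewrite /f'; case: (lifts n) => n'' /= _; rewrite (negbTE nc).
have f'q n : coprime n q -> f' n = f n by move=> cq; apply: f'E => //; exact: copd.
exists d, f'; split => //.
  split => // [n|m n|n].
  - have [cop|nc] := boolP (coprime n d); last first.
      by rewrite !f'0 // coprime_modl.
    have [n' E cq] := lift_coprime q0 dq cop.
    by rewrite !(f'E _ n') ?coprime_modl // modn_mod.
  - have [cop|nc] := boolP (coprime (m * n) d); last first.
      rewrite f'0 //; move: nc; rewrite coprimeMl negb_and.
      by move=> /orP[] /f'0->; rewrite ?mul0r ?mulr0.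
    move: (cop); rewrite coprimeMl => /andP[cm cn].
    have [m' Em cqm] := lift_coprime q0 dq cm.
    have [n' En cqn] := lift_coprime q0 dq cn.
    rewrite (f'E m m') // (f'E n n') // -mul; apply: f'E => //.
      by rewrite -modnMm Em En modnMm.
    by rewrite coprimeMl cqm.
  - have [cop|nc] := boolP (coprime n d); last by rewrite f'0 // eqxx.
    have [n' En cqn] := lift_coprime q0 dq cop.
    by rewrite (f'E _ n') // nz.
move=> e ed ltd; have eq := dvdn_trans ed dq.
have : ~~ P e by apply/negP => /dmin; rewrite leqNgt ltd.
rewrite /P eq /= => /asboolPn nall; apply: contrapT => H; apply: nall => n n1 cop.
apply: contrapT => fn; apply: H; exists n; split => //; first exact: copd.
by rewrite f'q //; apply/eqP.
Qed.

Lemma natcharM a b (f g : nat -> C) : coprime a b -> natchar a f -> natchar b g ->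
  natchar (a * b) (fun n => f n * g n).
Proof.
move=> cop fc gc; case: (fc) => a0 perf mulf nzf; case: (gc) => b0 perg mulg nzg.
split => [|n|m n|n]; first by rewrite muln_gt0 a0.
- rewrite (natchar_eqmod fc (b := n)) ?(natchar_eqmod gc (b := n)) //.
    by rewrite modn_dvdm // dvdn_mull.
  by rewrite modn_dvdm // dvdn_mulr.
- by rewrite mulf mulg mulrACA.
- by rewrite mulf_eq0 negb_or nzf nzg coprimeMr.
Qed.

(** A proper divisor of a b has a proper gcd with [a] or with [b]; a witness for that factor,
    extended by 1 modulo the other one, is congruent to 1 modulo the whole divisor. *)
Lemma separatingM a b (f g : nat -> C) : coprime a b -> natchar a f -> natchar b g ->
  separating a f -> separating b g -> separating (a * b) (fun n => f n * g n).
Proof.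
move=> cop fc gc fs gs e eab lt; case: (fc) => a0 _ _ _; case: (gc) => b0 _ _ _.
pose e1 := gcdn e a; pose e2 := gcdn e b.
have c12 : coprime e1 e2.
  by apply: (coprime_dvdl (dvdn_gcdr _ _)); apply: (coprime_dvdr (dvdn_gcdr _ _)).
have ee : (e %| e1 * e2)%N.
  rewrite /e1 /e2 muln_gcdr dvdn_gcd dvdn_mull //= muln_gcdl dvdn_gcd eab andbT.
  exact: dvdn_mulr.
have one n : n = 1 %[mod e1] -> n = 1 %[mod e2] -> n = 1 %[mod e].
  move=> H1 H2; have : n = 1 %[mod e1 * e2] by apply/eqP; rewrite chinese_remainder // H1 H2 !eqxx.
  by move=> H; rewrite -(modn_dvdm n ee) -(modn_dvdm 1 ee) H.
have dm d k n x : (d %| k)%N -> n = x %[mod k] -> n = x %[mod d].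
  by move=> dk E; rewrite -(modn_dvdm n dk) -(modn_dvdm x dk) E.
have e10 : (0 < e1)%N by rewrite gcdn_gt0 a0 orbT.
have e20 : (0 < e2)%N by rewrite gcdn_gt0 b0 orbT.
have [lt1|ge1] := ltnP e1 a.
  have [n [n1 cn fn]] := fs e1 (dvdn_gcdr _ _) lt1.
  pose N := chinese a b n 1.
  have NL : N = n %[mod a] by exact: chinese_modl.
  have NR : N = 1 %[mod b] by exact: chinese_modr.
  exists N; split.
  - by apply: one; [rewrite (dm _ _ _ _ (dvdn_gcdr _ _) NL) | exact: (dm _ _ _ _ (dvdn_gcdr _ _) NR)].
  - by rewrite coprimeMr (coprime_eqmod NL) cn (coprime_eqmod NR) coprime1n.
  - by rewrite (natchar_eqmod fc NL) (natchar_eqmod gc NR) (natchar1 gc) mulr1.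
have lt2 : (e2 < b)%N.
  rewrite ltnNge; apply/negP => ge2.
  have E1 : e1 = a by apply/eqP; rewrite eqn_leq ge1 andbT; apply: dvdn_leq (dvdn_gcdr _ _).
  have E2 : e2 = b by apply/eqP; rewrite eqn_leq ge2 andbT; apply: dvdn_leq (dvdn_gcdr _ _).
  have e0 : (0 < e)%N by case: (posnP e) eab => // ->; rewrite dvd0n muln_eq0; lia.
  have : (a * b %| e)%N by rewrite Gauss_dvd // -{1}E1 -{1}E2 !dvdn_gcdl.
  by move/(dvdn_leq e0); rewrite leqNgt lt.
have [n [n1 cn gn]] := gs e2 (dvdn_gcdr _ _) lt2.
pose N := chinese a b 1 n.
have NL : N = 1 %[mod a] by exact: chinese_modl.
have NR : N = n %[mod b] by exact: chinese_modr.
exists N; split.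
- by apply: one; [exact: (dm _ _ _ _ (dvdn_gcdr _ _) NL) | rewrite (dm _ _ _ _ (dvdn_gcdr _ _) NR)].
- by rewrite coprimeMr (coprime_eqmod NR) cn (coprime_eqmod NL) coprime1n.
- by rewrite (natchar_eqmod fc NL) (natchar_eqmod gc NR) (natchar1 fc) mul1r.
Qed.

Definition jacC (D n : nat) : C := (jac D n)%:~R.

Lemma natchar_jacC D : odd D -> natchar D (jacC D).
Proof.
move=> oD; split => [|n|m n|n]; first exact: odd_gt0.
- by rewrite /jacC jac_mod.
- by rewrite /jacC jacM // rmorphM.
- by rewrite /jacC intr_eq0 jac_coprime.
Qed.

Lemma separating_jac1 : separating 1 (jacC 1).
Proof. by move=> d; rewrite dvdn1 => /eqP->. Qed.

Lemma half_sign3 n : half_sign 3 n = (n %% 3 == 2)%N.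
Proof.
rewrite -half_sign_mod /half_sign; have := ltn_pmod n (isT : (0 < 3)%N).
by case: (n %% 3)%N => [|[|[|]]] // _; rewrite big_nat1.
Qed.

Lemma jac3 n : jac 3 n = (n %% 3 == 1)%N%:R - (n %% 3 == 2)%N%:R.
Proof.
rewrite /jac half_sign3 -coprime_modl; have := ltn_pmod n (isT : (0 < 3)%N).
by case: (n %% 3)%N => [|[|[|]]].
Qed.

Lemma separating_jac3 : separating 3 (jacC 3).
Proof.
move=> d d3 lt; have -> : d = 1%N.
  by move: d3; have : (d < 3)%N by []; case: d {lt} => [|[|[|]]].
exists 2%N; split => //.
by rewrite /jacC jac3 /= sub0r rmorphN rmorph1 -subr_eq0 -opprD oppr_eq0 -mulr2n pnatr_eq0.
Qed.

End Conductor.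

(** * Bounding the first moment by the largest partial sum *)

Section FirstMomentUpper.
Variable R : realType.
Local Notation C := R[i].

Lemma char_sum0 q (f : nat -> C) : (1 < q)%N -> natchar q f -> separating q f ->
  \sum_(0 <= n < q) f n = 0.
Proof.
move=> q1 fc fs; have := gauss_sumE q1 fc fs 0.
rewrite (natchar_notcoprime fc (n := 0%N)); last by rewrite /coprime gcd0n; lia.
rewrite rmorph0 mul0r => G; rewrite -[RHS]G /gauss_sum; apply: eq_bigr => a _.
by rewrite muln0 expr0 mulr1.
Qed.

(** As the complete sum vanishes, the sum of n f(n) over a period is minus the sum of [q] partial
    sums, and dividing by [q] leaves an average. *)
Lemma first_moment_le q (f : nat -> C) M : (1 < q)%N -> natchar q f -> separating q f ->
  (forall x, cabs (\sum_(0 <= n < x) f n) <= M) ->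
  cabs (\sum_(0 <= n < q) n%:R * f n) / q%:R <= M.
Proof.
move=> q1 fc fs HM; rewrite ler_pdivrMr ?ltr0n; last by lia.
have -> : \sum_(0 <= n < q) n%:R * f n = - \sum_(0 <= x < q) \sum_(0 <= n < x.+1) f n.
  have E : \sum_(0 <= x < q) \sum_(0 <= n < q) f n = 0.
    by under eq_bigr do rewrite char_sum0 //; rewrite big1.
  transitivity (\sum_(0 <= x < q) (\sum_(0 <= n < q) f n - \sum_(0 <= n < x.+1) f n));
    last by rewrite sumrB E sub0r.
  transitivity (\sum_(0 <= x < q) \sum_(0 <= n < q) (x < n)%N%:R * f n).
    rewrite exchange_big /=; apply: eq_big_nat => n nq.
    rewrite -mulr_suml -natr_sum; congr (_%:R * _).
    rewrite (@big_cat_nat _ _ _ n) /=; [|lia|lia].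
    rewrite [X in (_ = _ + X)%N]big_nat_cond [X in (_ = _ + X)%N]big1 ?addn0.
      rewrite (@eq_big_nat _ _ _ _ _ _ (fun=> 1%N)); first by rewrite sum_nat_const_nat subn0 muln1.
      by move=> i /andP[_ ->].
    by move=> i /andP[ir _]; case: ltnP => //; lia.
  apply: eq_big_nat => x xq.
  rewrite (@big_cat_nat _ _ _ x.+1 0 q) //= [X in _ = X - _](@big_cat_nat _ _ _ x.+1 0 q) //=.
  rewrite addrAC subrr add0r [X in X + _]big_nat_cond big1 ?add0r; last first.
    by move=> i /andP[ir _]; case: ltnP => //; [lia | rewrite mul0r].
  by apply: eq_big_nat => i ir; case: ltnP => //; [rewrite mul1r | lia].
rewrite cabsN; apply: (le_trans (cabs_sum _ _ _)).
apply: (@le_trans _ _ (\sum_(0 <= x < q) M)); first by apply: ler_sum => x _.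
by rewrite sumr_const_nat subn0 mulr_natr.
Qed.

Lemma sum_multiples (V : nmodType) (F : nat -> V) d x : (0 < d)%N ->
  \sum_(0 <= n < x | (d %| n)%N) F n = \sum_(0 <= b < (x + d.-1) %/ d) F (d * b)%N.
Proof.
move=> d0; elim: x => [|x IH].
  by rewrite add0n divn_small ?prednK // !big_geq.
rewrite big_mkcond big_nat_recr //= -big_mkcond /= IH.
have -> : (x.+1 + d.-1 = x + d)%N by lia.
case: ifP => dx.
  have [u ->] := dvdnP dx.
  rewrite divnMDl // divn_small ?prednK // addn0 -mulSnr mulnK //.
  by rewrite big_nat_recr //= mulnC.
rewrite addr0; congr bigop; congr index_iota.
have r0 : (0 < x %% d)%N by rewrite lt0n; move: dx; rewrite /dvdn => ->.
have rd := ltn_pmod x d0.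
have -> : (x + d.-1 = (x %/ d).+1 * d + (x %% d).-1)%N.
  by rewrite {1}(divn_eq x d) mulSn; lia.
rewrite divnMDl // (divn_small (m := (x %% d).-1)) ?addn0; last by lia.
by rewrite divnDr // divnn d0 addn1.
Qed.

Lemma sum_triple (V : nmodType) (F : nat -> V) q :
  \sum_(0 <= n < 3 * q) F n = \sum_(0 <= a < q) (F a + F (a + q)%N + F (a + 2 * q)%N).
Proof.
rewrite !big_split /= (@big_cat_nat _ _ _ q) /=; [|lia|lia].
rewrite (@big_cat_nat _ _ _ (2 * q) q) /=; [|lia|lia].
rewrite -addrA; congr (_ + (_ + _)).
  rewrite -{1}[q]add0n big_addn; congr bigop; congr index_iota; lia.
rewrite -{1}[(2 * q)%N]add0n big_addn; congr bigop; congr index_iota; lia.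
Qed.

(* Splitting the modulus [3q] into the three translates of [0, q[ turns the twisted
   first moment into a sum of [f] over [q, 2q[ restricted to multiples of [3]. *)
Lemma twisted_first_moment_le q (f : nat -> C) M : (1 < q)%N -> coprime 3 q ->
  natchar q f -> separating q f ->
  (forall x, cabs (\sum_(0 <= n < x) f n) <= M) ->
  cabs (\sum_(0 <= n < 3 * q) n%:R * (f n * jacC R 3 n)) / (3 * q)%:R <= 2 * M.
Proof.
move=> q1 c3 fc fs HM; case: (fc) => q0 per mul nz.
have perq a j : f (a + j * q)%N = f a by rewrite -per addnC modnMDl per.
have perq1 a : f (a + q)%N = f a by rewrite -(perq a 1%N) mul1n.
rewrite ler_pdivrMr ?ltr0n; last by lia.
have -> : \sum_(0 <= n < 3 * q) n%:R * (f n * jacC R 3 n) =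
   jacC R 3 q * (3 * q)%:R * \sum_(0 <= a < q | (3 %| a + q)%N) f a.
  rewrite sum_triple.
  transitivity (jacC R 3 q * q%:R * (3 * \sum_(0 <= a < q | (3 %| a + q)%N) f a -
      \sum_(0 <= a < q) f a)).
    rewrite [X in 3 * X]big_mkcond mulr_sumr -sumrB mulr_sumr; apply: eq_bigr => a _.
    rewrite perq perq1 /jacC (natrD _ a q) (natrD _ a (2 * q)%N) (natrM _ 2 q).
    have key : [/\ jac 3 a + jac 3 (a + q) + jac 3 (a + 2 * q) = 0 &
      jac 3 (a + q) + 2 * jac 3 (a + 2 * q) = jac 3 q * (3 * (3 %| a + q)%N%:R - 1)].
      have E1 : ((a + q) %% 3 = (a %% 3 + q %% 3) %% 3)%N by rewrite modnDm.
      have E2 : ((a + 2 * q) %% 3 = (a %% 3 + 2 * (q %% 3)) %% 3)%N.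
        by rewrite -[RHS]modnDmr modnMmr modnDm.
      rewrite !jac3 /dvdn E1 E2.
      have := ltn_pmod a (isT : (0 < 3)%N); have := ltn_pmod q (isT : (0 < 3)%N).
      have : (q %% 3 != 0)%N.
        by move: c3; rewrite prime_coprime.
      by case: (q %% 3)%N => [|[|[|]]] // _ _; case: (a %% 3)%N => [|[|[|]]].
    case: key => k1 k2.
    have K1 : (jac 3 a)%:~R + (jac 3 (a + q))%:~R + (jac 3 (a + 2 * q))%:~R = 0 :> C.
      by rewrite -!rmorphD k1 rmorph0.
    have K2 : (jac 3 (a + q))%:~R + 2 * (jac 3 (a + 2 * q))%:~R =
      (jac 3 q)%:~R * (3 * (3 %| a + q)%N%:R - 1) :> C.
      have := congr1 (fun z : int => z%:~R : C) k2.
      by rewrite !rmorphD !rmorphM rmorphB /= !rmorphM /= !rmorph_nat !rmorph1.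
    set j0 : C := (jac 3 a)%:~R in K1 *; set j1 : C := (jac 3 (a + q))%:~R in K1 K2 *.
    set j2 : C := (jac 3 (a + 2 * q))%:~R in K1 K2 *.
    have -> : a%:R * (f a * j0) + (a%:R + q%:R) * (f a * j1) + (a%:R + 2 * q%:R) * (f a * j2) =
      f a * (a%:R * (j0 + j1 + j2) + q%:R * (j1 + 2 * j2)) by ring.
    rewrite K1 K2; by case: (3 %| a + q)%N; rewrite /= ?mulr1n ?mulr0n; ring.
  by rewrite char_sum0 // natrM; ring.
have -> : \sum_(0 <= a < q | (3 %| a + q)%N) f a =
   \sum_(0 <= n < 2 * q | (3 %| n)%N) f n - \sum_(0 <= n < q | (3 %| n)%N) f n.
  rewrite [X in X - _](@big_cat_nat _ _ _ q) /=; [|lia|lia].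
  rewrite addrAC subrr add0r.
  have -> : \sum_(q <= n < 2 * q | (3 %| n)%N) f n =
      \sum_(0 + q <= n < 2 * q | (3 %| n)%N) f n by rewrite add0n.
  rewrite big_addn; have -> : (2 * q - q = q)%N by lia.
  by apply: eq_bigr => a _; rewrite perq1.
rewrite !cabsM cabs_nat !sum_multiples //.
(* Complete multiplicativity takes out [f 3], so a sum over multiples of 3 is again a partial sum;
   the range [q, 2q[ is a difference of two such sums, whence 2 M. *)
have B x : cabs (\sum_(0 <= b < x) f (3 * b)%N) <= M.
  under eq_bigr do rewrite mul.
  rewrite -mulr_sumr cabsM; apply: le_trans (HM x).
  by rewrite ler_piMl ?cabs_ge0 // (natchar_abs_le1 fc).
have j1 : cabs (jacC R 3 q) <= 1 by apply: (natchar_abs_le1 (natchar_jacC R (isT : odd 3))).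
have := cabsB (\sum_(0 <= b < (2 * q + 3.-1) %/ 3) f (3 * b)%N)
   (\sum_(0 <= b < (q + 3.-1) %/ 3) f (3 * b)%N).
move=> /le_trans/(_ (lerD (B _) (B _))) H.
rewrite -mulrA mulrCA.
have -> : 2 * M * (3 * q)%:R = (3 * q)%:R * (1 * (M + M)) by ring.
apply: ler_wpM2l; first exact: ler0n.
by apply: ler_pM => //; exact: cabs_ge0.
Qed.

End FirstMomentUpper.

(** * Primes congruent to 1 modulo k *)

Section CyclotomicValues.
Local Open Scope nat_scope.
Variable k : nat.
Hypothesis k2 : 2 <= k.
Let k0 : 0 < k := ltnW k2.

(** Evaluating at multiples of [k] keeps the value coprime to [k], since it divides (k n)^k - 1; all
    of its prime factors are then 1 modulo [k]. *)
Definition cyclo_val (n : nat) : nat := `|('Phi_k).[(k * n)%:Z]%R|%N.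

Lemma cyclo_val_dvd n : 0 < n -> cyclo_val n %| (k * n) ^ k - 1.
Proof.
move=> n0; have a0 : 0 < (k * n) ^ k by rewrite expn_gt0 muln_gt0 k0 n0.
have -> : (k * n) ^ k - 1 = `|(((k * n)%:Z) ^+ k - 1)%R|%N.
  have := natrB int a0; rewrite natrX !natz => <-.
  by rewrite absz_nat.
apply: (@dvdn_trans `|('X^k - 1 : {poly int}).[(k * n)%:Z]%R|%N); last first.
  by rewrite !hornerE.
rewrite -prod_Cyclotomic // (big_rem k) /=; last by rewrite -dvdn_divisors.
by rewrite hornerM abszM dvdn_mulr.
Qed.

(** Over the complex roots every factor |k n - z^j| is at least k n - 1 >= 1, so the single factor j
    = 1 already gives the bound. *)
Lemma cyclo_val_ge n : 0 < n -> n <= cyclo_val n.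
Proof.
move=> n0; set a := k * n.
have a2 : 2 <= a by rewrite /a; nia.
apply: (@leq_trans (a - 1)); first by rewrite /a; nia.
have [z prim_z] := C_prim_root_exists k0.
have nz : (`|z| = 1 :> algC)%R.
  have := congr1 Num.norm (prim_expr_order prim_z); rewrite normrX normr1 => /eqP.
  by rewrite pexpr_eq1 // => /eqP.
have E : (((cyclo_val n)%:R : algC) = `|(cyclotomic z k).[a%:R]|)%R.
  rewrite -(Cintr_Cyclotomic prim_z) /cyclo_val.
  rewrite -[in RHS](rmorph_nat (intr : int -> algC)) horner_map /= -intr_norm.
  by rewrite -abszE natz.
have le (j : nat) : ((a - 1)%:R <= `|(a%:R : algC) - z ^+ j|)%R.
  apply: (le_trans _ (lerB_dist _ _)).
  by rewrite normrX nz expr1n normr_nat natrB // ltnW.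
rewrite -(ler_nat algC) E /cyclotomic horner_prod normr_prod.
rewrite (bigD1 (Ordinal k2)) /=; last exact: coprime1n.
rewrite !hornerE; apply: (le_trans (le 1%N)); rewrite -[leLHS]mulr1 expr1.
apply: ler_pM; rewrite ?normr_ge0 ?ler01 ?expr1 //.
elim/big_rec : _ => // i x _ x1; rewrite !hornerE.
apply: mulr_ege1 => //; apply: le_trans (le i).
by rewrite ler1n; lia.
Qed.

(** As [p] does not divide [k], X^k - 1 is separable modulo [p], so a root of ['Phi_k] is a root of
    no other cyclotomic factor. The order of k n modulo [p] is therefore [k], and it divides p -
    1. *)
Lemma cyclo_val_prime n p : 0 < n -> prime p -> p %| cyclo_val n ->
  p = 1 %[mod k] /\ ~~ (p %| k).
Proof.
move=> n0 pr pF; have pd := dvdn_trans pF (cyclo_val_dvd n0).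
have a0 : 0 < (k * n) ^ k by rewrite expn_gt0 muln_gt0 k0 n0.
have pa : ~~ (p %| k * n).
  apply/negP => H; have H2 : p %| (k * n) ^ k by rewrite dvdn_exp.
  by move: pd; rewrite (dvdn_subr a0 H2) dvdn1; case: eqP pr => [->|].
have pk : ~~ (p %| k) by apply: contra pa => H; rewrite dvdn_mulr.
split => //.
have ch : p \in [pchar 'F_p]%R by rewrite pchar_Fp.
pose x : 'F_p := ((k * n)%:R)%R.
have xk : (x ^+ k = 1)%R.
  have : ((((k * n) ^ k - 1)%:R : 'F_p) == 0)%R by rewrite -(dvdn_pcharf ch).
  by rewrite natrB // subr_eq0 natrX => /eqP.
have [m prim_x mk] := prim_order_exists k0 xk.
have x0 : (x != 0)%R by rewrite -(dvdn_pcharf ch).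
have xp : (x ^+ p.-1 = 1)%R.
  apply: (mulfI x0); rewrite mulr1 -exprS prednK ?prime_gt0 //.
  by have := expf_card x; rewrite card_Fp.
have mp : m %| p.-1 by rewrite (prim_order_dvd prim_x) xp eqxx.
have [mk_eq|mk_ne] := eqVneq m k.
  apply/eqP; rewrite eqn_mod_dvd ?prime_gt0 // subn1 -mk_eq //.
pose intrp := map_poly (intr : int -> 'F_p).
have rootP : root (intrp 'Phi_k) x.
  rewrite /root /x -(rmorph_nat (intr : int -> 'F_p)) horner_map /=.
  rewrite natz [('Phi_k).[_]%R]intEsign rmorphM /= rmorph_sign mulf_eq0 signr_eq0 /=.
  by rewrite -[X in (X%:~R)%R]natz rmorph_nat -(dvdn_pcharf ch).
pose Q := (\prod_(d <- rem k (divisors k)) intrp 'Phi_d)%R.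
have PQ : (intrp 'Phi_k * Q = 'X^k - 1)%R.
  have : intrp (\prod_(d <- divisors k) 'Phi_d)%R = ('X^k - 1)%R.
    by rewrite prod_Cyclotomic // /intrp rmorphB /= rmorph1 map_polyXn.
  by rewrite (big_rem k) -?dvdn_divisors //= /intrp rmorphM rmorph_prod.
have sep : separable_poly ('X^k - 1 : {poly 'F_p})%R.
  by apply: separable_Xn_sub_1; rewrite -(dvdn_pcharf ch).
move: sep; rewrite -PQ separable_mul => /and3P[_ _ /coprimep_root /(_ rootP)].
have m0 : 0 < m by rewrite (dvdn_gt0 k0 mk).
have : ((intrp (\prod_(d <- divisors m) 'Phi_d)%R).[x] == 0)%R.
  rewrite prod_Cyclotomic // /intrp rmorphB /= rmorph1 map_polyXn !hornerE.
  by rewrite (prim_expr_order prim_x) subrr.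
rewrite /intrp rmorph_prod horner_prod prodf_seq_eq0 => /hasP[d dm /= d0].
rewrite /Q horner_prod prodf_seq_eq0 => /hasP[]; exists d => //.
rewrite mem_rem_uniq ?divisors_uniq // inE -!dvdn_divisors // in dm *.
rewrite (dvdn_trans dm mk) andbT; apply: contra mk_ne => /eqP dk.
by rewrite eqn_dvd mk -dk.
Qed.

End CyclotomicValues.

Section CyclotomicCount.
Local Open Scope nat_scope.
Variable k : nat.
Hypothesis k2 : 2 <= k.
Let k0 : 0 < k := ltnW k2.

(** Uniqueness in Hensel's lemma: (k m)^k - (k n)^k is k (m - n) times a sum congruent to k (k n)^(k
    - 1), a unit modulo [p]. *)
Lemma root_of_unity_lift p j n m : prime p -> ~~ (p %| k) -> 0 < j -> 0 < n -> 0 < m ->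
  p ^ j %| (k * n) ^ k - 1 -> p ^ j %| (k * m) ^ k - 1 ->
  k * n = k * m %[mod p] -> n = m %[mod p ^ j].
Proof.
move=> pr pk j0; wlog nm : n m / n <= m.
  move=> H n0 m0 dn dm E; have [le|lt] := leqP n m; first exact: H.
  by apply/esym/H => //; rewrite ?E // ltnW.
move=> n0 m0 dn dm E; apply/eqP; rewrite eq_sym eqn_mod_dvd //.
have ch : p \in [pchar 'F_p]%R by rewrite pchar_Fp.
have ppj : p %| p ^ j by rewrite dvdn_exp.
have a0 : 0 < (k * n) ^ k by rewrite expn_gt0 muln_gt0 k0 n0.
have le : (k * n) ^ k <= (k * m) ^ k by rewrite leq_exp2r // leq_mul2l nm orbT.
have d1 : p ^ j %| (k * m) ^ k - (k * n) ^ k.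
  by rewrite -{1}(subnK a0) addnC subnDA; apply: dvdn_sub.
move: d1; rewrite subn_exp -mulnBr -mulnA Gauss_dvdr; last first.
  by rewrite coprimeXl // prime_coprime.
rewrite mulnC Gauss_dvdr //.
rewrite coprimeXl // prime_coprime // (dvdn_pcharf ch) natr_sum.
have xE : ((k * m)%:R = (k * n)%:R :> 'F_p)%R.
  have mp x : ((x %% p)%:R = x%:R :> 'F_p)%R.
    by rewrite {2}(divn_eq x p) natrD natrM pchar_Fp_0 // mulr0 add0r.
  by rewrite -mp -E mp.
rewrite (eq_bigr (fun=> ((k * n)%:R ^+ k.-1 : 'F_p)%R)); last first.
  move=> i _; rewrite natrM !natrX xE -exprD subnK //.
  by rewrite -ltnS prednK.
rewrite sumr_const card_ord -[X in (X == 0)%R]mulr_natr mulf_eq0 -(dvdn_pcharf ch) (negbTE pk) orbF.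
have x0 : ((k * n)%:R != 0 :> 'F_p)%R.
  rewrite -(dvdn_pcharf ch); apply/negP => H.
  have H2 : p %| (k * n) ^ k by rewrite dvdn_exp.
  have := dvdn_trans ppj dn.
  by rewrite (dvdn_subr a0 H2) dvdn1; case: eqP pr => [->|].
by rewrite expf_eq0 (negbTE x0) andbF.
Qed.

(** At most [k] classes modulo [p] are possible, each lifts to at most one class modulo [p ^ j], and
    a class meets [1, T] at most T / p^j + 1 times. *)
Lemma count_cyclo_val p j T : prime p -> ~~ (p %| k) -> 0 < j ->
  count (fun n => p ^ j %| cyclo_val k n) (iota 1 T) <= k * (T %/ p ^ j).+1.
Proof.
move=> pr pk j0; set A := [seq n <- iota 1 T | p ^ j %| cyclo_val k n].
have ch : p \in [pchar 'F_p]%R by rewrite pchar_Fp.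
have q0 : 0 < p ^ j by rewrite expn_gt0 prime_gt0.
have AP n : n \in A -> [/\ 0 < n, n <= T & p ^ j %| (k * n) ^ k - 1].
  rewrite mem_filter mem_iota => /andP[d /andP[n0]].
  rewrite add1n ltnS => nT; split => //.
  exact: dvdn_trans d (cyclo_val_dvd k2 n0).
rewrite -size_filter -/A.
pose res := undup [seq n %% p ^ j | n <- A].
have sres : size res <= k.
  pose f r : 'F_p := ((k * r)%:R)%R.
  have mp x : ((x %% p)%:R = x%:R :> 'F_p)%R.
    by rewrite {2}(divn_eq x p) natrD natrM pchar_Fp_0 // mulr0 add0r.
  have fmod n : f (n %% p ^ j) = f n.
    rewrite /f !natrM; congr (_ * _)%R.
    by rewrite -mp modn_dvdm ?mp // dvdn_exp.
  have -> : size res = size (map f res) by rewrite size_map.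
  apply: (@max_unity_roots _ k _ k0).
    apply/allP => x /mapP[r]; rewrite mem_undup => /mapP[n nA ->] ->.
    have [n0 _ dn] := AP n nA; rewrite unity_rootE fmod /f -natrX.
    have a0 : 0 < (k * n) ^ k by rewrite expn_gt0 muln_gt0 k0 n0.
    have : p %| (k * n) ^ k - 1 by apply: dvdn_trans dn; rewrite dvdn_exp.
    by rewrite (dvdn_pcharf ch) natrB // subr_eq0.
  rewrite map_inj_in_uniq ?undup_uniq // => r s.
  rewrite !mem_undup => /mapP[n nA ->] /mapP[m mA ->]; rewrite !fmod => E.
  have [n0 _ dn] := AP n nA; have [m0 _ dm] := AP m mA.
  apply: root_of_unity_lift dn dm _ => //.
  apply/eqP; move: E; rewrite /f => /(congr1 val) /=.
  by rewrite !val_Fp_nat // => ->.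
apply: (@leq_trans (size res * (T %/ p ^ j).+1)); last by rewrite leq_mul2r sres orbT.
rewrite -(size_iota 0 (T %/ p ^ j).+1) -(size_allpairs pair).
rewrite -(size_map (fun n => (n %% p ^ j, n %/ p ^ j))).
apply: uniq_leq_size.
  rewrite map_inj_in_uniq ?filter_uniq ?iota_uniq // => n m _ _ [E1 E2].
  by rewrite (divn_eq n (p ^ j)) E1 E2 -divn_eq.
move=> x /mapP[n nA ->]; apply/allpairsP; exists (n %% p ^ j, n %/ p ^ j); split => //.
  by rewrite mem_undup; apply: (map_f (fun n => n %% p ^ j)).
by rewrite mem_iota add0n ltnS leq_div2r //; have [] := AP n nA.
Qed.

End CyclotomicCount.

(** * Sums of logarithms over primes *)

Section LogSums.
Local Open Scope ring_scope.
Variable R : realType.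

Lemma ln_nat_prod (P : seq nat) F : (0 < F)%N -> uniq P -> all prime P ->
  {subset primes F <= P} ->
  ln (F%:R : R) = \sum_(p <- P) (logn p F)%:R * ln (p%:R : R).
Proof.
move=> F0 uP prP sub.
have prp p : p \in P -> prime p by move/(allP prP).
rewrite (bigID (fun p => p \in primes F)) /= [X in _ + X]big1 ?addr0; last first.
  move=> p np; rewrite -(@logn_gt0 p F) lt0n negbK in np.
  by rewrite (eqP np) mul0r.
rewrite -big_filter (perm_big (primes F)); last first.
  apply: uniq_perm; rewrite ?filter_uniq ?primes_uniq // => p.
  by rewrite mem_filter; case: (boolP (p \in primes F)) => // /sub ->.
rewrite {1}(prod_prime_decomp F0) prime_decompE big_map /= natr_prod.
have : all prime (primes F) by apply/allP => p; rewrite mem_primes => /and3P[].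
elim: (primes F) => [|p s IH] /=; first by rewrite !big_nil ln1.
move=> /andP[pp E0]; have E := IH E0; rewrite !big_cons lnM ?E ?posrE; last 2 first.
- by rewrite ltr0n expn_gt0 prime_gt0.
- by rewrite -natr_prod ltr0n big_seq prodn_cond_gt0 // => q /(allP E0)/prime_gt0; rewrite expn_gt0 => ->.
by rewrite natrX lnXn ?ltr0n ?prime_gt0 // mulr_natl.
Qed.

Lemma hsum_le_ln n : (0 < n)%N -> hsum R n <= 1 + ln (n%:R : R).
Proof.
elim: n => // -[_ _|n IH _]; first by rewrite /hsum big_nat1 ln1 addr0 invr1.
rewrite /hsum big_nat_recr //= -/(hsum R n.+1).
apply: (le_trans (lerD (IH isT) (lexx _))); rewrite -addrA lerD2l.
have a : 0 < n.+1%:R :> R by rewrite ltr0n.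
have b : 0 < n.+2%:R :> R by rewrite ltr0n.
have := @le_ln1Dx R (- (n.+2%:R)^-1).
have -> : 1 + - (n.+2%:R)^-1 = n.+1%:R / n.+2%:R :> R.
  have -> : n.+2%:R = n.+1%:R + 1 :> R by rewrite natr1.
  by move: (n.+1%:R : R) a => t t0; field; rewrite lt0r_neq0 // addr_gt0.
rewrite ln_div ?posrE // ltrN2 invf_lt1 // ltr1n => /(_ isT).
by rewrite -opprB lerN2 lerBrDr addrC.
Qed.

Lemma geometric_le p J : (2 <= p)%N ->
  \sum_(1 <= j < J.+1) ((p ^ j)%:R : R)^-1 <= (p%:R - 1)^-1.
Proof.
move=> p2; have p1 : 0 < p%:R - 1 :> R by rewrite subr_gt0 ltr1n.
have p0 : 0 < p%:R :> R by rewrite ltr0n; lia.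
suff E : \sum_(1 <= j < J.+1) ((p ^ j)%:R : R)^-1 = (1 - ((p ^ J)%:R)^-1) / (p%:R - 1).
  rewrite E ler_pdivrMr // mulVf ?lt0r_neq0 // gerBl invr_ge0 ler0n //.
elim: J => [|J IH]; first by rewrite big_geq // expn0 invr1 subrr mul0r.
have pJ : (p ^ J)%:R != 0 :> R by rewrite pnatr_eq0 expn_eq0; lia.
rewrite big_nat_recr //= IH expnS natrM; field.
by rewrite pJ !lt0r_neq0.
Qed.

(** The bound depends on the primes only through their number. Those up to Z^2 have distinct
    predecessors and give a harmonic sum; beyond Z^2, ln p <= 2 sqrt p bounds each term by 4 / Z,
    and there are at most [Z] of them. *)
Lemma sum_ln_div_primes_le (P : seq nat) Z : uniq P -> all prime P -> (0 < Z)%N ->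
  (size P <= Z)%N ->
  \sum_(p <- P) ln (p%:R : R) / (p%:R - 1) <=
    ln ((Z ^ 2)%:R) * (1 + ln ((Z ^ 2)%:R)) + 4.
Proof.
move=> uP prP Z0 sP; set L : R := ln _.
have L0 : 0 <= L by rewrite ln_ge0 // ler1n expn_gt0 Z0.
have prp p : p \in P -> (2 <= p)%N by move/(allP prP)/prime_gt1.
have pos p : p \in P -> 0 < p%:R - 1 :> R by move/prp => p2; rewrite subr_gt0 ltr1n.
rewrite (bigID (fun p => (p <= Z ^ 2)%N)) /=; apply: lerD.
  apply: (@le_trans _ _ (\sum_(p <- [seq p <- P | (p <= Z ^ 2)%N]) L * (p.-1%:R)^-1)).
    rewrite big_filter big_seq_cond [leRHS]big_seq_cond; apply: ler_sum => p /andP[pP le].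
    have p2 := prp p pP.
    rewrite -subn1 natrB; last by lia.
    apply: ler_wpM2r; first by rewrite invr_ge0 ltW // pos.
    by rewrite /L ler_ln ?posrE ?ltr0n ?expn_gt0 ?Z0 ?ler_nat //; lia.
  rewrite -mulr_sumr; apply: ler_wpM2l => //.
  apply: (@le_trans _ _ (hsum R (Z ^ 2))); last by apply: hsum_le_ln; rewrite expn_gt0 Z0.
  rewrite -(big_map predn xpredT (fun i => (i%:R : R)^-1)).
  set Q := map _ _.
  have uQ : uniq Q.
    rewrite map_inj_in_uniq ?filter_uniq // => p q.
    by rewrite !mem_filter => /andP[_ /prp p2] /andP[_ /prp q2]; lia.
  have sQ q : q \in Q -> q \in index_iota 1 (Z ^ 2).+1.
    move=> /mapP[p]; rewrite mem_filter => /andP[le /prp p2] ->.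
    by rewrite mem_index_iota; lia.
  rewrite /hsum [leRHS](bigID (fun q => q \in Q)) /= -[leLHS]addr0; apply: lerD.
    rewrite -[leRHS]big_filter (perm_big [seq q <- index_iota 1 (Z ^ 2).+1 | q \in Q]) //.
    apply: uniq_perm; rewrite ?filter_uniq ?iota_uniq // => q.
    by rewrite mem_filter; case: (boolP (q \in Q)) => // /sQ ->.
  by apply: sumr_ge0 => q _; rewrite invr_ge0 ler0n.
apply: (@le_trans _ _ (\sum_(p <- P) 4 / Z%:R)).
  rewrite big_mkcond big_seq [leRHS]big_seq; apply: ler_sum => p pP.
  have Zp : 0 <= 4 / Z%:R :> R by rewrite divr_ge0 ?ler0n.
  case: ifP => //; rewrite -ltnNge => lt.
  have p0 : 0 < p%:R :> R by rewrite ltr0n; have := prp p pP; lia.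
  have s0 : 0 < Num.sqrt p%:R :> R by rewrite sqrtr_gt0.
  have ps : p%:R = Num.sqrt p%:R ^+ 2 :> R by rewrite sqr_sqrtr // ltW.
  have l1 : ln (p%:R : R) <= 2 * Num.sqrt p%:R.
    rewrite {1}ps lnXn // mulr2n; have := ln_sublinear s0; lra.
  have l2 : p%:R / 2 <= p%:R - 1 :> R.
    by have : 2 <= p%:R :> R by [rewrite ler_nat; exact: prp]; lra.
  have l3 : Z%:R <= Num.sqrt p%:R :> R.
    rewrite -(@ler_pXn2r _ 2) ?nnegrE ?ler0n ?sqrtr_ge0 // -ps -natrX ler_nat.
    exact: ltnW.
  rewrite ler_pdivrMr ?pos //; apply: (le_trans l1).
  have Z0' : 0 < Z%:R :> R by rewrite ltr0n.
  rewrite mulrAC ler_pdivlMr //.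
  have : Num.sqrt p%:R * Z%:R <= p%:R :> R by rewrite {2}ps expr2 ler_pM2l.
  lra.
rewrite big_const_seq count_predT iter_addr_0 -[leLHS]mulr_natr mulrAC.
rewrite ler_pdivrMr ?ltr0n // ler_pM2l // ler_nat //.
Qed.

End LogSums.

Section PrimesOneModK.
Variable R : realType.
Variable k : nat.
Hypothesis k2 : (2 <= k)%N.
Let k0 : (0 < k)%N := ltnW k2.

Lemma logn_sum p F J : prime p -> (0 < F)%N -> (logn p F <= J)%N ->
  logn p F = (\sum_(1 <= j < J.+1) (p ^ j %| F))%N.
Proof.
move=> pr F0 le; rewrite (@big_cat_nat _ _ _ (logn p F).+1) //=.
rewrite (@eq_big_nat _ _ _ _ _ _ (fun=> 1%N)); last first.
  by move=> j /andP[_]; rewrite ltnS pfactor_dvdn // => ->.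
rewrite sum_nat_const_nat subn1 muln1 big_nat_cond big1 ?addn0 //.
by move=> j /andP[/andP[lt _] _]; rewrite pfactor_dvdn // leqNgt lt.
Qed.

(** The exponent of [p] in the product of the values is summed over the powers p^j <= B with
    [count_cyclo_val]: the parts T / p^j form a geometric series, and the summands 1 total at most k
    ln B for each prime. *)
Lemma sum_ln_cyclo_upper (P : seq nat) T B : uniq P ->
  (forall p, p \in P -> prime p /\ ~~ (p %| k)%N) -> (0 < B)%N ->
  (forall n, (0 < n <= T)%N -> {subset primes (cyclo_val k n) <= P} /\
     (cyclo_val k n <= B)%N) ->
  \sum_(1 <= n < T.+1) ln ((cyclo_val k n)%:R : R) <=
    k%:R * T%:R * (\sum_(p <- P) ln (p%:R : R) / (p%:R - 1)) +
    k%:R * (size P)%:R * ln (B%:R : R).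
Proof.
move=> uP prP B0 HF.
have B1 : 0 <= ln (B%:R : R) by rewrite ln_ge0 // ler1n.
have Fpos n : (0 < n)%N -> (0 < cyclo_val k n)%N.
  by move=> n0; exact: leq_trans n0 (cyclo_val_ge k2 n0).
have -> : \sum_(1 <= n < T.+1) ln ((cyclo_val k n)%:R : R) =
    \sum_(p <- P) (\sum_(1 <= n < T.+1) logn p (cyclo_val k n))%:R * ln (p%:R : R).
  transitivity (\sum_(1 <= n < T.+1) \sum_(p <- P)
      (logn p (cyclo_val k n))%:R * ln (p%:R : R)).
    apply: eq_big_nat => n /andP[n0 nT]; apply: ln_nat_prod => //; first exact: Fpos.
      by apply/allP => p /prP[].
    by have [] := HF n; rewrite ?n0.
  by rewrite exchange_big /=; apply: eq_bigr => p _; rewrite natr_sum mulr_suml.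
have -> : k%:R * (size P)%:R * ln (B%:R : R) = \sum_(p <- P) k%:R * ln (B%:R : R).
  by rewrite big_const_seq count_predT iter_addr_0 -[RHS]mulr_natr mulrAC.
rewrite mulr_sumr -big_split /= big_seq [leRHS]big_seq; apply: ler_sum => p pP.
have [pr pk] := prP p pP; have p1 := prime_gt1 pr.
have p0R : 0 < p%:R :> R by rewrite ltr0n prime_gt0.
have p1R : 0 < p%:R - 1 :> R by rewrite subr_gt0 ltr1n.
have lp0 : 0 <= ln (p%:R : R) by rewrite ln_ge0 // ler1n prime_gt0.
pose J := trunc_log p B.
have JB : J%:R * ln (p%:R : R) <= ln (B%:R : R).
  rewrite mulr_natl -lnXn // -natrX ler_ln ?posrE ?ltr0n ?expn_gt0 ?(prime_gt0 pr) //.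
  by rewrite ler_nat trunc_logP.
have S : (\sum_(1 <= n < T.+1) logn p (cyclo_val k n) <=
    \sum_(1 <= j < J.+1) k * (T %/ p ^ j).+1)%N.
  have -> : (\sum_(1 <= n < T.+1) logn p (cyclo_val k n) =
     \sum_(1 <= n < T.+1) \sum_(1 <= j < J.+1) (p ^ j %| cyclo_val k n))%N.
    apply: eq_big_nat => n /andP[n0 nT]; apply: logn_sum => //; first exact: Fpos.
    apply: trunc_log_max => //; have nr : (0 < n <= T)%N by rewrite n0.
    have [_ le] := HF n nr; apply: leq_trans le; have F0 := Fpos n n0.
    by apply: dvdn_leq => //; rewrite pfactor_dvdn.
  rewrite exchange_big /= big_nat_cond [leqRHS]big_nat_cond.
  apply: leq_sum => j /andP[/andP[j0 _] _].
  have := @count_cyclo_val k k2 p j T pr pk j0.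
  by rewrite -sum1_count big_mkcond /= /index_iota subn1.
apply: (@le_trans _ _ ((\sum_(1 <= j < J.+1) k * (T %/ p ^ j).+1)%N%:R * ln (p%:R : R))).
  by apply: ler_wpM2r => //; rewrite ler_nat.
apply: (@le_trans _ _ ((k%:R * T%:R * (p%:R - 1)^-1 + k%:R * J%:R) * ln (p%:R : R))).
  apply: ler_wpM2r => //; rewrite natr_sum.
  apply: (@le_trans _ _ (\sum_(1 <= j < J.+1) (k%:R * T%:R * ((p ^ j)%:R)^-1 + k%:R))).
    apply: ler_sum => j _; rewrite natrM -natr1 mulrDr mulr1 lerD2r -mulrA.
    rewrite ler_wpM2l ?ler0n // ler_pdivlMr ?ltr0n ?expn_gt0 ?prime_gt0 //.
    by rewrite -natrM ler_nat leq_trunc_div.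
  rewrite big_split /= -mulr_sumr sumr_const_nat subn1 -[k%:R *+ _]mulr_natr lerD2r.
  by rewrite ler_wpM2l ?mulr_ge0 ?ler0n // geometric_le.
rewrite mulrDl; apply: lerD; first by rewrite -!mulrA [_^-1 * _]mulrC.
by rewrite -mulrA ler_wpM2l ?ler0n.
Qed.

Lemma ln2_bounds : 1 / 2 <= ln (2 : R) /\ ln (2 : R) <= 1.
Proof.
split.
  have := @le_ln1Dx R (- (1 / 2)); have -> : 1 + - (1 / 2) = 2^-1 :> R by field.
  by rewrite lnV ?posrE // lerN2 => -> //; lra.
have := @le_ln1Dx R 1; have -> : 1 + 1 = 2 :> R by ring.
by move=> -> //; lra.
Qed.

Lemma sum_ln_lower E : 
  (2 ^ E)%:R * (E%:R * ln (2 : R)) <= \sum_(1 <= n < (2 ^ E.+1).+1) ln (n%:R : R).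
Proof.
have p : (0 < 2 ^ E)%N by rewrite expn_gt0.
rewrite (@big_cat_nat _ _ _ (2 ^ E).+1) //=; last by rewrite ltnS leq_exp2l.
rewrite -[leLHS]add0r; apply: lerD.
  by rewrite big_nat_cond; apply: sumr_ge0 => n /andP[/andP[n0 _] _]; rewrite ln_ge0 // ler1n.
have -> : (2 ^ E)%:R * (E%:R * ln (2 : R)) = \sum_((2 ^ E).+1 <= n < (2 ^ E.+1).+1) (ln ((2 ^ E)%:R : R)).
  rewrite sumr_const_nat subSS expnS mul2n -addnn addnK natrX lnXn // mulr_natl.
  by rewrite -[RHS]mulr_natl natrX.
apply: ler_sum_nat => n /andP[n0 _].
by rewrite ler_ln ?posrE ?ltr0n ?ler_nat //; [exact: ltnW | exact: leq_trans n0].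
Qed.

Lemma expn_growth l : (100 <= l)%N -> (k <= l)%N ->
  (k * 2 ^ (3 * l + 4) * (k * (l + l ^ 3)) <= 2 ^ (l ^ 3).-1)%N.
Proof.
move=> l100 kl.
have l0 : (0 < l)%N by apply: leq_trans l100.
have l2 := ltnW (ltn_expl l (isT : 1 < 2)%N).
apply: (@leq_trans (l * 2 ^ (3 * l + 4) * (l * (2 * l ^ 3)))).
  apply: leq_mul; [exact: leq_mul | apply: leq_mul => //].
  by rewrite mul2n -addnn leq_add2r -{1}[l]expn1 leq_pexp2l.
apply: (@leq_trans (2 ^ l * 2 ^ (3 * l + 4) * (2 ^ l * (2 * (2 ^ l) ^ 3)))).
  apply: leq_mul; [exact: leq_mul | apply: leq_mul => //].
  by apply: leq_mul => //; rewrite leq_exp2r.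
rewrite -expnM -expnS -!expnD leq_exp2l //.
have : (l * 100 <= l ^ 3)%N.
  by rewrite expnS leq_mul2l; apply/orP; right; apply: leq_trans l100 _; rewrite -{1}[l]expn1 leq_pexp2l.
clear l2; move: (l ^ 3)%N => e; lia.
Qed.

(** The left side grows like x^3 and the right side like K x^2 with K <= x / 2000, so the cubic
    terms compare as 1/2 against 72 / 2000. This is where the constant in 2000 k <= l is spent. *)
Lemma cubic_gap (x K L : R) : 1 / 2 <= L -> 100 <= x -> 2000 * K <= x ->
  (x ^+ 3 - 1) * L <= 2 * (K * ((6 * x + 8) * (1 + (6 * x + 8)) + 4)) + 1 -> False.
Proof.
move=> hL x100 xK.
have x2 : 100 * x <= x ^+ 2 by rewrite expr2 ler_wpM2r //; lra.
have x3 : 100 * x ^+ 2 <= x ^+ 3.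
  by rewrite [x ^+ 3]exprS; apply: ler_wpM2r => //; exact: sqr_ge0.
have h1 : (x ^+ 3 - 1) / 2 <= (x ^+ 3 - 1) * L.
  by rewrite -[_ / 2]/(_ * 2^-1); apply: ler_wpM2l; lra.
have h2 : K * (36 * x ^+ 2 + 102 * x + 76) <= (x / 2000) * (36 * x ^+ 2 + 102 * x + 76).
  by apply: ler_wpM2r; lra.
have -> : 2 * (K * ((6 * x + 8) * (1 + (6 * x + 8)) + 4)) = 2 * (K * (36 * x ^+ 2 + 102 * x + 76)).
  by ring.
have e : (x / 2000) * (36 * x ^+ 2 + 102 * x + 76) = (36 * x ^+ 3 + 102 * x ^+ 2 + 76 * x) / 2000.
  by rewrite exprS; field.
rewrite e in h2; lra.
Qed.

(* Too few such primes could not carry the factorization of the product of the values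
   [Phi_k (k n)] for [n <= 2 ^ (l ^ 3)]. *)
Lemma many_primes_one_mod l y : (2000 * k <= l)%N -> (y < 2 ^ l.+1)%N ->
  exists s : seq nat, [/\ uniq s, size s = (k * y.+1)%N &
    forall p, p \in s -> [/\ prime p, p = 1 %[mod k], (y ^ 3 < p)%N &
      (p <= (k * 2 ^ (l ^ 3)) ^ k)%N]].
Proof.
move=> kl yl.
pose T := (2 ^ (l ^ 3))%N; pose B := ((k * T) ^ k)%N.
pose P := [seq p <- iota 0 B.+1 | prime p && (p == 1 %[mod k])%N].
have uP : uniq P by rewrite filter_uniq // iota_uniq.
pose s0 := [seq p <- P | (y ^ 3 < p)%N].
have [big|small] := leqP (k * y.+1)%N (size s0).
  exists (take (k * y.+1) s0); split; first by rewrite take_uniq // filter_uniq.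
    exact: size_takel.
  move=> p /mem_take; rewrite !mem_filter mem_iota => /and3P[yp /andP[pr /eqP p1] /andP[_]].
  by rewrite add0n ltnS.
exfalso.
have l100 : (100 <= l)%N by apply: leq_trans kl; lia.
have kl1 : (k <= l)%N by apply: leq_trans kl; lia.
have T0 : (0 < T)%N by rewrite expn_gt0.
have B0 : (0 < B)%N by rewrite expn_gt0 muln_gt0 k0 T0.
(* Twice 2^(3 l + 3), which bounds both y^3 + 1 and k (y + 1). *)
pose Z := (2 ^ (3 * l + 4))%N.
have Z0 : (0 < Z)%N by rewrite expn_gt0.
have sPZ : (size P <= Z)%N.
  have -> : size P = (size s0 + size [seq p <- P | (p <= y ^ 3)%N])%N.
    rewrite -(count_predC (fun p => y ^ 3 < p)%N P) !size_filter; congr (_ + _)%N.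
    by apply: eq_count => p /=; rewrite -leqNgt.
  have c1 : (size [seq p <- P | (p <= y ^ 3)%N] <= (y ^ 3).+1)%N.
    rewrite -(size_iota 0 (y ^ 3).+1); apply: uniq_leq_size; first by rewrite filter_uniq.
    by move=> p; rewrite mem_filter mem_iota /= add0n ltnS => /andP[].
  have c2 : ((y ^ 3).+1 <= 2 ^ (3 * l + 3))%N.
    by rewrite -[(3 * l + 3)%N]/(3 * l + 3 * 1)%N -mulnDr addn1 mulnC expnM ltn_exp2r.
  have c3 : (k * y.+1 <= 2 ^ (3 * l + 3))%N.
    apply: (@leq_trans (2 ^ l * 2 ^ l.+1)).
      by apply: leq_mul => //; apply: leq_trans kl1 (ltnW (ltn_expl _ _)).
    by rewrite -expnD leq_exp2l //; lia.
  have -> : Z = (2 ^ (3 * l + 3) + 2 ^ (3 * l + 3))%N by rewrite addnn -mul2n -expnS -addnS.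
  apply: leq_add; first exact: leq_trans (ltnW small) c3.
  exact: leq_trans c1 c2.
have PP p : p \in P -> prime p /\ ~~ (p %| k)%N.
  rewrite mem_filter => /andP[/andP[pr /eqP p1] _]; split => //.
  apply/negP => /dvdnP[u ku]; have : (k %| p - 1)%N by rewrite -eqn_mod_dvd ?prime_gt0 //; apply/eqP.
  have p2 := prime_gt1 pr; move/dvdn_leq; rewrite subn_gt0 => /(_ p2).
  have : (p <= k)%N by rewrite ku leq_pmull //; case: (u) ku k0 => // ->.
  lia.
have HF n : (0 < n <= T)%N -> {subset primes (cyclo_val k n) <= P} /\ (cyclo_val k n <= B)%N.
  move=> /andP[n0 nT].
  have a1 : (1 < (k * n) ^ k)%N.
    rewrite -[1%N](exp1n k) ltn_exp2r //.
    exact: leq_trans k2 (leq_pmulr _ n0).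
  have leB : (cyclo_val k n <= B)%N.
    apply: (@leq_trans ((k * n) ^ k)%N); last by rewrite leq_exp2r // leq_mul2l nT orbT.
    by apply: leq_trans (leq_subr 1 _); apply: dvdn_leq (cyclo_val_dvd k2 n0); rewrite subn_gt0.
  split=> // p; rewrite mem_primes => /and3P[pr F0 pF].
  have [p1 _] := cyclo_val_prime k2 n0 pr pF.
  rewrite mem_filter pr mem_iota add0n ltnS /=; apply/andP; split; first exact/eqP.
  exact: leq_trans (dvdn_leq F0 pF) leB.
have up := sum_ln_cyclo_upper uP PP B0 HF.
have prP : all prime P by apply/allP => p /PP[].
have mid := @sum_ln_div_primes_le R P Z uP prP Z0 sPZ.
have E0 : (0 < l ^ 3)%N by rewrite expn_gt0; apply/orP; left; apply: leq_trans l100.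
have low := sum_ln_lower (l ^ 3).-1; rewrite prednK // in low.
have cmp : \sum_(1 <= n < T.+1) ln (n%:R : R) <= \sum_(1 <= n < T.+1) ln ((cyclo_val k n)%:R : R).
  rewrite big_nat_cond [leRHS]big_nat_cond; apply: ler_sum => n /andP[/andP[n0 _] _].
  have := cyclo_val_ge k2 n0 => le.
  by rewrite ler_ln ?posrE ?ltr0n ?ler_nat // (leq_trans n0).
have [ln2l ln2u] := ln2_bounds.
have x100 : 100 <= l%:R :> R by rewrite ler_nat.
have xk : 2000 * k%:R <= l%:R :> R by rewrite -natrM ler_nat.
have kR : 2 <= k%:R :> R by rewrite ler_nat.
set L2 := ln 2 in low ln2l ln2u.
have lnZ : ln ((Z ^ 2)%:R : R) = (6 * l%:R + 8) * L2.
  rewrite /Z -expnM (_ : (3 * l + 4) * 2 = 6 * l + 8)%N; last by clear; lia.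
  by rewrite natrX lnXn // -[LHS]mulr_natl natrD natrM.
set a : R := ln ((Z ^ 2)%:R) in mid lnZ.
have a0 : 0 <= a by rewrite ln_ge0 // ler1n expn_gt0 Z0.
have a1 : a <= 6 * l%:R + 8.
  by rewrite lnZ ler_piMr // addr_ge0 // mulr_ge0 // ler0n.
have lnB : ln (B%:R : R) <= k%:R * (l%:R + l%:R ^+ 3).
  rewrite /B natrX lnXn ?ltr0n ?muln_gt0 ?k0 // -[leLHS]mulr_natl ler_wpM2l ?ler0n //.
  rewrite natrM lnM ?posrE ?ltr0n //; apply: lerD.
    apply: (@le_trans _ _ k%:R); last by rewrite ler_nat.
    by apply/ltW/ln_sublinear; rewrite ltr0n.
  by rewrite /T natrX lnXn // -[leLHS]mulr_natl natrX ler_piMr // exprn_ge0 // ler0n.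
pose T' := (2 ^ (l ^ 3).-1)%N.
have T'0 : 0 < T'%:R :> R by rewrite ltr0n expn_gt0.
have TT : T%:R = 2 * T'%:R :> R by rewrite /T -(prednK E0) expnS natrM.
have t1 : k%:R * (size P)%:R * ln (B%:R : R) <= T'%:R.
  apply: (@le_trans _ _ (k%:R * Z%:R * (k%:R * (l%:R + l%:R ^+ 3)))).
    apply: ler_pM => //; rewrite ?mulr_ge0 ?ler0n //; first by rewrite ln_ge0 // ler1n.
    by rewrite ler_wpM2l ?ler0n // ler_nat.
  have := expn_growth l100 kl1; rewrite -/Z -/T' -(ler_nat R).
  by rewrite !natrM natrD natrX.
have t2 : k%:R * T%:R * (\sum_(p <- P) ln (p%:R : R) / (p%:R - 1)) <=
    2 * T'%:R * (k%:R * ((6 * l%:R + 8) * (1 + (6 * l%:R + 8)) + 4)).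
  rewrite TT; have -> : k%:R * (2 * T'%:R) = 2 * T'%:R * k%:R :> R by ring.
  rewrite -[2 * _ * _ * _]mulrA; apply: ler_wpM2l; first by rewrite mulr_ge0 // ltW.
  apply: ler_wpM2l; first exact: ler0n.
  apply: (le_trans mid); rewrite lerD2r; apply: ler_pM => //; first exact: addr_ge0.
  by rewrite lerD2l.
have E1 : (l ^ 3).-1%:R = l%:R ^+ 3 - 1 :> R by rewrite -subn1 natrB // natrX.
move: low; rewrite -/T' E1 => low.
(* The values carry at least T' (l^3 - 1) ln 2 in logarithms, whereas so few primes allow only [T']
   times O(k l^2). *)
have fin : T'%:R * ((l%:R ^+ 3 - 1) * L2) <=
   T'%:R * (2 * (k%:R * ((6 * l%:R + 8) * (1 + (6 * l%:R + 8)) + 4)) + 1).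
  apply: (le_trans low); apply: (le_trans cmp); apply: (le_trans up).
  rewrite mulrDr mulr1 mulrA [T'%:R * 2]mulrC; exact: lerD.
rewrite ler_pM2l // in fin.
exact: cubic_gap ln2l x100 xk fin.
Qed.

End PrimesOneModK.

(** * Characters of order k trivial at small primes *)

Section PowerCharacters.
Variable R : realType.
Local Notation C := R[i].
Variable k : nat.
Hypothesis k2 : (2 <= k)%N.
Let k0 : (0 < k)%N := ltnW k2.
Let zeta : C := unit_root R k.
Let zeta_prim : k.-primitive_root zeta := unit_root_prim R k0.

(** Raising to the power (p - 1)/k sends units to the [k]-th roots of unity of the prime field, and
    the exponent there is transported to [zeta]. The exponent function [E] is part of the statement
    because the pigeonhole argument compares exponents. *)
Lemma power_character p : prime p -> p = 1 %[mod k] ->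
  exists (f : nat -> C) (E : nat -> nat), [/\ natchar p f,
    forall n, coprime n p -> f n = zeta ^+ E n &
    exists2 g, coprime g p & f g = zeta].
Proof.
move=> pr p1.
have kp : (k %| p.-1)%N by rewrite -subn1 -eqn_mod_dvd ?prime_gt0 //; apply/eqP.
have pp0 : (0 < p.-1)%N by have := prime_gt1 pr; lia.
have ch : p \in [pchar 'F_p] by rewrite pchar_Fp.
have copE n : coprime n p = (n%:R != 0 :> 'F_p).
  by rewrite coprime_sym prime_coprime // (dvdn_pcharf ch).
have fermat (x : 'F_p) : x != 0 -> x ^+ p.-1 = 1.
  move=> x0; apply: (mulfI x0); rewrite mulr1 -exprS prednK ?prime_gt0 //.
  by have := expf_card x; rewrite card_Fp.
have /hasP[h _ h_prim] : has p.-1.-primitive_root (enum [pred x : 'F_p | x != 0]).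
  apply: has_prim_root => //.
  - apply/allP => x; rewrite mem_enum inE => x0; rewrite unity_rootE.
    by rewrite fermat.
  - exact: enum_uniq.
  - rewrite -cardE (eq_card (B := predC1 0)); last by move=> x; rewrite !inE.
    by rewrite cardC1 card_Fp.
pose d := (p.-1 %/ k)%N.
have g_prim : k.-primitive_root (h ^+ d) by exact: dvdn_prim_root.
have lg (x : 'F_p) : {j : 'I_k | x != 0 -> x ^+ d = (h ^+ d) ^+ j}.
  apply: cid; have [->|x0] := eqVneq x 0; first by exists (Ordinal k0).
  have xd : (x ^+ d) ^+ k = 1 by rewrite -exprM divnK // fermat.
  by have [j Ej] := prim_rootP g_prim xd; exists j.
pose E (n : nat) : nat := sval (lg n%:R).
have EP n : coprime n p -> (n%:R : 'F_p) ^+ d = (h ^+ d) ^+ E n.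
  by rewrite copE /E; case: (lg _).
pose f (n : nat) : C := if coprime n p then zeta ^+ E n else 0.
have zE i j : (h ^+ d) ^+ i = (h ^+ d) ^+ j -> zeta ^+ i = zeta ^+ j.
  by move=> /eqP; rewrite (eq_prim_root_expr g_prim) -(eq_prim_root_expr zeta_prim) => /eqP.
exists f, E; split => [|n cn|].
- split => [|n|m n|n]; first exact: prime_gt0.
  + rewrite /f coprime_modl; case: ifP => // cn; apply: zE.
    rewrite -!EP ?coprime_modl //; congr (_ ^+ _).
    by rewrite {2}(divn_eq n p) natrD natrM pchar_Fp_0 // mulr0 add0r.
  + rewrite /f coprimeMl; case: (boolP (coprime m p)) => cm; rewrite ?mul0r //.
    case: (boolP (coprime n p)) => cn; rewrite ?mulr0 //= -exprD; apply: zE.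
    by rewrite exprD -!EP ?coprimeMl ?cm // natrM exprMn.
  + by rewrite /f; case: ifP => _; rewrite ?eqxx // expf_neq0 // (prim_root_eq0 zeta_prim) gtn_eqF.
- by rewrite /f cn.
have h0 : h != 0 by rewrite (prim_root_eq0 h_prim) gtn_eqF.
have ch' : coprime h p by rewrite copE natr_Zp.
exists (h : nat) => //; rewrite /f ch' -[RHS]expr1; apply: zE.
by rewrite -EP // natr_Zp expr1.
Qed.

(* Two of the [2 ^ r] products of characters modulo [r] distinct primes agree on all the primes
   up to [y]; [xi] is their quotient. *)
Lemma power_character_family l y : (2000 * k <= l)%N -> (y < 2 ^ l.+1)%N ->
  exists (q : nat) (xi : nat -> C),
  [/\ natchar q xi,
      (forall p, prime p -> (p %| q)%N -> (y ^ 3 < p)%N) /\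
        (size (primes q) <= k * y.+1)%N,
      (q <= ((k * 2 ^ (l ^ 3)) ^ k) ^ (k * y.+1))%N,
      forall p, prime p -> (p <= y)%N -> xi p = 1 &
      (forall n, coprime n q -> xi n ^+ k = 1) /\
      exists2 g, coprime g q & k.-primitive_root (xi g)].
Proof.
move=> kl yl; have [s [us ss sP]] := many_primes_one_mod R k2 kl yl.
set r := (k * y.+1)%N in ss *.
pose q (i : 'I_r) := nth 0%N s i.
have qs i : q i \in s by rewrite mem_nth // ss.
have qpr i : prime (q i) by have [] := sP _ (qs i).
have qinj : injective q.
  by move=> i j /eqP; rewrite nth_uniq ?ss // => /eqP/val_inj.
have /boolp.choice[F HF] : forall i, exists fE : (nat -> C) * (nat -> nat),
   [/\ natchar (q i) fE.1, forall n, coprime n (q i) -> fE.1 n = zeta ^+ fE.2 n &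
    exists2 g, coprime g (q i) & fE.1 g = zeta].
  move=> i; have [_ p1 _ _] := sP _ (qs i).
  by have [f [E ?]] := power_character (qpr i) p1; exists (f, E).
pose f i := (F i).1; pose E i := (F i).2.
have fc i : natchar (q i) (f i) by have [] := HF i.
have fE i n : coprime n (q i) -> f i n = zeta ^+ E i n by have [_ H _] := HF i; exact: H.
pose sig (b : {ffun 'I_r -> bool}) : {ffun 'I_y.+1 -> 'I_k} :=
  [ffun t : 'I_y.+1 => Ordinal (ltn_pmod (\sum_(i < r) b i * E i t)%N k0)].
(* With r = k (y + 1) there are (2^k)^(y + 1) choices of [b] and only k^(y + 1) vectors of exponents
   modulo [k]. *)
have /injectivePn[b [b' bb' sbb']] : ~~ injectiveb sig.
  apply/negP => /injectiveP/leq_card; rewrite !card_ffun !card_ord card_bool.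
  rewrite leqNgt /r expnM ltn_exp2r // ltn_expl //.
(* The shift by [k] changes no value on units and keeps every exponent positive, so that the product
   vanishes at each prime of [Q]; where [b] and [b'] differ the exponent is k + 1 or k - 1, coprime
   to [k]. *)
pose e i := (k + b i - b' i)%N.
have e0 i : (0 < e i)%N by rewrite /e; case: (b i) (b' i) => [] []; lia.
pose xi n : C := \prod_(i < r) f i n ^+ e i.
pose Q := (\prod_(i < r) q i)%N.
have qQ i : (q i %| Q)%N by rewrite /Q (bigD1 i) //= dvdn_mulr.
have copQ n : coprime n Q = [forall i : 'I_r, coprime n (q i)].
  apply/idP/forallP => [c i|H]; first exact: coprime_dvdr (qQ i) c.
  by apply: (big_ind (fun m => coprime n m)) => // [|a c]; rewrite ?coprimen1 // coprimeMr => -> ->.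
have xic : natchar Q xi.
  split => [|n|m n|n].
  - by rewrite prodn_gt0 // => i; exact: prime_gt0.
  - apply: eq_bigr => i _; congr (_ ^+ _); apply: (natchar_eqmod (fc i)).
    by rewrite modn_dvdm.
  - rewrite /xi -big_split /=; apply: eq_bigr => i _.
    by have [_ _ -> _] := fc i; rewrite exprMn.
  - rewrite copQ; apply/prodf_neq0/forallP => H i.
      have := H i isT; rewrite expf_eq0 e0 /=.
      by have [_ _ _ ->] := fc i.
    by move=> _; rewrite expf_eq0 e0 /=; have [_ _ _ ->] := fc i; exact: H.
have Qs p : prime p -> (p %| Q)%N -> p \in s.
  move=> pr pQ; have : ~~ [forall i : 'I_r, coprime p (q i)].
    by rewrite -copQ prime_coprime // pQ.
  rewrite negb_forall; case/existsP => i.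
  by rewrite prime_coprime // negbK dvdn_prime2 // => /eqP->.
exists Q, xi; split => //.
- split; first by move=> p pr /(Qs p pr)/sP[].
  rewrite -ss.
  apply: uniq_leq_size; first exact: primes_uniq.
  by move=> p; rewrite mem_primes => /and3P[pr _]; exact: Qs.
- rewrite /Q -[X in (_ <= _ ^ X)%N]card_ord -prod_nat_const.
  by apply: leq_prod => i _; have [] := sP _ (qs i).
- move=> p pr py.
  have cop i : coprime p (q i).
    rewrite prime_coprime // dvdn_prime2 //; apply/negP => /eqP pq.
    have [_ _ lt _] := sP _ (qs i); move: lt; rewrite -pq ltnNge.
    move/negP; apply; apply: leq_trans py _.
    by rewrite -{1}[y]expn1; case: (y) => // y'; rewrite leq_pexp2l.
  have pl : (p < y.+1)%N by [].
  pose t : 'I_y.+1 := Ordinal pl.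
  have St : ((\sum_(i < r) b i * E i p) %% k = (\sum_(i < r) b' i * E i p) %% k)%N.
    by have := congr1 (fun g : {ffun 'I_y.+1 -> 'I_k} => val (g t)) sbb'; rewrite !ffunE.
  have -> : xi p = zeta ^+ (\sum_(i < r) E i p * e i).
    rewrite expr_sum; apply: eq_bigr => i _; rewrite fE // -exprM //.
  have key : (\sum_(i < r) E i p * e i + \sum_(i < r) b' i * E i p =
      k * (\sum_(i < r) E i p) + \sum_(i < r) b i * E i p)%N.
    rewrite big_distrr /= -!big_split /=; apply: eq_bigr => i _.
    rewrite /e; case: (b i) (b' i) => [] [] /=; rewrite ?mul1n ?mul0n ?addn0 ?subn0.
    + by rewrite addnK mulnC.
    + by rewrite addn1 mulnS addnC mulnC.
    + by rewrite mulnC -mulSnr subn1 prednK.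
    + by rewrite mulnC.
  apply/eqP; rewrite -(prim_order_dvd zeta_prim) /dvdn -[X in _ == X](mod0n k).
  rewrite -(eqn_modDr (\sum_(i < r) b' i * E i p)%N) key add0n.
  by rewrite mulnC modnMDl St.
split.
  move=> n; rewrite copQ => /forallP cop; rewrite -prodrXl; apply: big1 => i _.
  by rewrite fE // -!exprM mulnC exprM (prim_expr_order zeta_prim) expr1n.
have /existsP[i0 bi] : [exists i, b i != b' i].
  by rewrite -negb_forall; apply: contra bb' => /forallP H; apply/eqP/ffunP => i; apply/eqP.
have [_ _ [g cg fg]] := HF i0.
pose M := (\prod_(i < r | i != i0) q i)%N.
have cM : coprime (q i0) M.
  apply: (big_ind (fun m => coprime (q i0) m)) => [|a c ca cc|i ii]; rewrite ?coprimen1 ?coprimeMr ?ca //.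
  by rewrite prime_coprime // dvdn_prime2 // (inj_eq qinj) eq_sym.
pose n := chinese (q i0) M g 1.
have n0 : n = g %[mod q i0] by exact: chinese_modl.
have n1 i : i != i0 -> n = 1 %[mod q i].
  move=> ii; have d : (q i %| M)%N by rewrite /M (bigD1 i) //= dvdn_mulr.
  by rewrite -(modn_dvdm n d) -(modn_dvdm 1 d) (_ : n = 1 %[mod M]) //; exact: chinese_modr.
exists n.
  rewrite copQ; apply/forallP => i; have [->|ii] := eqVneq i i0.
    by rewrite (coprime_eqmod n0).
  by rewrite (coprime_eqmod (n1 i ii)) coprime1n.
have -> : xi n = zeta ^+ e i0.
  rewrite /xi (bigD1 i0) //= big1 ?mulr1.
    by rewrite (natchar_eqmod (fc i0) n0) -/(f i0) [f i0 g]fg.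
  by move=> i ii; rewrite (natchar_eqmod (fc i) (n1 i ii)) (natchar1 (fc i)) expr1n.
rewrite (prim_root_exp_coprime _ zeta_prim) /e.
move: bi; case: (b i0) (b' i0) => [] [] //= _.
  by rewrite subn0 addn1 coprimeSn.
by rewrite addn0 subn1 coprimePn.
Qed.

End PowerCharacters.

(** * Smooth sums and Mertens' product *)

Section SmoothSums.
Variable R : realType.
Variable m : nat.

(** The primes dividing [m] are excluded too, because [family_char] vanishes there. *)
Definition smooth (y n : nat) : bool := all (fun p => (p <= y) && ~~ (p %| m))%N (primes n).

Definition smooth_sum (g : nat -> R) y N : R := \sum_(1 <= n < N.+1 | smooth y n) g n.

Lemma smoothS_notin y n : ~~ (prime y.+1 && ~~ (y.+1 %| m)%N) -> smooth y.+1 n = smooth y n.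
Proof.
move=> np; apply: eq_in_all => p; rewrite mem_primes => /and3P[pr _ _].
rewrite leq_eqVlt ltnS; case: eqP => [E|//].
by subst p; rewrite ltnn; move: np; rewrite pr /= => /negbTE ->.
Qed.

Lemma smoothS_prime_ndvd y n : (0 < n)%N -> ~~ (y.+1 %| n)%N -> smooth y.+1 n = smooth y n.
Proof.
move=> n0 nd; apply: eq_in_all => p; rewrite mem_primes => /and3P[pr _ pn].
rewrite leq_eqVlt ltnS; case: eqP => [E|//].
by move: nd; rewrite -E pn.
Qed.

Lemma smoothS_dvd y n : prime y.+1 -> ~~ (y.+1 %| m)%N -> (0 < n)%N ->
  smooth y.+1 (y.+1 * n) = smooth y.+1 n.
Proof.
move=> pr nm n0; rewrite /smooth; apply/allP/allP => H p.
  move=> pn; apply: H; rewrite primesM // pn orbT //.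
rewrite primesM // primes_prime // inE => /orP[/eqP->|]; last exact: H.
by rewrite leqnn nm.
Qed.

Lemma smooth_sum0 g N : (0 < N)%N -> smooth_sum g 0 N = g 1%N.
Proof.
move=> N0; rewrite /smooth_sum big_ltn_cond //= big_nat_cond big1 ?addr0 //.
move=> n /andP[/andP[n1 _] /allP H]; exfalso.
have := H (pdiv n); rewrite mem_primes pdiv_prime // pdiv_dvd (ltnW n1) => /(_ isT).
by rewrite leqn0 => /andP[/eqP E]; have := pdiv_prime n1; rewrite E.
Qed.

Lemma sum_dvdn_div (F : nat -> R) d N : (0 < d)%N ->
  \sum_(1 <= n < N.+1 | (d %| n)%N) F n = \sum_(1 <= n < (N %/ d).+1) F (d * n)%N.
Proof.
move=> d0; elim: N => [|N IH]; first by rewrite div0n !big_geq.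
rewrite big_mkcond big_nat_recr //= -big_mkcond IH /=.
case: ifP => dN.
  have [u Eu] := dvdnP dN.
  have -> : (N %/ d = u.-1)%N.
    have u0 : (0 < u)%N by case: u Eu => //; rewrite mul0n.
    have -> : (N = u.-1 * d + d.-1)%N.
      apply: succn_inj; rewrite Eu -addnS prednK // -mulSnr prednK //.
    by rewrite divnMDl // divn_small ?addn0 // prednK.
  rewrite Eu mulnK //; case: u Eu => // u _.
  by rewrite [RHS]big_nat_recr //= mulnC.
rewrite addr0; congr bigop; congr index_iota; congr _.+1.
apply/eqP; rewrite eqn_leq leq_div2r //=.
have [q [r [E rd]]] : exists q r, N.+1 = (q * d + r)%N /\ (0 < r < d)%N.
  exists (N.+1 %/ d)%N, (N.+1 %% d)%N; split; first exact: divn_eq.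
  by rewrite ltn_mod d0 lt0n andbT; move: dN; rewrite /dvdn => ->.
have -> : (N.+1 %/ d = q)%N by rewrite E divnMDl // divn_small ?addn0 //; lia.
have -> : (N = q * d + r.-1)%N by lia.
by rewrite divnMDl // leq_addr.
Qed.

Variable g : nat -> R.
Hypothesis gM : forall a b, (0 < a)%N -> (0 < b)%N -> g (a * b)%N = g a * g b.
Hypothesis g0 : forall a, 0 <= g a.

Lemma smooth_sum_ge0 y N : 0 <= smooth_sum g y N.
Proof. by apply: sumr_ge0. Qed.

Lemma smooth_sum_le y N N' : (N <= N')%N -> smooth_sum g y N <= smooth_sum g y N'.
Proof.
move=> le; rewrite /smooth_sum [leRHS](@big_cat_nat _ _ _ N.+1) //=.
by rewrite lerDl sumr_ge0.
Qed.

(** One factor [y.+1] is removed from the smooth multiples of it. Solved as an inequality, the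
    recursion gives [smooth_sum_upper]; iterated, it gives [smooth_sum_lower]. *)
Lemma smooth_sum_prime y N : prime y.+1 -> ~~ (y.+1 %| m)%N ->
  smooth_sum g y.+1 N = smooth_sum g y N + g y.+1 * smooth_sum g y.+1 (N %/ y.+1).
Proof.
move=> pr nm; rewrite /smooth_sum (bigID (fun n => y.+1 %| n)%N) /= addrC; congr (_ + _).
  rewrite big_nat_cond [RHS]big_nat_cond; apply: eq_bigl => n.
  case: (posnP n) => [->|n0] //=; rewrite ?ltn0 //.
  case: (n < N.+1)%N; rewrite ?andbF //= andbC.
  have [dv|nd] /= := boolP (y.+1 %| n)%N; last by rewrite smoothS_prime_ndvd.
  apply/esym/negP => /allP/(_ y.+1).
  by rewrite mem_primes pr n0 dv ltnn => /(_ isT).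
rewrite (eq_bigl (fun n => (y.+1 %| n)%N && smooth y.+1 n)); last by move=> n; rewrite andbC.
rewrite big_mkcondr /= sum_dvdn_div // mulr_sumr [RHS]big_mkcond /=.
apply: eq_big_nat => n /andP[n0 _].
by rewrite smoothS_dvd //; case: ifP => // _; rewrite gM.
Qed.

Definition prime_euler (y : nat) : R :=
  \prod_(0 <= p < y.+1 | prime p && ~~ (p %| m)%N) (1 - g p)^-1.

Lemma prime_eulerS y : prime_euler y.+1 =
  prime_euler y * (if prime y.+1 && ~~ (y.+1 %| m)%N then (1 - g y.+1)^-1 else 1).
Proof. by rewrite /prime_euler big_mkcond big_nat_recr //= -big_mkcond. Qed.

Hypothesis g1 : g 1%N = 1.
Hypothesis glt1 : forall p, prime p -> g p < 1.

Lemma prime_euler_gt0 y : 0 < prime_euler y.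
Proof. by apply: prodr_gt0 => p /andP[pr _]; rewrite invr_gt0 subr_gt0 glt1. Qed.

Lemma smooth_sum_upper y N : (0 < N)%N -> smooth_sum g y N <= prime_euler y.
Proof.
move=> N0; elim: y => [|y IH].
  by rewrite smooth_sum0 // g1 /prime_euler big_mkcond big_nat1.
rewrite prime_eulerS; case: ifP => [/andP[pr nm]|/negbT np]; last first.
  rewrite mulr1; apply: le_trans IH; rewrite /smooth_sum.
  by under eq_bigl do rewrite smoothS_notin //.
have lt : 0 < 1 - g y.+1 by rewrite subr_gt0 glt1.
rewrite ler_pdivlMr //; apply: le_trans IH.
rewrite mulrBr mulr1 {1}smooth_sum_prime // lerBlDr lerD2l mulrC.
by rewrite ler_wpM2r // smooth_sum_le // leq_div.
Qed.

(* Truncating every Euler factor after [A] terms keeps all the integers below [y!^A]. *)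
Lemma smooth_sum_lower y A :
  \prod_(0 <= p < y.+1 | prime p && ~~ (p %| m)%N) (\sum_(0 <= a < A.+1) g p ^+ a) <=
  smooth_sum g y (y`! ^ A).
Proof.
elim: y => [|y IH].
  by rewrite smooth_sum0 ?expn_gt0 // g1 big_mkcond big_nat1.
rewrite big_mkcond big_nat_recr //= -big_mkcond.
have f0 : (0 < y`! ^ A)%N by rewrite expn_gt0 fact_gt0.
case: ifP => [/andP[pr nm]|/negbT np]; last first.
  rewrite mulr1; apply: (le_trans IH).
  apply: (@le_trans _ _ (smooth_sum g y (y.+1`! ^ A))).
    by apply: smooth_sum_le; rewrite factS expnMn leq_pmull // expn_gt0.
  by rewrite /smooth_sum; under [leRHS]eq_bigl do rewrite smoothS_notin //.
apply: (@le_trans _ _ (smooth_sum g y (y`! ^ A) * (\sum_(0 <= a < A.+1) g y.+1 ^+ a))).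
  by apply: ler_wpM2r => //; apply: sumr_ge0 => a _; rewrite exprn_ge0.
have key B : smooth_sum g y (y`! ^ A) * (\sum_(0 <= a < B.+1) g y.+1 ^+ a) <=
    smooth_sum g y.+1 (y`! ^ A * y.+1 ^ B).
  elim: B => [|B IHB].
    rewrite big_nat1 expr0 mulr1 expn0 muln1 smooth_sum_prime //.
    by rewrite lerDl mulr_ge0 // smooth_sum_ge0.
  rewrite big_nat_recl // expr0 mulrDr mulr1 smooth_sum_prime //.
  apply: lerD; first by apply: smooth_sum_le; rewrite leq_pmulr // expn_gt0.
  rewrite expnSr mulnA mulnK //; under eq_bigr do rewrite exprS.
  by rewrite -mulr_sumr mulrCA ler_wpM2l.
by have := key A; rewrite factS expnMn mulnC.
Qed.

End SmoothSums.

Local Open Scope classical_set_scope.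

(** * Euler's constant and inequalities for the logarithm *)

Section Mertens.
Variable R : realType.

Lemma ln_ratio_le n : (0 < n)%N -> ln (n.+1%:R : R) - ln (n%:R : R) <= (n%:R)^-1.
Proof.
move=> n0; have a : 0 < n%:R :> R by rewrite ltr0n.
rewrite -ln_div ?posrE ?ltr0n //.
have -> : n.+1%:R / n%:R = 1 + (n%:R)^-1 :> R.
  by rewrite -natr1 mulrDl mulfV ?lt0r_neq0 // mul1r.
by apply: le_ln1Dx; apply: lt_trans (ltrN10 _) _; rewrite invr_gt0.
Qed.

Lemma ln_ratio_ge n : (0 < n)%N -> (n.+1%:R : R)^-1 <= ln (n.+1%:R : R) - ln (n%:R : R).
Proof.
move=> n0; have a : 0 < n%:R :> R by rewrite ltr0n.
have b : 0 < n.+1%:R :> R by rewrite ltr0n.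
have := @le_ln1Dx R (- (n.+1%:R)^-1).
have -> : 1 + - (n.+1%:R)^-1 = n%:R / n.+1%:R :> R.
  have -> : n.+1%:R = n%:R + 1 :> R by rewrite natr1.
  by move: (n%:R : R) a => t t0; field; rewrite lt0r_neq0 // addr_gt0.
rewrite ln_div ?posrE // ltrN2 invf_lt1 // ltr1n => /(_ n0).
by rewrite -opprB lerN2.
Qed.

Let u (n : nat) : R := hsum R n - ln (n%:R : R).

Let u_decr n : u n.+2 <= u n.+1.
Proof.
have step (H a b c : R) : a <= b - c -> H + a - b <= H - c by lra.
rewrite /u /hsum [X in X - _]big_nat_recr //=.
by apply: step; exact: ln_ratio_ge.
Qed.

Let hsum_ge_ln n : ln (n.+1%:R : R) <= hsum R n.
Proof.
elim: n => [|n IH]; first by rewrite ln1 hsum_ge0.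
have step (H a b c : R) : b - c <= a -> c <= H -> b <= H + a by lra.
rewrite /hsum big_nat_recr //= -/(hsum R n).
by apply: step IH; exact: ln_ratio_le.
Qed.

Let u_ge0 n : 0 <= u n.+1.
Proof.
rewrite subr_ge0; apply: le_trans (hsum_ge_ln n.+1).
by rewrite ler_ln ?posrE ?ltr0n // ler_nat.
Qed.

Lemma euler_gamma_le n : (0 < n)%N -> euler_gamma R <= hsum R n - ln (n%:R : R).
Proof.
case: n => // n _.
pose v := [sequence u n.+1]_n.
have vd : nonincreasing_seq v by apply/nonincreasing_seqP => i; exact: u_decr.
have vlb : has_lbound (range v) by exists 0 => _ [i _ <-]; exact: u_ge0.
have vc := nonincreasing_is_cvgn vd vlb.
have E : euler_gamma R = limn v.
  rewrite /euler_gamma; apply/cvg_lim => //.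
  rewrite -/u -(cvg_shiftS u).
  exact: vc.
by rewrite E; exact: nonincreasing_cvgn_ge vd vc n.
Qed.

Lemma sum_inv_sub_ln J : (0 < J)%N ->
  \sum_(1 <= j < J) ((j%:R)^-1 - (ln (j.+1%:R : R) - ln (j%:R : R))) =
  hsum R J - (J%:R)^-1 - ln (J%:R : R).
Proof.
case: J => // J _; rewrite sumrB telescope_sumr // ln1 subr0.
by rewrite /hsum [X in _ = X - _ - _]big_nat_recr //= addrK.
Qed.

Lemma sum_inv_sub_ln_ge J : (0 < J)%N -> euler_gamma R - (J%:R)^-1 <=
  \sum_(1 <= j < J) ((j%:R)^-1 - (ln (j.+1%:R : R) - ln (j%:R : R))).
Proof. by move=> J0; rewrite sum_inv_sub_ln //; have := euler_gamma_le J0; lra. Qed.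

Lemma sum_inv_sub_ln_le1 J : (0 < J)%N ->
  \sum_(1 <= j < J) ((j%:R)^-1 - (ln (j.+1%:R : R) - ln (j%:R : R))) <= 1.
Proof.
move=> J0; rewrite sum_inv_sub_ln //; have := hsum_le_ln R J0.
have : 0 <= (J%:R : R)^-1 by rewrite invr_ge0 ler0n.
lra.
Qed.

(** The derivative of log (1 - x) plus the partial sum is - x^(J - 1) / (1 - x) <= 0 once J >= 1,
    and the mean value theorem turns its sign into the bound. *)
Lemma power_series_ln_le (r : R) J : 0 <= r < 1 ->
  \sum_(1 <= j < J) r ^+ j / j%:R <= - ln (1 - r).
Proof.
move=> /andP[r0 r1]; move: r0; rewrite le_eqVlt => /predU1P[<-|r0].
  rewrite subr0 ln1 oppr0 big_nat_cond big1 // => j /andP[/andP[j0 _] _].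
  by rewrite expr0n gtn_eqF // mul0r.
pose F (x : R) := \sum_(1 <= j < J) x ^+ j / j%:R.
pose dF (x : R) := \sum_(1 <= j < J) x ^+ j.-1.
pose P : {poly R} := \sum_(1 <= j < J) (j%:R^-1 : R) *: 'X^j.
have FP : F = horner P.
  apply/funext => z; rewrite /F /P horner_sum; apply: eq_bigr => j _.
  by rewrite !hornerE mulrC.
have dFP (x : R) : is_derive x (1 : R) F (dF x).
  have -> : dF x = P^`().[x]; last by rewrite FP; exact: is_derive_poly.
  rewrite /dF /P raddf_sum /= horner_sum; apply: eq_big_nat => j /andP[j0 _].
  rewrite derivZ derivXn hornerZ hornerMn hornerXn -[X in _ = _ * X]mulr_natl mulrA mulVf ?mul1r //.
  by rewrite pnatr_eq0 -lt0n.
have dl (x : R) : x < 1 -> is_derive x (1 : R) (fun z : R => ln (1 - z)) (- (1 - x)^-1).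
  move=> x1.
  have H1 : is_derive (1 - x) (1 : R) (@ln R) (1 - x)^-1 by apply: is_derive1_ln; rewrite subr_gt0.
  have H2 : is_derive x (1 : R) (fun z : R => 1 - z) (-1).
    by rewrite -[X in is_derive _ _ _ X]sub0r; apply: is_deriveB.
  have := @is_derive1_comp _ (@ln R) (fun z : R => 1 - z) x _ _ H1 H2.
  by rewrite mulrN1.
pose G := (fun z : R => ln (1 - z)) + F.
have dG (x : R) : x < 1 -> is_derive x (1 : R) G (- (1 - x)^-1 + dF x).
  by move=> x1; apply: is_deriveD; exact: dl.
have contG : {within `[0, r], continuous G}.
  apply: continuous_in_subspaceT => x; rewrite inE /= in_itv /= => /andP[_ xr].
  apply: differentiable_continuous; apply/derivable1_diffP.
  by have := dG x (le_lt_trans xr r1) => -[].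
have dGin (x : R) : x \in `]0, r[%R -> is_derive x (1 : R) G (- (1 - x)^-1 + dF x).
  by rewrite in_itv /= => /andP[_ xr]; apply: dG; exact: lt_trans r1.
have [c] := MVT r0 dGin contG.
rewrite in_itv /= => /andP[c0 cr].
have c1 : c < 1 by exact: lt_trans r1.
rewrite /G !fctE subr0 ln1 add0r.
have -> : F 0 = 0.
  rewrite /F big_nat_cond big1 // => j /andP[/andP[j0 _] _].
  by rewrite expr0n gtn_eqF // mul0r.
rewrite !subr0 => E.
have le : - (1 - c)^-1 + dF c <= 0.
  rewrite addrC subr_le0 -[leRHS]mul1r ler_pdivlMr ?subr_gt0 // /dF.
  have -> : \sum_(1 <= j < J) c ^+ j.-1 = \sum_(0 <= j < J.-1) c ^+ j.
    by rewrite big_add1.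
  rewrite big_mkord mulrC -opprB mulNr -subrX1 opprB gerBl exprn_ge0 //.
  exact: ltW.
have : ln (1 - r) + F r <= 0 by rewrite E mulr_le0_ge0 // ltW.
rewrite /F; lra.
Qed.

(** Convexity of - log (1 - x), which is 0 at 0. Two instances of log (1 + z) <= z, weighted by t
    and 1 - t, have right sides that cancel. *)
Lemma ln_convex_scale (t x : R) : 0 <= t <= 1 -> 0 <= x < 1 ->
  - ln (1 - t * x) <= t * - ln (1 - x).
Proof.
move=> /andP[t0 t1] /andP[x0 x1].
have tx : t * x <= x by rewrite ler_piMl.
have u0 : 0 < 1 - t * x by lra.
have v0 : 0 < 1 - x by lra.
have A : ln (1 - x) - ln (1 - t * x) <= (t - 1) * x / (1 - t * x).
  rewrite -ln_div ?posrE //.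
  have -> : (1 - x) / (1 - t * x) = 1 + (t - 1) * x / (1 - t * x).
    by field; rewrite lt0r_neq0.
  apply: le_ln1Dx; have q0 : 0 < (1 - x) / (1 - t * x) by rewrite divr_gt0.
  have -> : (t - 1) * x / (1 - t * x) = (1 - x) / (1 - t * x) - 1.
    by field; rewrite lt0r_neq0.
  by rewrite ltrBrDl subrr.
have B : - ln (1 - t * x) <= t * x / (1 - t * x).
  rewrite -lnV ?posrE //.
  rewrite [X in ln X](_ : _ = 1 + t * x / (1 - t * x)); last by field; rewrite lt0r_neq0.
  apply: le_ln1Dx; apply: lt_le_trans (ltrN10 _) _.
  by rewrite divr_ge0 ?mulr_ge0 // ltW.
have A' := ler_wpM2l t0 A.
have t1' : 0 <= 1 - t by lra.
have B' := ler_wpM2l t1' B.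
have E : t * ((t - 1) * x / (1 - t * x)) + (1 - t) * (t * x / (1 - t * x)) = 0.
  by field; rewrite lt0r_neq0.
lra.
Qed.

End Mertens.

Local Open Scope ring_scope.
Local Open Scope classical_set_scope.

(** * Comparison of Mertens' product with zeta *)

Section MertensProduct.
Variable R : realType.

Definition inv_nat (n : nat) : R := (n%:R)^-1.

Lemma inv_natM a b : (0 < a)%N -> (0 < b)%N -> inv_nat (a * b) = inv_nat a * inv_nat b.
Proof. by move=> _ _; rewrite /inv_nat natrM invfM. Qed.
Lemma inv_nat_ge0 a : 0 <= inv_nat a. Proof. by rewrite invr_ge0 ler0n. Qed.
Lemma inv_nat1 : inv_nat 1 = 1. Proof. exact: invr1. Qed.
Lemma inv_nat_lt1 p : prime p -> inv_nat p < 1.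
Proof.
by move=> pr; rewrite invf_lt1 ?ltr0n ?prime_gt0 // ltr1n prime_gt1.
Qed.

Let a_ (p : nat) : R := - ln (1 - inv_nat p).
Let W (y : nat) : R := \sum_(0 <= p < y.+1 | prime p) a_ p.

Lemma ln_prime_euler (g : nat -> R) m y : (forall p, prime p -> g p < 1) ->
  ln (prime_euler m g y) = \sum_(0 <= p < y.+1 | prime p && ~~ (p %| m)%N) - ln (1 - g p).
Proof.
move=> g1; elim: y => [|y IH].
  by rewrite /prime_euler big_mkcond [RHS]big_mkcond !big_nat1 /= ln1.
rewrite prime_eulerS [RHS]big_mkcond big_nat_recr //= -big_mkcond -IH /=.
case: ifP => [/andP[pr _]|_]; last by rewrite mulr1 addr0.
rewrite lnM ?posrE ?prime_euler_gt0 //; last by rewrite invr_gt0 subr_gt0 g1.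
by rewrite lnV // posrE subr_gt0 g1.
Qed.

Lemma a_ge0 p : prime p -> 0 <= a_ p.
Proof.
move=> pr; rewrite oppr_ge0 ln_le0 // gerBl; exact: inv_nat_ge0.
Qed.

Section Blocks.
Variables (d L : R).
Hypotheses (d0 : 0 < d) (L0 : 0 < L).
Let r := expR (- d).
(** With s = 1 + 1/L, the primes are cut at e^(j d L), so that p^(- 1/L) is at most r^j beyond the
    j-th cut. *)
Let yj (j : nat) : nat := Num.truncn (expR (j%:R * d * L)).

Lemma yj_itv j : (yj j)%:R <= expR (j%:R * d * L) < (yj j).+1%:R.
Proof. by apply: truncn_itv; exact: expR_ge0. Qed.

Lemma yj_ge1 j : (1 <= yj j)%N.
Proof.
rewrite truncn_ge_nat ?expR_ge0 // -[X in X <= _]expR0 ler_expR.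
by rewrite mulr_ge0 ?(ltW L0) // mulr_ge0 ?(ltW d0).
Qed.

Lemma yj_le j : (yj j <= yj j.+1)%N.
Proof.
have /andP[h1 _] := yj_itv j; have /andP[_ h2] := yj_itv j.+1.
rewrite -ltnS -(ltr_nat R); apply: le_lt_trans h1 _; apply: le_lt_trans _ h2.
by rewrite ler_expR ler_pM2r // ler_pM2r // ler_nat.
Qed.

Lemma ln_yj j : ln ((yj j)%:R : R) <= j%:R * d * L.
Proof.
have /andP[h1 _] := yj_itv j.
rewrite -[leRHS]expRK ler_ln // ?posrE ?expR_gt0 //.
by rewrite ltr0n yj_ge1.
Qed.

Lemma yj_lt_weight j n : (yj j < n)%N -> expR (- (ln (n%:R : R) / L)) <= r ^+ j.
Proof.
move=> lt; have n0 : 0 < n%:R :> R by rewrite ltr0n; case: n lt.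
have /andP[_ h2] := yj_itv j.
have h : expR (j%:R * d * L) <= n%:R.
  by apply: ltW; apply: lt_le_trans h2 _; rewrite ler_nat.
rewrite /r -expRM_natl ler_expR mulrN lerN2 ler_pdivlMr //.
by rewrite -[leLHS]expRK ler_ln ?posrE ?expR_gt0.
Qed.

Lemma prime_block_sum J :
  \sum_(0 <= p < (yj J).+1 | prime p) a_ p * expR (- (ln (p%:R : R) / L)) <=
  \sum_(0 <= j < J) (W (yj j.+1) - W (yj j)) * r ^+ j.
Proof.
elim: J => [|J IH].
  have -> : yj 0 = 1%N.
    apply/eqP; rewrite eqn_leq yj_ge1 andbT -(ler_nat R).
    by have /andP[h1 _] := yj_itv 0; move: h1; rewrite !mul0r expR0.
  by rewrite big_mkcond !big_nat_recr //= !big_geq // addr0 add0r.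
rewrite (@big_cat_nat _ _ _ (yj J).+1) //=; last by rewrite ltnS yj_le.
rewrite [leRHS]big_nat_recr //=; apply: lerD => //.
rewrite /W (@big_cat_nat _ _ _ (yj J).+1 0 (yj J.+1).+1) //=; last by rewrite ltnS yj_le.
rewrite addrAC subrr add0r mulr_suml.
rewrite big_nat_cond [leRHS]big_nat_cond; apply: ler_sum => p /andP[/andP[lt _] pr].
by apply: ler_wpM2l; [exact: a_ge0 | exact: yj_lt_weight].
Qed.

(** The term n^(- 1 - 1/L) dominates L times the drop of n^(- 1/L) from n to n + 1, and these drops
    telescope. *)
Lemma zeta_truncation_lower J : 
  L * (1 - r ^+ J) <= \sum_(1 <= n < (yj J).+1) expR (- (1 + L^-1) * ln (n%:R : R)).
Proof.
pose h (n : nat) : R := expR (- (ln (n%:R : R) / L)).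
apply: (@le_trans _ _ (\sum_(1 <= n < (yj J).+1) L * (h n - h n.+1))).
  rewrite -mulr_sumr ler_wpM2l //; first exact: ltW.
  have -> : \sum_(1 <= n < (yj J).+1) (h n - h n.+1) = - \sum_(1 <= n < (yj J).+1) (h n.+1 - h n).
    by rewrite -sumrN; apply: eq_bigr => i _; rewrite opprB.
  rewrite telescope_sumr // opprB {1}/h ln1 mul0r oppr0 expR0.
  by rewrite lerB // yj_lt_weight.
apply: ler_sum_nat => n /andP[n0 _].
have nR : 0 < n%:R :> R by rewrite ltr0n.
have -> : expR (- (1 + L^-1) * ln (n%:R : R)) = h n * (n%:R)^-1.
  have -> : (n%:R)^-1 = expR (- ln (n%:R : R)) by rewrite expRN lnK ?posrE.
  rewrite /h -expRD; congr expR.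
  by field; rewrite lt0r_neq0.
have -> : h n.+1 = h n * expR (- ((ln (n.+1%:R : R) - ln (n%:R : R)) / L)).
  by rewrite /h -expRD; congr expR; field; rewrite lt0r_neq0.
rewrite -{1}[h n]mulr1 -mulrBr mulrCA ler_wpM2l //; first exact: expR_ge0.
set t := ln _ - ln _.
have h1 := expR_ge1Dx (- (t / L)).
have h2 : t <= (n%:R)^-1 by exact: ln_ratio_le.
apply: (@le_trans _ _ (L * (t / L))).
  by rewrite ler_pM2l //; lra.
by rewrite mulrCA mulfV ?mulr1 // lt0r_neq0.
Qed.

Variable kappa : R.

(** Partial summation against the decreasing weights r^j: the assumed bound at the cuts becomes
    [V j], that is kappa + log (j d L), whose increments are those of log j. The induction carries
    the slack between [V] and [W] along. *)
Lemma abel_blocks J : (0 < J)%N ->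
  (forall j, (0 < j <= J)%N -> W (yj j) <= ln (ln ((yj j)%:R : R)) + kappa) ->
  (forall j, (0 < j <= J)%N -> 0 < ln ((yj j)%:R : R)) ->
  \sum_(0 <= j < J) (W (yj j.+1) - W (yj j)) * r ^+ j <=
  kappa + ln (d * L) + \sum_(1 <= j < J) r ^+ j * (ln (j.+1%:R : R) - ln (j%:R : R)).
Proof.
pose V j : R := kappa + ln (d * L) + ln (j%:R : R).
have r0 : 0 <= r by exact: expR_ge0.
have r1 : r <= 1 by rewrite expR_le1 oppr_le0 ltW.
move=> J0 HW Hl.
have WV j : (0 < j <= J)%N -> W (yj j) <= V j.
  move=> jJ; apply: (le_trans (HW j jJ)); have lj := Hl j jJ.
  have jR : 0 < j%:R :> R by rewrite ltr0n; case/andP: jJ.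
  rewrite addrC /V -addrA lerD2l -lnM ?posrE ?mulr_gt0 //.
  rewrite ler_ln ?posrE ?mulr_gt0 //.
  by apply: (le_trans (ln_yj j)); rewrite -mulrA mulrC.
have W0 : W (yj 0) = 0.
  have -> : yj 0 = 1%N.
    apply/eqP; rewrite eqn_leq yj_ge1 andbT -(ler_nat R).
    by have /andP[h1 _] := yj_itv 0; move: h1; rewrite !mul0r expR0.
  by rewrite /W big_mkcond !big_nat_recr //= !big_geq // addr0 add0r.
suff H i : (i < J)%N ->
   \sum_(0 <= j < i.+1) (W (yj j.+1) - W (yj j)) * r ^+ j + (V i.+1 - W (yj i.+1)) * r ^+ i <=
   kappa + ln (d * L) + \sum_(1 <= j < i.+1) r ^+ j * (ln (j.+1%:R : R) - ln (j%:R : R)).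
  case: (J) J0 H WV => // i _ H WV; apply: le_trans (H i (ltnSn i)).
  rewrite lerDl mulr_ge0 ?exprn_ge0 // subr_ge0 WV //=.
elim: i => [|i IH] iJ.
  rewrite big_nat1 [X in _ + _ + X]big_geq // W0 expr0 !mulr1 subr0 addrCA subrr addr0.
  by rewrite /V ln1 !addr0.
have {}IH := IH (ltnW iJ).
rewrite big_nat_recr //= [X in _ <= _ + X]big_nat_recr //= -addrA -mulrDl.
set S := \sum_(0 <= j < i.+1) _ in IH *; set T := \sum_(1 <= j < i.+1) _ in IH *.
have -> : W (yj i.+2) - W (yj i.+1) + (V i.+2 - W (yj i.+2)) =
   (V i.+1 - W (yj i.+1)) + (ln (i.+2%:R : R) - ln (i.+1%:R : R)).
  by rewrite /V; ring.
rewrite mulrDl addrA [X in _ <= _ + (_ + X)]mulrC addrA lerD2r.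
apply: le_trans IH; rewrite lerD2l; apply: ler_wpM2l.
  by rewrite subr_ge0 WV //= ltnW.
by rewrite exprS ler_piMl // exprn_ge0.
Qed.

End Blocks.

End MertensProduct.

Local Open Scope ring_scope.
Local Open Scope classical_set_scope.

Section MertensInfinitelyOften.
Variable R : realType.
Local Notation PE y := (prime_euler 1 (inv_nat R) y).

Lemma smooth_small y n : (0 < n <= y)%N -> smooth 1 y n.
Proof.
move=> /andP[n0 ny]; apply/allP => p; rewrite mem_primes => /and3P[pr _ pn].
rewrite (leq_trans (dvdn_leq n0 pn) ny) /= dvdn1.
by case: eqP pr => // ->.
Qed.

Let g (L : R) (n : nat) : R := expR (- (1 + L^-1) * ln (n%:R : R)).

(** The Euler product over p <= y dominates the truncated zeta sum at s = 1 + 1/L. In each factor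
    p^(- s) is 1/p scaled by p^(- 1/L) <= 1, and [ln_convex_scale] moves the scaling outside the
    logarithm. *)
Lemma zeta_vs_primes (L : R) y : 0 < L -> (0 < y)%N ->
  ln (\sum_(1 <= n < y.+1) g L n) <=
  \sum_(0 <= p < y.+1 | prime p) - ln (1 - inv_nat R p) * expR (- (ln (p%:R : R) / L)).
Proof.
move=> L0 y0.
have gM a b : (0 < a)%N -> (0 < b)%N -> g L (a * b)%N = g L a * g L b.
  by move=> a0 b0; rewrite /g natrM lnM ?posrE ?ltr0n // mulrDr expRD.
have g_ge0 a : 0 <= g L a by exact: expR_ge0.
have g1 : g L 1%N = 1 by rewrite /g ln1 mulr0 expR0.
have gE p : prime p -> g L p = expR (- (ln (p%:R : R) / L)) * inv_nat R p.
  move=> pr; have p0 : 0 < p%:R :> R by rewrite ltr0n prime_gt0.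
  have -> : inv_nat R p = expR (- ln (p%:R : R)) by rewrite expRN lnK ?posrE.
  rewrite /g -expRD; congr expR.
  by field; rewrite lt0r_neq0.
have t01 p : prime p -> 0 <= expR (- (ln (p%:R : R) / L)) <= 1.
  move=> pr; rewrite expR_ge0 expR_le1 oppr_le0 divr_ge0 ?(ltW L0) //.
  by rewrite ln_ge0 // ler1n prime_gt0.
have glt1 p : prime p -> g L p < 1.
  move=> pr; rewrite gE //; have /andP[_ t1] := t01 p pr.
  apply: le_lt_trans (inv_nat_lt1 R pr); rewrite ler_piMl //; exact: inv_nat_ge0.
have S : \sum_(1 <= n < y.+1) g L n = smooth_sum 1 (g L) y y.
  rewrite /smooth_sum big_nat_cond [RHS]big_nat_cond; apply: eq_bigl => n.
  rewrite andbT ltnS; case: (boolP (0 < n <= y)%N) => // ny.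
  by rewrite smooth_small.
have Sp : 0 < \sum_(1 <= n < y.+1) g L n.
  rewrite big_ltn // g1; apply: (@lt_le_trans _ _ 1) => //.
  by rewrite lerDl sumr_ge0.
apply: (@le_trans _ _ (ln (prime_euler 1 (g L) y))).
  rewrite ler_ln ?posrE //; last exact: prime_euler_gt0.
  by rewrite S; exact: smooth_sum_upper.
rewrite (ln_prime_euler 1 y glt1).
rewrite (eq_bigl prime); last first.
  by move=> p /=; rewrite dvdn1; case: (boolP (prime p)) => // pr; case: eqP pr => // ->.
apply: ler_sum => p pr.
rewrite gE // mulrC; rewrite [leRHS]mulrC [X in ln (1 - X)]mulrC.
by apply: ln_convex_scale; [exact: t01 | rewrite inv_nat_ge0 inv_nat_lt1].
Qed.

(** The logarithm of the truncated zeta sum is at least log L + log (1 - r^J), and at most kappa +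
    log (d L) plus a weighted sum of increments of log j. The terms log L cancel, and log d <= d +
    log (1 - r) brings in the power series with coefficients 1/j. *)
Lemma mertens_finite (d kappa : R) (Y0 J : nat) : 0 < d -> (0 < J)%N ->
  (forall y, (Y0 <= y)%N -> PE y <= expR kappa * ln (y%:R : R)) ->
  ln (1 - expR (- d) ^+ J) +
    \sum_(1 <= j < J) expR (- d) ^+ j * ((j%:R)^-1 - (ln (j.+1%:R : R) - ln (j%:R : R))) <=
  kappa + d.
Proof.
move=> d0 J0 HP; set r := expR (- d).
(* This puts the first cut at e^(Y0 + 3), so that every later cut lies in the range of the
   hypothesis on the product. *)
pose L := (Y0 + 3)%:R / d.
have L0 : 0 < L by rewrite divr_gt0 // ltr0n addnS.
have dL : d * L = (Y0 + 3)%:R by rewrite /L mulrCA mulfV ?mulr1 // lt0r_neq0.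
pose yj j : nat := Num.truncn (expR (j%:R * d * L)).
have yjY j : (0 < j)%N -> (Y0 + 3 <= yj j)%N.
  move=> j0; rewrite truncn_ge_nat ?expR_ge0 //.
  apply: (@le_trans _ _ (expR (Y0 + 3)%:R)).
    by apply: le_trans (expR_ge1Dx _); rewrite lerDr.
  rewrite ler_expR -mulrA dL -natrM ler_nat leq_pmull //.
have yj0 : (0 < yj J)%N by apply: leq_trans (yjY J J0); rewrite addnS.
have lpos j : (0 < j <= J)%N -> 0 < ln ((yj j)%:R : R).
  move=> /andP[j0 _]; rewrite ln_gt0 // ltr1n; apply: leq_trans (yjY j j0); lia.
have PEp y : 0 < PE y by apply: prime_euler_gt0; exact: inv_nat_lt1.
have HW j : (0 < j <= J)%N ->
   \sum_(0 <= p < (yj j).+1 | prime p) - ln (1 - inv_nat R p) <= ln (ln ((yj j)%:R : R)) + kappa.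
  move=> jJ; have lp := lpos j jJ.
  have -> : \sum_(0 <= p < (yj j).+1 | prime p) - ln (1 - inv_nat R p) = ln (PE (yj j)).
    rewrite (ln_prime_euler 1 _ (@inv_nat_lt1 R)); apply: eq_bigl => p.
    by rewrite dvdn1; case: (boolP (prime p)) => // pr; case: eqP pr => // ->.
  rewrite addrC -[kappa in leRHS]expRK -lnM ?posrE ?expR_gt0 //.
  rewrite ler_ln ?posrE ?mulr_gt0 ?expR_gt0 //; apply: HP.
  by case/andP: jJ => j0 _; apply: leq_trans (yjY j j0); rewrite leq_addr.
have r0 : 0 < r by exact: expR_gt0.
have r1 : r < 1 by rewrite expR_lt1 oppr_lt0.
have rJ : 0 < 1 - r ^+ J by rewrite subr_gt0 exprn_ilt1 // ?(ltW r0) // gtn_eqF.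
have lower := zeta_truncation_lower d L0 J.
have upper := zeta_vs_primes L0 yj0.
have blocks := @prime_block_sum R d L d0 L0 J.
have abel := @abel_blocks R d L d0 L0 kappa J J0 HW lpos.
have chain : ln (L * (1 - r ^+ J)) <= kappa + ln (d * L) +
    \sum_(1 <= j < J) r ^+ j * (ln (j.+1%:R : R) - ln (j%:R : R)).
  apply: le_trans abel; apply: le_trans blocks; apply: le_trans upper.
  have Lr : 0 < L * (1 - r ^+ J) by exact: mulr_gt0.
  have Sp : 0 < \sum_(1 <= n < (yj J).+1) g L n by exact: lt_le_trans lower.
  by rewrite ler_ln ?posrE.
rewrite [ln (L * _)]lnM ?posrE // [ln (d * L)]lnM ?posrE // in chain.
have r01 : 0 <= r < 1 by rewrite r1 ltW.
have ser := power_series_ln_le J r01.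
have split_sum : \sum_(1 <= j < J) r ^+ j * ((j%:R)^-1 - (ln (j.+1%:R : R) - ln (j%:R : R))) =
   \sum_(1 <= j < J) r ^+ j / j%:R - \sum_(1 <= j < J) r ^+ j * (ln (j.+1%:R : R) - ln (j%:R : R)).
  by rewrite -sumrB; apply: eq_bigr => j _; rewrite mulrBr.
have lnd : ln d - ln (1 - r) <= d.
  have r1' : 0 < 1 - r by rewrite subr_gt0.
  rewrite -ln_div ?posrE // -[leRHS]expRK ler_ln ?posrE ?divr_gt0 ?expR_gt0 //.
  rewrite ler_pdivrMr // /r mulrBr mulr1 -expRD subrr expR0.
  by rewrite lerBrDl expR_ge1Dx.
rewrite split_sum; lra.
Qed.

(* If the product stayed below [e^(gamma - eps) log y] from some point on, letting first
   [J -> oo] and then [d -> 0] in [mertens_finite] would be contradictory, [gamma] being the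
   sum of the [1/j - log (1 + 1/j)]. *)
Lemma mertens_infinitely_often (eps : R) (Y0 : nat) : 0 < eps ->
  exists2 y, (Y0 <= y)%N & expR (euler_gamma R - eps) * ln (y%:R : R) <= PE y.
Proof.
move=> e0; apply: contrapT => H.
have HP y : (Y0 <= y)%N -> PE y <= expR (euler_gamma R - eps) * ln (y%:R : R).
  move=> Yy; have [le|lt] := leP (PE y) (expR (euler_gamma R - eps) * ln (y%:R : R)) => //.
  by exfalso; apply: H; exists y => //; exact: ltW.
pose J0 := (Num.truncn (4 / eps)).+1.
have J0p : (0 < J0)%N by [].
have J0R : 0 < J0%:R :> R by rewrite ltr0n.
have J0e : (J0%:R : R)^-1 <= eps / 4.
  have e4 : 0 <= 4 / eps by rewrite divr_ge0 // ltW.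
  have /andP[_ h] := truncn_itv e4.
  by rewrite -[eps / 4]invf_div lef_pV2 ?posrE ?divr_gt0 //; exact: ltW.
set c := \sum_(1 <= j < J0) ((j%:R)^-1 - (ln (j.+1%:R : R) - ln (j%:R : R))).
have cg : euler_gamma R - (J0%:R)^-1 <= c by exact: sum_inv_sub_ln_ge.
have c1 : c <= 1 by exact: sum_inv_sub_ln_le1.
have tpos j : (0 < j)%N -> 0 <= (j%:R)^-1 - (ln (j.+1%:R : R) - ln (j%:R : R)).
  by move=> j0; rewrite subr_ge0 ln_ratio_le.
have c0 : 0 <= c.
  by rewrite /c big_nat_cond; apply: sumr_ge0 => j /andP[/andP[j0 _] _]; exact: tpos.
(* Of the deficit [eps], one quarter goes to 1/J0, one to log (1 - r^J) and one to d J0 + d; the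
   remaining quarter is the contradiction. *)
pose d := eps / (4 * (J0.+1)%:R).
have d0 : 0 < d by rewrite divr_gt0 // mulr_gt0.
have dJ : d * J0%:R + d = eps / 4.
  rewrite -{2}[d]mulr1 -mulrDr natr1 /d.
  have : J0.+1%:R != 0 :> R by rewrite pnatr_eq0.
  by move: (J0.+1%:R : R) => t t0; field.
set r := expR (- d).
have r0 : 0 < r by exact: expR_gt0.
have r1 : r <= 1 by rewrite expR_le1 oppr_le0 ltW.
pose eta := 1 - expR (- (eps / 4)).
have eta0 : 0 < eta by rewrite subr_gt0 expR_lt1 oppr_lt0 divr_gt0.
have [J JJ0 Jsmall] : exists2 J, (J0 <= J)%N & r ^+ J < eta.
  pose J := (J0 + (Num.truncn (d * eta)^-1).+1)%N.
  exists J; first exact: leq_addr.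
  rewrite /r -expRM_natl mulrN expRN -[eta]invrK ltf_pV2 ?posrE ?invr_gt0 ?expR_gt0 //.
  have de : 0 <= (d * eta)^-1 by rewrite invr_ge0 ltW // mulr_gt0.
  have /andP[_ h] := truncn_itv de.
  apply: lt_le_trans (expR_ge1Dx _).
  have : (d * eta)^-1 < J%:R by apply: lt_le_trans h _; rewrite ler_nat leq_addl.
  rewrite invfM -ltr_pdivlMl ?invr_gt0 // invrK mulrC => h2.
  by apply: lt_trans h2 _; rewrite ltrDr.
have J0' : (0 < J)%N by exact: leq_trans J0p JJ0.
have K := mertens_finite d0 J0' HP; rewrite -/r in K.
have lnl : - (eps / 4) <= ln (1 - r ^+ J).
  have e1 : expR (- (eps / 4)) <= 1 - r ^+ J by rewrite /eta in Jsmall; lra.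
  rewrite -[leLHS]expRK ler_ln ?posrE ?expR_gt0 //.
  by apply: lt_le_trans e1; exact: expR_gt0.
have suml : c - d * J0%:R <= \sum_(1 <= j < J) r ^+ j * ((j%:R)^-1 - (ln (j.+1%:R : R) - ln (j%:R : R))).
  apply: (@le_trans _ _ (r ^+ J0 * c)).
    have rJ : 1 - d * J0%:R <= r ^+ J0.
      rewrite /r -expRM_natl mulrN mulrC; exact: expR_ge1Dx.
    have dJ0 : 0 <= d * J0%:R by rewrite mulr_ge0 // ltW.
    have := ler_wpM2r c0 rJ; rewrite mulrBl mul1r.
    have : d * J0%:R * c <= d * J0%:R by rewrite ler_piMr.
    lra.
  rewrite (@big_cat_nat _ _ _ J0) //= -[leLHS]addr0; apply: lerD.
    rewrite mulr_sumr; apply: ler_sum_nat => j /andP[j0 jJ].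
    apply: ler_wpM2r; first exact: tpos.
    by apply: ler_wiXn2l; rewrite ?(ltW r0) // ltnW.
  rewrite big_nat_cond; apply: sumr_ge0 => j /andP[/andP[j0 _] _].
  by rewrite mulr_ge0 ?exprn_ge0 ?(ltW r0) // tpos // (leq_trans J0p).
lra.
Qed.

End MertensInfinitelyOften.

Local Open Scope ring_scope.

(** * The family of twists *)

Section TwistedFamily.
Variable R : realType.
Local Notation C := R[i].
Variables (y m q1 : nat) (xi : nat -> C) (neg : bool).
Hypothesis m13 : m = 1%N \/ m = 3%N.
Hypothesis y3 : (3 <= y)%N.
Hypothesis xic : natchar q1 xi.
Hypothesis q1big : forall p, prime p -> (p %| q1)%N -> (y ^ 3 < p)%N.
Hypothesis xi1 : forall p, prime p -> (p <= y)%N -> xi p = 1.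

(* The moduli are [m] or [- m] modulo [family_step]; the sign [neg] will be adjusted to
   [xi (- 1)] so that [family_char] is odd. *)
Definition family_step : nat :=
  (8 * (\prod_(0 <= p < y.+1 | prime p && ~~ (p %| m)) p) * q1)%N.
Definition family_start : nat :=
  (if neg then family_step - m else family_step + m)%N.
(** The factor [m] in the step puts the members in the form M (m j + 1) + m or M (m j + 1) - m,
    which is coprime to [m] because [family_step] is. *)
Definition family_disc (j : nat) : nat := (family_start + family_step * m * j)%N.
Local Notation M := family_step.
Local Notation D := family_disc.

Let q10 : (0 < q1)%N. Proof. by case: xic. Qed.
Let m0 : (0 < m)%N. Proof. by case: m13 => ->. Qed.
Let m3 : (m <= 3)%N. Proof. by case: m13 => ->. Qed.
Let om : odd m. Proof. by case: m13 => ->. Qed.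

Lemma big_prime_gt p : prime p -> (p %| q1)%N -> (y < p)%N.
Proof.
move=> pr pq; apply: leq_ltn_trans (q1big pr pq).
by rewrite -{1}[y]expn1 leq_pexp2l //; apply: leq_trans y3.
Qed.

Let prodp_gt0 : (0 < \prod_(0 <= p < y.+1 | prime p && ~~ (p %| m)) p)%N.
Proof. by apply: prodn_cond_gt0 => p /andP[/prime_gt0]. Qed.

Lemma family_step_gt0 : (8 <= M)%N.
Proof. by rewrite -[8%N]muln1 /M -mulnA leq_mul2l /= muln_gt0 prodp_gt0. Qed.

Let mM : (m < M)%N.
Proof. exact: leq_ltn_trans m3 (leq_trans _ family_step_gt0). Qed.

Lemma family_step_dvd8 : (8 %| M)%N.
Proof. by rewrite /M -mulnA dvdn_mulr. Qed.

Lemma family_step_dvd_prime p : prime p -> (p <= y)%N -> ~~ (p %| m)%N -> (8 * p %| M)%N.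
Proof.
move=> pr py pm; rewrite /M; apply: dvdn_mulr; apply: dvdn_mul => //.
rewrite big_mkcond (big_rem p) /=; last by rewrite mem_index_iota.
by rewrite pr pm dvdn_mulr.
Qed.

Lemma family_step_dvd_q1 : (q1 %| M)%N.
Proof. by rewrite /M dvdn_mull. Qed.

Lemma prime_dvd_family_step p : prime p -> (p %| M)%N ->
  p = 2 \/ ((p <= y)%N /\ ~~ (p %| m)%N) \/ (p %| q1)%N.
Proof.
move=> pr; rewrite /M Euclid_dvdM // => /orP[|]; last by right; right.
rewrite Euclid_dvdM // => /orP[p8|].
  left; apply/eqP; rewrite -(dvdn_prime2 pr) //.
  by move: p8; rewrite -[8%N]/(2 ^ 3)%N Euclid_dvdX // => /andP[].
rewrite big_seq_cond; elim/big_rec : _ => [|p' x /andP[p'y /andP[pr' pm]] IH].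
  by rewrite dvdn1; case: eqP pr => [->|].
rewrite Euclid_dvdM // => /orP[|/IH //].
rewrite dvdn_prime2 // => /eqP E; right; left; rewrite E; split => //.
by move: p'y; rewrite mem_index_iota.
Qed.

Lemma coprime_family_step_m : coprime M m.
Proof.
rewrite coprime_sym; apply: coprime_no_prime; last by apply: leq_trans family_step_gt0.
move=> p pr pm pM; case: (prime_dvd_family_step pr pM) => [p2|[[_]|pq]].
- by move: pm; rewrite p2; case: m13 => ->.
- by rewrite pm.
- have := big_prime_gt pr pq; have := dvdn_leq m0 pm; lia.
Qed.

Lemma family_discE j : if neg then (D j + m = M * (m * j + 1))%N else
  (D j = M * (m * j + 1) + m)%N.
Proof.
rewrite /D /family_start; case: neg; rewrite mulnDr muln1.
  by rewrite addnAC subnK ?(ltnW mM) // -mulnA addnC.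
by rewrite -mulnA addnAC [(M * (m * j) + M)%N]addnC.
Qed.

Lemma family_disc_congr d j : (d %| M)%N -> D j = m %[mod d] \/ (d %| D j + m)%N.
Proof.
move=> dM; have := family_discE j; case: neg => ->; [right | left].
  exact: dvdn_mulr.
have [u ->] := dvdnP dM; rewrite mulnAC.
by rewrite modnMDl.
Qed.

Lemma prime_dvd_disc_step p j : prime p -> (p %| D j)%N -> (p %| M)%N -> (p %| m)%N.
Proof.
move=> pr pD pM; have [E|dv] := family_disc_congr j pM.
  by move: pD; rewrite /dvdn E.
by move: dv; rewrite dvdn_addr.
Qed.

Lemma odd_family_disc j : odd (D j).
Proof.
have M2 : (2 %| M)%N by apply: dvdn_trans family_step_dvd8.
have eM : odd M = false by rewrite -[odd M]negbK -dvdn2 M2.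
have := family_discE j; case: neg => E.
  by have := congr1 odd E; rewrite oddD oddM eM om /=; case: (odd _).
by rewrite E oddD oddM eM om.
Qed.

Lemma coprime_disc_m j : coprime (D j) m.
Proof.
rewrite coprime_sym; apply: coprime_no_prime; last exact: odd_gt0 (odd_family_disc j).
move=> p pr pm pD; have := family_discE j.
have pM : ~~ (p %| M)%N.
  apply/negP => pM; have /eqP := coprime_family_step_m.
  have : (p %| gcdn M m)%N by rewrite dvdn_gcd pM.
  by move=> /[swap] ->; rewrite dvdn1; case: eqP pr => [->|].
have pm1 : ~~ (p %| m * j + 1)%N.
  by rewrite dvdn_addr ?dvdn_mulr // dvdn1; case: eqP pr => [->|].
have nd : ~~ (p %| M * (m * j + 1))%N by rewrite Euclid_dvdM // negb_or pM.
case: neg => E; move: nd; first by rewrite -E dvdn_addr // pm.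
by move: pD; rewrite E dvdn_addl // => ->.
Qed.

Lemma prime_dvd_disc_gt p j : prime p -> (p %| D j)%N -> (y < p)%N.
Proof.
move=> pr pD; rewrite ltnNge; apply/negP => py.
have pm : ~~ (p %| m)%N.
  apply/negP => pm; have /eqP := coprime_disc_m j.
  have : (p %| gcdn (D j) m)%N by rewrite dvdn_gcd pD.
  by move=> /[swap] ->; rewrite dvdn1; case: eqP pr => [->|].
have pM : (p %| M)%N.
  by apply: dvdn_trans (family_step_dvd_prime pr py pm); rewrite dvdn_mull.
by move: pm; rewrite (prime_dvd_disc_step pr pD pM).
Qed.

Lemma prime_dvd_disc_notin p j : prime p -> (p %| D j)%N -> ~~ (p %| M * m)%N.
Proof.
move=> pr pD; have yp := prime_dvd_disc_gt pr pD.
have pm : ~~ (p %| m)%N by apply/negP => /(dvdn_leq m0); lia.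
rewrite Euclid_dvdM // negb_or pm andbT.
by apply/negP => /(prime_dvd_disc_step pr pD); rewrite (negbTE pm).
Qed.

Lemma coprime_disc_q1 j : coprime (D j) q1.
Proof.
apply: coprime_no_prime => // p pr pD pq.
have := prime_dvd_disc_notin pr pD; rewrite dvdn_mulr //.
exact: dvdn_trans pq family_step_dvd_q1.
Qed.

Definition family_char (j n : nat) : C := xi n * jacC R (D j) n * jacC R m n.

Local Notation theta := family_char.

Lemma family_charM j a b : theta j (a * b) = theta j a * theta j b.
Proof.
rewrite /family_char; case: xic => _ _ -> _.
rewrite /jacC !jacM ?odd_family_disc // !rmorphM /=; ring.
Qed.

Lemma family_char1 j : theta j 1 = 1.
Proof.
by rewrite /family_char (natchar1 xic) /jacC !jac1 ?odd_family_disc // !mulr1.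
Qed.

Lemma family_char_abs_le1 j n : cabs (theta j n) <= 1.
Proof.
rewrite !cabsM; have a := natchar_abs_le1 xic n.
have b := natchar_abs_le1 (natchar_jacC R (odd_family_disc j)) n.
have c := natchar_abs_le1 (natchar_jacC R om) n.
rewrite -[leRHS]mulr1 -[X in _ <= X * _]mulr1.
by rewrite !ler_pM ?mulr_ge0 ?cabs_ge0.
Qed.

(** At these primes (p/D) = (p/m) by [jac_prime_congr], so the two symbols multiply to a square,
    while [xi] is 1. *)
Lemma family_char_prime j p : prime p -> (p <= y)%N -> ~~ (p %| m)%N -> theta j p = 1.
Proof.
move=> pr py pm; rewrite /family_char xi1 // mul1r /jacC.
rewrite (jac_prime_congr om (odd_family_disc j) pr); last first.
  apply: family_disc_congr; exact: family_step_dvd_prime.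
by rewrite -rmorphM -expr2 jac_sqr prime_coprime // pm.
Qed.

Lemma family_char_smooth j n : (0 < n)%N -> smooth m y n -> theta j n = 1.
Proof.
move=> n0 /allP sm; rewrite (prod_prime_decomp n0) prime_decompE big_map /=.
have mor := big_morph (theta j) (family_charM j) (family_char1 j).
rewrite mor big_seq big1 // => p pn.
have /andP[py pm] := sm p pn.
have pr : prime p by move: pn; rewrite mem_primes => /andP[].
by elim: (logn p n) => [|a IH]; rewrite ?expn0 ?family_char1 // expnS family_charM IH family_char_prime // mulr1.
Qed.

Lemma family_char_dvd_m j p n : prime p -> (p %| m)%N -> (p %| n)%N -> theta j n = 0.
Proof.
move=> pr pm pn; rewrite /family_char [jacC R m n](natchar_notcoprime (natchar_jacC R om)) ?mulr0 //.
apply/negP => /eqP cop; have : (p %| gcdn n m)%N by rewrite dvdn_gcd pn.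
by rewrite cop dvdn1; case: eqP pr => [->|].
Qed.

(* Only at these [n] may the primitive character inducing [family_char] differ from it. *)
Definition exceptional (j n : nat) : bool := has (fun p => (p %| q1) || (p ^ 2 %| D j))%N (primes n).

(** If [p] did not divide [d], then [d] would divide q1 D / p. The sign-flipping integer that is 1
    modulo q1 and modulo D / p is then 1 modulo [d], yet the character is - 1 there. *)
Lemma conductor_prime d (chi : nat -> C) j p : natchar d chi -> (d %| q1 * D j)%N ->
  (forall n, coprime n (q1 * D j) -> chi n = xi n * jacC R (D j) n) ->
  prime p -> (p %| D j)%N -> ~~ (p ^ 2 %| D j)%N -> (p %| d)%N.
Proof.
move=> cc dq chiE pr pD p2; apply/negPn/negP => pd.
have Dodd := odd_family_disc j; have D0 := odd_gt0 Dodd.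
have [e De] := dvdnP pD.
have pe : ~~ (p %| e)%N.
  by apply: contra p2 => /dvdnP[u Eu]; rewrite De Eu -mulnA mulnn dvdn_mull.
have [oe op] : odd e /\ odd p by move: Dodd; rewrite De oddM => /andP[].
have pq1 : ~~ (p %| q1)%N.
  apply: contra (prime_dvd_disc_notin pr pD) => pq; rewrite dvdn_mulr //.
  exact: dvdn_trans pq family_step_dvd_q1.
have [n [n1 cn sn]] := exists_sign_flip pr op (isT : odd 1) oe pe q10 pq1.
have DE : (p ^ 1 * e = D j)%N by rewrite expn1 De mulnC.
rewrite DE in cn sn.
have nq1 : n = 1 %[mod q1].
  have dv : (q1 %| 4 * q1 * e)%N by rewrite -mulnA dvdn_mull // dvdn_mulr.
  by rewrite -(modn_dvdm n dv) -(modn_dvdm 1 dv) n1.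
have nd : n = 1 %[mod d].
  have dv : (d %| 4 * q1 * e)%N.
    rewrite -mulnA dvdn_mull //; move: dq; rewrite De mulnA mulnC Gauss_dvdr //.
    by rewrite coprime_sym prime_coprime.
  by rewrite -(modn_dvdm n dv) -(modn_dvdm 1 dv) n1.
have cnq : coprime n (q1 * D j) by rewrite coprimeMr cn (coprime_eqmod nq1) coprime1n.
have := chiE n cnq; rewrite (natchar_eqmod cc nd) (natchar1 cc) (natchar_eqmod xic nq1) (natchar1 xic).
rewrite mul1r /jacC /jac cn sn expr1 => /eqP.
by rewrite rmorphN rmorph1 -subr_eq0 opprK -mulr2n pnatr_eq0.
Qed.

(** A nonexceptional [n] that is not coprime to q1 D shares with it a prime dividing [D] exactly
    once; by [conductor_prime] this prime divides the conductor, so both sides are 0. *)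
Lemma induced_character j : exists d (chi : nat -> C),
  [/\ (d %| q1 * D j)%N, natchar d chi, separating d chi,
      forall n, coprime n (q1 * D j) -> chi n = xi n * jacC R (D j) n &
      forall n, (0 < n)%N -> ~~ exceptional j n -> chi n * jacC R m n = theta j n].
Proof.
have qc : natchar (q1 * D j) (fun n => xi n * jacC R (D j) n).
  apply: natcharM => //; first by rewrite coprime_sym coprime_disc_q1.
  exact/natchar_jacC/odd_family_disc.
have [d [chi [dq cc sep chiE]]] := conductor_exists qc.
exists d, chi; split => // n n0 nb.
have [cop|ncop] := boolP (coprime n (q1 * D j)); first by rewrite chiE.
have D0 := odd_gt0 (odd_family_disc j).
have [p [pr pn pqD]] : exists p, [/\ prime p, (p %| n)%N & (p %| q1 * D j)%N].
  apply: contrapT => H; move: ncop; rewrite coprime_no_prime // ?muln_gt0 ?q10 //.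
  by move=> p pr pn pq; apply: H; exists p.
have pb : ~~ ((p %| q1) || (p ^ 2 %| D j))%N.
  by move: nb; rewrite /exceptional -all_predC => /allP/(_ p); apply; rewrite mem_primes pr n0.
move: pb; rewrite negb_or => /andP[pq1 p2].
have pD : (p %| D j)%N by move: pqD; rewrite Euclid_dvdM // (negbTE pq1).
have pd := conductor_prime cc dq chiE pr pD p2.
have nc e : (p %| e)%N -> ~~ coprime n e.
  move=> pe; apply/negP => /eqP cop; have : (p %| gcdn n e)%N by rewrite dvdn_gcd pn.
  by rewrite cop dvdn1; case: eqP pr => [->|].
rewrite /family_char (natchar_notcoprime cc (nc d pd)).
by rewrite [jacC R (D j) n](natchar_notcoprime (natchar_jacC R (odd_family_disc j))) ?nc // mulr0 !mul0r.
Qed.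

End TwistedFamily.

Section AverageTools.
Variable R : realType.
Local Notation C := R[i].

Lemma cabs_int (z : int) : cabs (z%:~R : C) = (`|z|)%:~R.
Proof.
by rewrite -(rmorph_int (real_complex R)) cabs_real intr_norm.
Qed.

Lemma Re_nat n : complex.Re (n%:R : C) = n%:R.
Proof. by rewrite -(rmorph_nat (real_complex R)). Qed.

Lemma sumr_const_list (I : Type) (s : seq I) (a : R) :
  \sum_(i <- s) a = (size s)%:R * a.
Proof.
by elim: s => [|i s IH]; rewrite ?big_nil ?mul0r // big_cons IH /= mulrS mulrDl mul1r.
Qed.

Lemma Re_lower (z : C) a : cabs z <= a -> - a <= complex.Re z.
Proof.
move=> za; rewrite lerNl; apply: le_trans za.
by rewrite -cabsN; apply: le_trans (Re_le_cabs _); case: z.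
Qed.

Lemma sum_inv_sqr_le y N : (0 < y)%N ->
  \sum_(y.+1 <= t < N.+1) ((t ^ 2)%:R : R)^-1 <= (y%:R)^-1.
Proof.
move=> y0; have [yN|Ny] := ltnP y N; last first.
  by rewrite big_geq // invr_ge0 ler0n.
apply: (@le_trans _ _ (\sum_(y.+1 <= t < N.+1) - ((t%:R)^-1 - (t.-1%:R)^-1))).
  apply: ler_sum_nat => t /andP[yt _].
  have t1 : (0 < t.-1)%N by lia.
  have a : 0 < t.-1%:R :> R by rewrite ltr0n.
  have -> : t%:R = t.-1%:R + 1 :> R by rewrite natr1 prednK //; lia.
  have -> : (t ^ 2)%:R = (t.-1%:R + 1) ^+ 2 :> R by rewrite natr1 prednK ?natrX //; lia.
  move: (t.-1%:R : R) a => x x0.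
  have -> : - ((x + 1)^-1 - x^-1) = (x * (x + 1))^-1.
    by field; rewrite !lt0r_neq0 // addr_gt0.
  by rewrite lef_pV2 ?posrE ?exprn_gt0 ?mulr_gt0 ?addr_gt0 // expr2 ler_pM2r ?addr_gt0 // lerDl.
rewrite sumrN big_add1 /= (telescope_sumr (fun t => (t%:R : R)^-1)); last exact: ltnW.
by rewrite opprB gerBl invr_ge0 ler0n.
Qed.

Lemma count_progression d c L K : coprime d L ->
  (\sum_(0 <= j < K) (d %| c + L * j) <= K %/ d + 1)%N.
Proof.
move=> cop; set A := [seq j <- iota 0 K | (d %| c + L * j)%N].
have -> : (\sum_(0 <= j < K) (d %| c + L * j) = size A)%N.
  by rewrite size_filter -sum1_count [RHS]big_mkcond /index_iota subn0.
have same i j : (i <= j)%N -> (d %| c + L * i)%N -> (d %| c + L * j)%N -> (d %| j - i)%N.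
  move=> ij di dj; rewrite -(Gauss_dvdr _ cop) mulnBr.
  by rewrite -(subnDl c); apply: dvdn_sub.
have inj : {in A &, injective (fun j => j %/ d)%N}.
  move=> i j; rewrite !mem_filter => /andP[di _] /andP[dj _].
  wlog ij : i j di dj / (i <= j)%N.
    by move=> H E; have [ij|ji] := leqP i j; [exact: H | apply/esym/H => //; exact: ltnW].
  move=> /= E; have := same i j ij di dj => dv.
  have [d0|d0] := posnP d.
    by move: dv; rewrite d0 dvd0n subn_eq0 => ji; apply/eqP; rewrite eqn_leq ij.
  have : j = i %[mod d] by apply/eqP; rewrite eqn_mod_dvd.
  by move=> Em; rewrite (divn_eq i d) (divn_eq j d) E Em.
rewrite -(size_map (fun j => j %/ d)%N) addn1 -(size_iota 0 (K %/ d).+1).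
apply: uniq_leq_size; first by rewrite map_inj_in_uniq // filter_uniq // iota_uniq.
move=> x /mapP[j]; rewrite mem_filter mem_iota => /andP[_ /andP[_ jK]] ->.
by rewrite mem_iota /= add0n ltnS leq_div2r // ltnW.
Qed.

Lemma sum_harmonic_multiples p N : (0 < p)%N ->
  \sum_(1 <= n < N.+1) (p %| n)%N%:R * (n%:R : R)^-1 <= hsum R N / p%:R.
Proof.
move=> p0; rewrite (eq_bigr (fun n => if (p %| n)%N then (n%:R : R)^-1 else 0)); last first.
  by move=> n _; case: ifP; rewrite ?mul1r ?mul0r.
rewrite -big_mkcond /= sum_dvdn_div //.
rewrite (eq_bigr (fun n => (p%:R)^-1 * (n%:R : R)^-1)); last by move=> n _; rewrite natrM invfM.
rewrite -mulr_sumr mulrC ler_wpM2r ?invr_ge0 ?ler0n // /hsum.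
rewrite [leRHS](@big_cat_nat _ _ _ (N %/ p).+1) //=; last by rewrite ltnS leq_div.
by rewrite lerDl sumr_ge0 // => i _; rewrite invr_ge0 ler0n.
Qed.

End AverageTools.

(** * The average over the family *)

Section Average.
Variable R : realType.
Local Notation C := R[i].
Variables (y m q1 : nat) (xi : nat -> C) (neg : bool).
Hypothesis m13 : m = 1%N \/ m = 3%N.
Hypothesis y3 : (3 <= y)%N.
Hypothesis xic : natchar q1 xi.
Hypothesis q1big : forall p, prime p -> (p %| q1)%N -> (y ^ 3 < p)%N.
Hypothesis xi1 : forall p, prime p -> (p <= y)%N -> xi p = 1.
Local Notation D := (family_disc y m q1 neg).
Local Notation M := (family_step y m q1).
Local Notation theta := (family_char y m q1 xi neg).
Local Notation exceptional := (exceptional y m q1 neg).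
Variable N : nat.
Hypothesis N0 : (0 < N)%N.

Let m0 : (0 < m)%N. Proof. by case: m13 => ->. Qed.
Let y0 : (0 < y)%N. Proof. exact: leq_trans y3. Qed.

(** For n <= N coprime to [m], this holds whenever the part of [n] made of primes above [y] is a
    square other than 1, the case in which the symbols (n/D) do not oscillate. *)
Definition square_rough n : bool :=
  has (fun t => (t ^ 2 %| n)%N && smooth m y (n %/ t ^ 2)) (index_iota y.+1 N.+1).

(** Write n = s r with [r] the part made of primes above [y]; the character is 1 at the smooth part
    [s]. A nonsquare [r] is handled by [jac_lower_progression_sum], a square by the trivial bound
    [N]. *)
Lemma family_char_sum_nonsmooth n : (0 < n <= N)%N -> ~~ smooth m y n ->
  cabs (\sum_(0 <= j < N) theta j n) <= n%:R + N%:R * (square_rough n)%:R.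
Proof.
move=> /andP[n0 nN] nsm.
have pos : 0 <= n%:R + N%:R * (square_rough n)%:R :> R.
  by rewrite addr_ge0 ?mulr_ge0 ?ler0n.
have [|nomn] := boolP (has (fun p => p %| m)%N (primes n)).
  move=> /hasP[p]; rewrite mem_primes => /and3P[pr _ pn] pm.
  rewrite big1 ?cabs0 // => j _; exact: (family_char_dvd_m y q1 xi neg m13 j pr pm pn).
pose pi : nat_pred := [pred p | (p <= y)%N].
pose s := partn n pi; pose r := partn n (negn pi).
have nE : (s * r)%N = n by exact: partnC.
have s0 : (0 < s)%N by exact: part_gt0.
have r0 : (0 < r)%N by exact: part_gt0.
have sn : (s %| n)%N by rewrite -nE dvdn_mulr.
have rn : (r %| n)%N by rewrite -nE dvdn_mull.
have rough p : prime p -> (p %| r)%N -> (y < p)%N.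
  move=> pr pd; have := pnat_dvd pd (part_pnat _ _).
  by rewrite pnatE // !inE -ltnNge.
have sms : smooth m y s.
  apply/allP => p; rewrite mem_primes => /and3P[pr _ ps].
  have := pnat_dvd ps (part_pnat _ _); rewrite pnatE // inE => -> /=.
  move: nomn; rewrite -all_predC => /allP/(_ p); apply.
  by rewrite mem_primes pr n0 (dvdn_trans ps sn).
have th j : theta j n = theta j r.
  by rewrite -nE (family_charM y neg m13 xic) // (family_char_smooth neg m13 xic xi1) // mul1r.
have r1 : r != 1%N by apply: contra nsm => /eqP r1; rewrite -nE r1 muln1.
have [[t rt]|nsq] := pselect (exists t, r = (t ^ 2)%N).
  have Ind : square_rough n.
    apply/hasP; exists t.
      have t1 : (1 < t)%N.
        by case: t rt r1 r0 => [|[|t]] // -> //; rewrite ?exp1n // exp0n.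
      have yt : (y < t)%N.
        have := pdiv_prime t1 => pr; have := dvdn_leq (ltnW t1) (pdiv_dvd t).
        apply: leq_trans; apply: rough => //.
        by rewrite rt dvdn_exp // pdiv_dvd.
      have tN : (t <= N)%N.
        apply: leq_trans nN; apply: (@leq_trans r); last exact: dvdn_leq.
        by rewrite rt -{1}[t]expn1 leq_pexp2l // ltnW.
      by rewrite mem_index_iota yt ltnS.
    by rewrite -rt rn /= -{1}nE mulnK.
  rewrite Ind mulr1; apply: (le_trans (cabs_sum _ _ _)).
  apply: (@le_trans _ _ (\sum_(0 <= j < N) 1)).
    by apply: ler_sum => j _; exact: (family_char_abs_le1 y neg m13 xic).
  by rewrite sumr_const_nat subn0 lerDr ler0n.
apply: (@le_trans _ _ n%:R); last by rewrite lerDl mulr_ge0 ?ler0n.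
have [cq|ncq] := boolP (coprime r q1); last first.
  rewrite big1 ?cabs0 ?ler0n // => j _.
  by rewrite th /family_char (natchar_notcoprime xic ncq) !mul0r.
rewrite (eq_bigr (fun j => xi r * jacC R m r * (jac (D j) r)%:~R)); last first.
  by move=> j _; rewrite th /family_char /jacC; ring.
rewrite -mulr_sumr -rmorph_sum /= cabsM cabsM cabs_int.
have nop p : prime p -> (p %| r)%N -> ~~ (p %| M * m)%N.
  move=> pr pd; have yp := rough p pr pd.
  rewrite Euclid_dvdM // negb_or; apply/andP; split; last first.
    by apply/negP => /(dvdn_leq m0); case: m13 => ->; lia.
  apply/negP => /(prime_dvd_family_step pr)[p2|[[py _]|pq]]; [lia|lia|].
  have : (p %| gcdn r q1)%N by rewrite dvdn_gcd pd.
  by rewrite (eqP cq) dvdn1; case: eqP pr => [->|].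
have cL : coprime (M * m) r.
  by rewrite coprime_sym; apply: coprime_no_prime => [p pr pd pL|];
    [move: (nop p pr pd); rewrite pL | rewrite muln_gt0 m0 andbT; apply: leq_trans (family_step_gt0 y m xic)].
have oddr : odd r.
  rewrite -[odd r]negbK -dvdn2; apply/negP => r2.
  by have := rough 2 isT r2; lia.
have L4 : (4 %| M * m)%N.
  by apply: dvdn_mulr; apply: dvdn_trans (family_step_dvd8 y m q1).
have oc : odd (family_start y m q1 neg).
  by have := odd_family_disc y neg m13 xic 0; rewrite /family_disc muln0 addn0.
have nsq' t : r <> (t ^ 2)%N by move=> E; apply: nsq; exists t.
have key := jac_lower_progression_sum N oddr oc L4 cL nsq'.
apply: (@le_trans _ _ (1 * 1 * (r%:Z)%:~R)).
  apply: ler_pM; rewrite ?mulr_ge0 ?cabs_ge0 ?ler0z ?normr_ge0 //; last by rewrite ler_int.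
  apply: ler_pM; rewrite ?cabs_ge0 //; first exact: (natchar_abs_le1 xic).
  by apply: (natchar_abs_le1 (q := m)); apply: natchar_jacC; case: m13 => ->.
by rewrite !mul1r -[r%:Z]natz rmorph_nat ler_nat dvdn_leq.
Qed.

Lemma family_char_sum_Re n : (0 < n <= N)%N ->
  N%:R * (smooth m y n)%:R - n%:R - N%:R * (square_rough n)%:R <=
  complex.Re (\sum_(0 <= j < N) theta j n).
Proof.
move=> nN; have [sm|nsm] := boolP (smooth m y n).
  rewrite (eq_bigr (fun=> 1)); last first.
    by move=> j _; rewrite (family_char_smooth neg m13 xic xi1) //; case/andP: nN.
  rewrite sumr_const_nat subn0 Re_nat mulr1.
  by rewrite -addrA gerDl -opprD oppr_le0 addr_ge0 ?mulr_ge0 ?ler0n.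
by rewrite mulr0 sub0r -opprD; apply: Re_lower; exact: family_char_sum_nonsmooth.
Qed.

Local Notation S := (smooth_sum m (inv_nat R) y N).

Lemma square_rough_sum :
  \sum_(1 <= n < N.+1) (square_rough n)%:R * (n%:R : R)^-1 <= S / y%:R.
Proof.
apply: (@le_trans _ _ (\sum_(1 <= n < N.+1) \sum_(y.+1 <= t < N.+1)
   ((t ^ 2 %| n)%N && smooth m y (n %/ t ^ 2))%:R * (n%:R : R)^-1)).
  apply: ler_sum_nat => n _; rewrite -mulr_suml ler_wpM2r ?invr_ge0 ?ler0n //.
  have [/hasP[t tin ht]|_] := boolP (square_rough n); last by rewrite sumr_ge0.
  rewrite (big_rem t) //= ht lerDl sumr_ge0 //.
rewrite exchange_big /=.
apply: (@le_trans _ _ (\sum_(y.+1 <= t < N.+1) ((t ^ 2)%:R : R)^-1 * S)).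
  apply: ler_sum_nat => t /andP[yt _].
  have t20 : (0 < t ^ 2)%N by rewrite expn_gt0; apply/orP; left; exact: leq_trans yt.
  rewrite (eq_bigr (fun n => if (t ^ 2 %| n)%N then (smooth m y (n %/ t ^ 2))%:R * (n%:R : R)^-1 else 0)).
    rewrite -big_mkcond sum_dvdn_div //.
    rewrite (eq_bigr (fun n => ((t ^ 2)%:R)^-1 * ((smooth m y n)%:R * (n%:R : R)^-1))).
      rewrite -mulr_sumr ler_wpM2l ?invr_ge0 ?ler0n //.
      apply: (@le_trans _ _ (smooth_sum m (inv_nat R) y (N %/ t ^ 2))).
        rewrite /smooth_sum [leRHS]big_mkcond; apply: ler_sum => n _.
        by case: ifP => _; rewrite ?mul1r ?mul0r.
      by apply: smooth_sum_le; [exact: inv_nat_ge0 | exact: leq_div].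
    by move=> n _; rewrite mulKn // natrM invfM mulrCA.
  by move=> n _; case: ifP => _; rewrite ?mul0r.
rewrite -mulr_suml mulrC ler_wpM2l ?sum_inv_sqr_le //.
by apply: smooth_sum_ge0; exact: inv_nat_ge0.
Qed.

(** The error [n] of each nonsmooth integer is cancelled by the weight 1/n, so these errors total at
    most [N]: a constant for each of the [N] twists. *)
Lemma average_family_char :
  N%:R * S * (1 - (y%:R)^-1) - N%:R <=
  \sum_(0 <= j < N) complex.Re (\sum_(1 <= n < N.+1) theta j n * (((n%:R)^-1)%:C)%C).
Proof.
have -> : \sum_(0 <= j < N) complex.Re (\sum_(1 <= n < N.+1) theta j n * (((n%:R)^-1)%:C)%C) =
   \sum_(1 <= n < N.+1) (n%:R)^-1 * complex.Re (\sum_(0 <= j < N) theta j n).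
  rewrite -Re_sum exchange_big /= Re_sum; apply: eq_bigr => n _.
  by rewrite -mulr_suml mulrC Re_realM.
apply: (@le_trans _ _ (\sum_(1 <= n < N.+1) (n%:R)^-1 *
   (N%:R * (smooth m y n)%:R - n%:R - N%:R * (square_rough n)%:R))); last first.
  apply: ler_sum_nat => n nN; rewrite ler_wpM2l ?invr_ge0 ?ler0n //.
  exact: family_char_sum_Re.
rewrite (eq_big_nat _ _ (F2 := fun n => N%:R * ((smooth m y n)%:R * (n%:R)^-1) - 1 -
   N%:R * ((square_rough n)%:R * (n%:R)^-1))); last first.
  move=> n /andP[n0 _]; have nz : n%:R != 0 :> R by rewrite pnatr_eq0 -lt0n.
  by rewrite !mulrBr mulVf //; ring.
rewrite !sumrB -!mulr_sumr sumr_const_nat subn1 /=.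
have -> : \sum_(1 <= n < N.+1) (smooth m y n)%:R * (n%:R : R)^-1 = S.
  rewrite /smooth_sum [RHS]big_mkcond; apply: eq_bigr => n _.
  by case: ifP => _; rewrite ?mul1r ?mul0r.
have NR : 0 <= N%:R :> R by rewrite ler0n.
have := ler_wpM2l NR square_rough_sum; lra.
Qed.

Variable c : nat.
Hypothesis q1cnt : (size (primes q1) <= c)%N.

(** A prime of [q1] exceeds y^3 and costs at most hsum / y^3 per twist. For the others, p^2 divides
    at most N / p^2 + 1 of the [D j], and a further 1/p comes from p dividing [n]: the first part
    yields 1/y^2, the summand 1 the squared harmonic sum. *)
Lemma exceptional_sum_le :
  \sum_(0 <= j < N) \sum_(1 <= n < N.+1) (exceptional j n)%:R * (n%:R : R)^-1 <=
  N%:R * hsum R N * (c%:R / (y ^ 3)%:R + ((y ^ 2)%:R)^-1) + hsum R N ^+ 2.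
Proof.
have H0 := hsum_ge0 R N.
have q10 : (0 < q1)%N by case: xic.
pose A n : R := \sum_(p <- primes q1) (p %| n)%N%:R.
pose B j n : R := \sum_(y.+1 <= p < N.+1 | prime p) (p ^ 2 %| D j)%N%:R * (p %| n)%N%:R.
have badAB j n : (0 < n <= N)%N -> (exceptional j n)%:R <= A n + B j n.
  move=> /andP[n0 nN].
  have A0 : 0 <= A n by apply: sumr_ge0.
  have B0 : 0 <= B j n by apply: sumr_ge0 => p _; rewrite mulr_ge0.
  have [/hasP[p pn pb]|_] := boolP (exceptional j n); last exact: addr_ge0.
  move: pn; rewrite mem_primes => /and3P[pr _ pn].
  case/orP: pb => [pq|p2].
    rewrite -[leLHS]addr0 lerD // /A (big_rem p) /=; last by rewrite mem_primes pr q10.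
    by rewrite pn lerDl sumr_ge0.
  have pD : (p %| D j)%N by apply: dvdn_trans p2; rewrite dvdn_exp.
  have yp := prime_dvd_disc_gt m13 y3 xic q1big pr pD.
  rewrite -[leLHS]add0r lerD // /B big_mkcond (big_rem p) /=; last first.
    by rewrite mem_index_iota yp ltnS (leq_trans (dvdn_leq n0 pn)).
  rewrite pr p2 pn mulr1 lerDl sumr_ge0 // => i _.
  by case: ifP => // _; rewrite mulr_ge0.
apply: (@le_trans _ _ (\sum_(0 <= j < N) \sum_(1 <= n < N.+1) (A n + B j n) * (n%:R : R)^-1)).
  apply: ler_sum => j _; apply: ler_sum_nat => n nN.
  by rewrite ler_wpM2r ?invr_ge0 ?ler0n // badAB.
have partA : \sum_(1 <= n < N.+1) A n * (n%:R : R)^-1 <= hsum R N * (c%:R / (y ^ 3)%:R).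
  under eq_bigr do rewrite mulr_suml.
  rewrite exchange_big /=.
  apply: (@le_trans _ _ (\sum_(p <- primes q1) hsum R N * ((y ^ 3)%:R)^-1)).
    rewrite big_seq [leRHS]big_seq; apply: ler_sum => p; rewrite mem_primes => /and3P[pr _ pq].
    apply: le_trans (sum_harmonic_multiples R N (prime_gt0 pr)) _.
    rewrite ler_wpM2l // lef_pV2 ?posrE ?ltr0n ?expn_gt0 ?y0 //; last exact: prime_gt0.
    by rewrite ler_nat ltnW // q1big.
  rewrite sumr_const_list mulrCA.
  by rewrite ler_wpM2l // ler_wpM2r ?invr_ge0 ?ler0n // ler_nat.
have partB : \sum_(0 <= j < N) \sum_(1 <= n < N.+1) B j n * (n%:R : R)^-1 <=
    N%:R * hsum R N * ((y ^ 2)%:R)^-1 + hsum R N ^+ 2.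
  have -> : \sum_(0 <= j < N) \sum_(1 <= n < N.+1) B j n * (n%:R : R)^-1 =
    \sum_(y.+1 <= p < N.+1 | prime p) (\sum_(0 <= j < N) (p ^ 2 %| D j)%N%:R) *
      (\sum_(1 <= n < N.+1) (p %| n)%N%:R * (n%:R : R)^-1).
    rewrite exchange_big /=.
    under eq_bigr => n _ do (under eq_bigr => j _ do rewrite mulr_suml; rewrite exchange_big /=).
    rewrite exchange_big /=; apply: eq_bigr => p _.
    rewrite mulr_sumr; apply: eq_bigr => n _; rewrite mulr_suml; apply: eq_bigr => j _.
    by rewrite mulrA.
  apply: (@le_trans _ _ (\sum_(y.+1 <= p < N.+1 | prime p)
     (N%:R * ((p ^ 2)%:R)^-1 + 1) * (hsum R N / p%:R))).
    rewrite big_nat_cond [leRHS]big_nat_cond; apply: ler_sum => p /andP[_ pr].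
    apply: ler_pM; last exact/sum_harmonic_multiples/prime_gt0.
    - by apply: sumr_ge0.
    - by apply: sumr_ge0 => n _; rewrite mulr_ge0 ?invr_ge0 ?ler0n.
    rewrite -natr_sum.
    have [pL|pL] := boolP (p %| M * m)%N.
      rewrite big1; first by rewrite addr_ge0 // mulr_ge0 ?invr_ge0 ?ler0n.
      move=> j _; apply/eqP; rewrite eqb0; apply/negP => p2.
      have pD : (p %| D j)%N by apply: dvdn_trans p2; rewrite dvdn_exp.
      by have := prime_dvd_disc_notin m13 y3 xic q1big pr pD; rewrite pL.
    have cp : coprime (p ^ 2) (M * m) by rewrite coprimeXl // prime_coprime.
    have := count_progression (family_start y m q1 neg) N cp.
    rewrite -(ler_nat R) => /le_trans; apply; rewrite natrD lerD2r.
    rewrite ler_pdivlMr ?ltr0n ?expn_gt0 ?prime_gt0 // -natrM ler_nat.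
    exact: leq_trunc_div.
  apply: (@le_trans _ _ (\sum_(y.+1 <= p < N.+1)
     (N%:R * hsum R N * (y%:R)^-1 * ((p ^ 2)%:R)^-1 + hsum R N * (p%:R)^-1))).
    rewrite big_mkcond; apply: ler_sum_nat => p /andP[yp _].
    have p0 : 0 < p%:R :> R by rewrite ltr0n; exact: leq_trans yp.
    have yR : 0 < y%:R :> R by rewrite ltr0n.
    have py : (p%:R : R)^-1 <= (y%:R)^-1 by rewrite lef_pV2 ?posrE // ler_nat ltnW.
    have P2 : 0 <= ((p ^ 2)%:R : R)^-1 by rewrite invr_ge0 ler0n.
    have PI : 0 <= (p%:R : R)^-1 by rewrite invr_ge0 ltW.
    have YI : 0 <= (y%:R : R)^-1 by rewrite invr_ge0 ltW.
    case: ifP => _; last by rewrite addr_ge0 // ?mulr_ge0 // ?mulr_ge0 // ler0n.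
    rewrite mulrDl mul1r lerD2r.
    have -> : N%:R * ((p ^ 2)%:R)^-1 * (hsum R N / p%:R) =
      (N%:R * hsum R N * ((p ^ 2)%:R)^-1) * (p%:R)^-1 by ring.
    rewrite [leRHS]mulrAC ler_wpM2l // !mulr_ge0 ?ler0n //.
  rewrite big_split /= -!mulr_sumr; apply: lerD.
    have -> : N%:R * hsum R N * ((y ^ 2)%:R)^-1 = N%:R * hsum R N * (y%:R)^-1 * (y%:R : R)^-1.
      by rewrite natrX expr2 invfM mulrA.
    by rewrite ler_wpM2l ?mulr_ge0 ?invr_ge0 ?ler0n // sum_inv_sqr_le.
  rewrite expr2 ler_wpM2l // /hsum [leRHS](bigID (fun p => (y < p)%N)) /=.
  have [yN|Ny] := ltnP y N; last first.
    by rewrite big_geq // addr_ge0 // sumr_ge0 // => i _; rewrite invr_ge0 ler0n.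
  rewrite -[leLHS]addr0 lerD //; last by rewrite sumr_ge0 // => i _; rewrite invr_ge0 ler0n.
  rewrite [leRHS](@big_cat_nat _ _ _ y.+1) //=; last exact: ltnW.
  rewrite -[leLHS]add0r lerD //; first by rewrite sumr_ge0 // => i _; rewrite invr_ge0 ler0n.
  rewrite big_nat_cond [leRHS]big_nat_cond le_eqVlt; apply/orP; left; apply/eqP.
  by apply: eq_bigl => i; case: (y < i)%N; rewrite ?andbF ?andbT.
have -> : \sum_(0 <= j < N) \sum_(1 <= n < N.+1) (A n + B j n) * (n%:R : R)^-1 =
   N%:R * (\sum_(1 <= n < N.+1) A n * (n%:R : R)^-1) +
   \sum_(0 <= j < N) \sum_(1 <= n < N.+1) B j n * (n%:R : R)^-1.
  transitivity (\sum_(0 <= j < N) (\sum_(1 <= n < N.+1) A n * (n%:R : R)^-1 +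
     \sum_(1 <= n < N.+1) B j n * (n%:R : R)^-1)).
    by apply: eq_bigr => j _; rewrite -big_split; apply: eq_bigr => n _; rewrite mulrDl.
  by rewrite big_split /= sumr_const_nat subn0 mulr_natl.
rewrite mulrDr -addrA; apply: lerD => //.
by rewrite -mulrA ler_wpM2l ?ler0n.
Qed.

(** The functions [th] may differ from [family_char] by up to 2 at exceptional integers, whence the
    factor 2; if all the sums were smaller, their real parts would contradict the average. *)
Lemma exists_large_partial_sum (th : nat -> nat -> C) :
  (forall j n, cabs (th j n) <= 1) ->
  (forall j n, (0 < n)%N -> ~~ exceptional j n -> th j n = theta j n) ->
  exists j, S * (1 - (y%:R)^-1) -
     (1 + 2 * (hsum R N * (c%:R / (y ^ 3)%:R + ((y ^ 2)%:R)^-1) + hsum R N ^+ 2 / N%:R)) <=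
     cabs (\sum_(1 <= n < N.+1) th j n * (((n%:R)^-1)%:C)%C) /\ (j < N)%N.
Proof.
move=> th1 thE; apply: contrapT => Hno.
set E := (X in _ - X) in Hno.
have NR : 0 < N%:R :> R by rewrite ltr0n.
pose V j : C := \sum_(1 <= n < N.+1) th j n * (((n%:R)^-1)%:C)%C.
pose U j : C := \sum_(1 <= n < N.+1) theta j n * (((n%:R)^-1)%:C)%C.
have Vlt j : (j < N)%N -> complex.Re (V j) < S * (1 - (y%:R)^-1) - E.
  move=> jN; apply: le_lt_trans (Re_le_cabs _) _; rewrite ltNge.
  by apply/negP => le; apply: Hno; exists j.
have UV j : complex.Re (U j) <= complex.Re (V j) +
   2 * \sum_(1 <= n < N.+1) (exceptional j n)%:R * (n%:R : R)^-1.
  rewrite /U /V !Re_sum mulr_sumr -big_split /=; apply: ler_sum_nat => n /andP[n0 _].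
  have I0 : 0 <= (n%:R : R)^-1 by rewrite invr_ge0 ler0n.
  rewrite ![_ * ((_)%:C)%C]mulrC !Re_realM mulrA [2 * _ * _]mulrC -mulrDr ler_wpM2l //.
  have [nb|gd] := boolP (exceptional j n); last by rewrite thE // mulr0 addr0.
  have a : complex.Re (theta j n) <= 1.
    by apply: le_trans (Re_le_cabs _) _; exact: (family_char_abs_le1 y neg m13 xic).
  have := Re_lower (th1 j n); rewrite mulr1; lra.
have := average_family_char; rewrite leNgt => /negP; apply.
apply: (@le_lt_trans _ _ (\sum_(0 <= j < N) complex.Re (V j) +
   2 * \sum_(0 <= j < N) \sum_(1 <= n < N.+1) (exceptional j n)%:R * (n%:R : R)^-1)).
  by rewrite mulr_sumr -big_split /=; apply: ler_sum => j _; exact: UV.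
apply: (@lt_le_trans _ _ (N%:R * (S * (1 - (y%:R)^-1) - E) + 2 *
  (N%:R * hsum R N * (c%:R / (y ^ 3)%:R + ((y ^ 2)%:R)^-1) + hsum R N ^+ 2))).
  apply: ltr_leD; last by rewrite ler_pM2l // exceptional_sum_le.
  apply: (@lt_le_trans _ _ (\sum_(0 <= j < N) (S * (1 - (y%:R)^-1) - E))); last first.
    by rewrite sumr_const_nat subn0 mulr_natl.
  rewrite !big_mkord; apply: ltr_sum; first by apply/hasP; exists (Ordinal N0); rewrite // mem_index_enum.
  by move=> j _; exact: Vlt.
rewrite /E le_eqVlt; apply/orP; left; apply/eqP.
have nz : N%:R != 0 :> R by rewrite gt_eqF.
have yz : y%:R != 0 :> R by rewrite pnatr_eq0 -lt0n.
move: nz yz; rewrite !natrX; move: (N%:R : R) (y%:R : R) (c%:R : R) S (hsum R N) => a b d e f a0 b0; field; rewrite ?a0 ?b0 ?expf_neq0 //.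
Qed.

End Average.

Section SmoothLower.
Variable R : realType.

(** Truncation multiplies the factor at [p] by 1 - p^(- A - 1) >= 1 - 2^(- A - 1); at most [z] such
    losses are combined as in Bernoulli's inequality, inside the induction. *)
Lemma truncated_euler_lower m A z : z%:R * (2^-1 : R) ^+ A.+1 <= 1 ->
  prime_euler m (inv_nat R) z * (1 - z%:R * (2^-1) ^+ A.+1) <=
  \prod_(0 <= p < z.+1 | prime p && ~~ (p %| m)%N) (\sum_(0 <= a < A.+1) inv_nat R p ^+ a).
Proof.
set e := (2^-1 : R) ^+ A.+1.
have e0 : 0 <= e by rewrite exprn_ge0 // invr_ge0.
elim: z => [|z IH] ze.
  rewrite mul0r subr0 mulr1 /prime_euler [leLHS]big_mkcond [leRHS]big_mkcond !big_nat1 //=.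
have ze' : z%:R * e <= 1 by apply: le_trans ze; rewrite ler_wpM2r // ler_nat.
have {}IH := IH ze'.
rewrite prime_eulerS [leRHS]big_mkcond big_nat_recr //= -big_mkcond /=.
have PE0 z' : 0 < prime_euler m (inv_nat R) z'.
  by apply: prime_euler_gt0 => p pr; exact: inv_nat_lt1.
case: ifP => [/andP[pr _]|_]; last first.
  rewrite !mulr1; apply: le_trans IH; rewrite ler_wpM2l ?(ltW (PE0 _)) //.
  by rewrite lerD2l lerN2 ler_wpM2r // ler_nat.
set x := inv_nat R z.+1.
have x0 : 0 <= x by exact: inv_nat_ge0.
have x1 : x < 1 by exact: inv_nat_lt1.
have x2 : x <= 2^-1.
  by rewrite /x /inv_nat lef_pV2 ?posrE ?ltr0n // ler_nat prime_gt1.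
have xe : x ^+ A.+1 <= e by rewrite lerXn2r ?nnegrE ?invr_ge0.
have -> : \sum_(0 <= a < A.+1) x ^+ a = (1 - x)^-1 * (1 - x ^+ A.+1).
  have nz : 1 - x != 0 by rewrite subr_eq0 gt_eqF.
  by rewrite big_mkord -[X in _ * X]opprB subrX1 -mulNr opprB mulrA mulVf // mul1r.
have V0 : 0 < (1 - x)^-1 by rewrite invr_gt0 subr_gt0.
apply: (@le_trans _ _ (prime_euler m (inv_nat R) z * (1 - z%:R * e) * ((1 - x)^-1 * (1 - e)))).
  rewrite [leRHS]mulrACA ler_wpM2l ?mulr_ge0 ?(ltW V0) ?(ltW (PE0 _)) //.
  have : 0 <= z%:R * e * e by rewrite !mulr_ge0.
  rewrite -natr1; lra.
apply: ler_pM => //.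
- by rewrite mulr_ge0 ?(ltW (PE0 _)) // subr_ge0.
- rewrite mulr_ge0 ?(ltW V0) // subr_ge0; apply: le_trans ze.
  by rewrite ler_peMl // ler1n.
by rewrite ler_wpM2l ?(ltW V0) // lerD2l lerN2.
Qed.

Lemma smooth_inv_sum_lower m y A N : (0 < y)%N -> (y ^ 2 <= 2 ^ A)%N -> (y`! ^ A <= N)%N ->
  (1 - (y%:R)^-1) * prime_euler m (inv_nat R) y <= smooth_sum m (inv_nat R) y N.
Proof.
move=> y0 yA AN.
have yR : 0 < y%:R :> R by rewrite ltr0n.
have small : y%:R * (2^-1 : R) ^+ A.+1 <= (y%:R)^-1.
  rewrite exprVn -natrX -[y%:R in leLHS]invrK -invfM lef_pV2 ?posrE //; last first.
    by rewrite mulr_gt0 ?invr_gt0 // ltr0n expn_gt0.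
  rewrite ler_pdivlMl // -natrM ler_nat mulnn //.
  by apply: (leq_trans yA); rewrite leq_exp2l.
have small1 : y%:R * (2^-1 : R) ^+ A.+1 <= 1.
  by apply: (le_trans small); rewrite invf_le1 // ler1n.
apply: (@le_trans _ _ (smooth_sum m (inv_nat R) y (y`! ^ A))); last first.
  by apply: smooth_sum_le => //; exact: inv_nat_ge0.
apply: le_trans (smooth_sum_lower _ (@inv_natM R) (@inv_nat_ge0 R) (inv_nat1 R) _ _).
apply: le_trans (truncated_euler_lower m small1).
rewrite mulrC ler_wpM2l ?lerD2l ?lerN2 //.
by apply/ltW/prime_euler_gt0 => p pr; exact: inv_nat_lt1.
Qed.

Lemma prime_euler_three (g : nat -> R) y : (3 <= y)%N -> g 3%N < 1 ->
  prime_euler 3 g y = (1 - g 3%N) * prime_euler 1 g y.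
Proof.
move=> y3 g3.
have nz : 1 - g 3%N != 0 by rewrite subr_eq0 gt_eqF.
rewrite -[y](subnKC y3); elim: (y - 3)%N => [|n IH].
  rewrite addn0 /prime_euler [LHS]big_mkcond [X in _ = _ * X]big_mkcond !big_nat_recr //= !big_geq //=.
  by rewrite !mul1r !mulr1 mulrCA mulfV // mulr1.
rewrite addnS (prime_eulerS 3 g (3 + n)) (prime_eulerS 1 g (3 + n)) IH -mulrA; congr (_ * (_ * _)).
Qed.

End SmoothLower.

(** * Size of the construction *)

Section Sizes.
Variable R : realType.

(** With w = Q^(1/4) the harmonic sum is at most 5 w. The tail costs 20, as [N] and Q/2 are at least
    of order w^3, and the term 2 hsum costs 40 after division by sqrt Q / pi; together 60. *)
Lemma first_moment_error Q N (X : R) : (1 < Q)%N -> (Q ^ 3 <= N ^ 4)%N ->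
  Num.sqrt Q%:R / pi * (X - 60) <=
  Num.sqrt Q%:R / pi * (X - 2 * (Num.sqrt Q%:R * hsum R Q) / (minn N Q./2).+1%:R) - 2 * hsum R Q.
Proof.
move=> Q1 QN.
have Q0 : 0 < Q%:R :> R by rewrite ltr0n; lia.
set s := Num.sqrt Q%:R.
have s0 : 0 < s by rewrite sqrtr_gt0.
have ss : s ^+ 2 = Q%:R by rewrite sqr_sqrtr // ltW.
pose w := Num.sqrt s.
have w0 : 0 < w by rewrite sqrtr_gt0.
have ws : w ^+ 2 = s by rewrite sqr_sqrtr // ltW.
have w4 : w ^+ 4 = Q%:R by rewrite -ss -ws -exprM.
have w1 : 1 <= w.
  by rewrite -(@ler_pXn2r _ 4) ?nnegrE ?(ltW w0) // expr1n w4 ler1n; lia.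
have Hw : hsum R Q <= 5 * w.
  apply: (le_trans (@hsum_le_ln R Q _)); first lia.
  rewrite -w4 lnXn // -mulr_natl; have := ln_sublinear w0; lra.
have H0 := hsum_ge0 R Q.
have pi0 := @pi_gt0 R; have pi4 : pi <= 4 :> R by have /andP[_] := @pihalf_02 R; lra.
set K := (minn _ _).+1%:R.
have K0 : 0 < K by rewrite ltr0n.
have tail : 2 * (s * hsum R Q) / K <= 20.
  rewrite ler_pdivrMr //.
  have sH : s * hsum R Q <= 5 * w ^+ 3.
    apply: (@le_trans _ _ (s * (5 * w))); first by rewrite ler_pM2l.
    by rewrite -ws; have -> : w ^+ 2 * (5 * w) = 5 * w ^+ 3 by ring.
  have w3 : w ^+ 3 <= 2 * K.
    rewrite /K /minn; case: ifP => _.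
      have : w ^+ 3 <= N%:R.
        rewrite -(@ler_pXn2r _ 4) ?nnegrE ?exprn_ge0 ?(ltW w0) ?ler0n //.
        by rewrite -exprM mulnC exprM w4 -!natrX ler_nat.
      have : N%:R <= N.+1%:R :> R by rewrite ler_nat.
      have : 0 <= N%:R :> R by rewrite ler0n.
      lra.
    apply: (@le_trans _ _ (w ^+ 4)); first by rewrite [leRHS]exprS ler_peMl // exprn_ge0 // ltW.
    by rewrite w4 -natrM ler_nat; lia.
  lra.
have corr : 2 * hsum R Q * pi / s <= 40.
  rewrite ler_pdivrMr // -ws.
  have : w <= w ^+ 2 by rewrite expr2 ler_peMl // ltW.
  have : hsum R Q * pi <= 5 * w * 4 by rewrite ler_pM // ltW.
  lra.
have -> : 2 * hsum R Q = s / pi * (2 * hsum R Q * pi / s).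
  by move: s0 pi0; move: (s : R) (pi : R) (hsum R Q) => a b c a0 b0; field; rewrite !gt_eqF.
rewrite -mulrBr ler_wpM2l //; first by rewrite divr_ge0 // ltW.
move: tail corr; move: (_ / K) (_ / s) => a b; lra.
Qed.

Lemma six_power_le l : (4000 <= l)%N -> (31 * l ^ 6 <= 2 ^ l)%N.
Proof.
move=> l4; pose n := (l %/ 8)%N.
have ln : (l < 8 * n.+1)%N by rewrite /n; lia.
have n23 : (23 <= 2 * n)%N by rewrite /n; lia.
have nl : (8 * n <= l)%N by rewrite /n; lia.
have l8 : (l <= 2 ^ (3 + n))%N.
  rewrite expnD; apply: (leq_trans (ltnW ln)); rewrite leq_mul2l /=.
  exact: ltn_expl.
apply: (@leq_trans (2 ^ 5 * (2 ^ (3 + n)) ^ 6)).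
  by apply: leq_mul => //; rewrite leq_exp2r.
by rewrite -expnM -expnD leq_exp2l //; lia.
Qed.

Lemma leq_exp2r_le a b n : (a <= b)%N -> (a ^ n <= b ^ n)%N.
Proof. by case: n => // n ab; rewrite leq_exp2r. Qed.

Lemma fact_le_exp y : (y`! <= y ^ y)%N.
Proof.
elim: y => // y IH; rewrite factS expnS leq_mul2l /=; apply: (leq_trans IH).
exact: leq_exp2r_le.
Qed.

Lemma prod_primes_le_fact (P : pred nat) y : (\prod_(0 <= p < y.+1 | prime p && P p) p <= y`!)%N.
Proof.
elim: y => [|y IH]; first by rewrite big_mkcond big_nat1.
rewrite big_mkcond big_nat_recr //= -big_mkcond /= factS mulnC.
by apply: leq_mul => //; case: ifP.
Qed.

Lemma exponent_le l y : (4000 <= l)%N -> (0 < y)%N ->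
  (3 * (7 + l.+1 * y + 2 * (2 * l ^ 5 * y.+1)) + l.+1 * y * (2 * l + 2) <= 30 * l ^ 5 * y)%N.
Proof.
move=> l4 y0; have b : (5 * l.+1 ^ 2 <= l ^ 5)%N.
  apply: (@leq_trans (5 * (2 * l) ^ 2)).
    by rewrite leq_mul2l /= leq_exp2r //; lia.
  rewrite expnMn (expnD l 2 3) mulnA mulnC leq_mul2l; apply/orP; right.
  apply: (@leq_trans (l ^ 1)); first by rewrite expn1; apply: leq_trans l4.
  by rewrite leq_pexp2l //; apply: leq_trans l4.
have bl : (l.+1 ^ 2 = l.+1 * l.+1)%N by rewrite mulnn.
move: (l ^ 5)%N (l.+1 ^ 2)%N bl b => a b -> ab.
have aP : (a <= a * y)%N by rewrite leq_pmulr.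
have bP : (5 * (l.+1 * l.+1) * y <= a * y)%N by rewrite leq_mul2r ab orbT.
have : (21 <= a)%N by nia.
nia.
Qed.

(** Every factor is bounded by a power of 2, with y! <= y^y and [q1] at most 2^(2 l^5 (y + 1)). An
    exponent linear in [y] up to powers of [l] is what keeps log log q close to log y. *)
Lemma construction_size k l y m q1 : (2000 * k <= l)%N -> (2 <= k)%N -> (0 < y)%N ->
  (y < 2 ^ l.+1)%N -> (q1 <= ((k * 2 ^ (l ^ 3)) ^ k) ^ (k * y.+1))%N ->
  ((15 * q1 * family_step y m q1) ^ 3 * y`! ^ (2 * l + 2) <= 2 ^ (30 * l ^ 5 * y))%N.
Proof.
move=> kl k2 y0 yl q1l.
have l4 : (4000 <= l)%N by lia.
have k2l : (k <= 2 ^ l)%N.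
  by apply: ltnW; apply: (leq_trans (ltn_expl k (isT : 1 < 2)%N)); rewrite leq_exp2l //; lia.
set e := (2 * l ^ 5 * y.+1)%N.
have q1e : (q1 <= 2 ^ e)%N.
  apply: (leq_trans q1l).
  apply: (@leq_trans (((2 ^ (l + l ^ 3)) ^ l) ^ (l * y.+1))).
    apply: (@leq_trans (((2 ^ (l + l ^ 3)) ^ k) ^ (k * y.+1))).
      rewrite expnD; apply: leq_exp2r_le; apply: leq_exp2r_le.
      by rewrite leq_mul2r k2l orbT.
    have p0 : (0 < 2 ^ (l + l ^ 3))%N by rewrite expn_gt0.
    apply: (@leq_trans (((2 ^ (l + l ^ 3)) ^ l) ^ (k * y.+1))).
      by apply: leq_exp2r_le; rewrite leq_pexp2l //; lia.
    by rewrite leq_pexp2l ?expn_gt0 ?p0 // leq_mul2r; apply/orP; right; lia.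
  rewrite -!expnM leq_exp2l // /e.
  have : (l <= l ^ 3)%N by rewrite -{1}[l]expn1 leq_pexp2l //; lia.
  have -> : (l ^ 5 = l ^ 3 * l * l)%N by rewrite -mulnA mulnn -expnD.
  move: (l ^ 3)%N => a al; rewrite !mulnA !leq_mul2r; apply/orP; right.
  by apply/orP; right; apply/orP; right; lia.
have f2 : (y`! <= 2 ^ (l.+1 * y))%N.
  apply: (leq_trans (fact_le_exp y)); rewrite expnM.
  by apply: leq_exp2r_le; exact: ltnW.
apply: (@leq_trans ((2 ^ 4 * 2 ^ e * (2 ^ 3 * 2 ^ (l.+1 * y) * 2 ^ e)) ^ 3 *
    (2 ^ (l.+1 * y)) ^ (2 * l + 2))).
  apply: leq_mul; last exact: leq_exp2r_le.
  apply: leq_exp2r_le; rewrite /family_step; apply: leq_mul; first exact: leq_mul.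
  apply: leq_mul => //; apply: leq_mul => //; apply: leq_trans f2.
  exact: prod_primes_le_fact.
rewrite -!expnD -!expnM -expnD leq_exp2l //.
apply: leq_trans (exponent_le l4 y0).
by rewrite -/e; lia.
Qed.

(** The total 21 is 1 + 2 (1 + 9). The inner 1 is where y^3 is spent: the harmonic sum is at most 31
    l^5 y, the bracket at most l / y^2, and 31 l^6 <= 2^l <= y. The 9 comes from a harmonic sum of
    at most 3 sqrt N. *)
Lemma average_error_le k l y N : (2000 * k <= l)%N -> (2 <= k)%N ->
  (2 ^ l <= y)%N -> (0 < N)%N -> (N <= 2 ^ (30 * l ^ 5 * y))%N ->
  1 + 2 * (hsum R N * ((k * y.+1)%:R / (y ^ 3)%:R + ((y ^ 2)%:R)^-1) + hsum R N ^+ 2 / N%:R)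
  <= 21.
Proof.
move=> kl k2 ly N0 NB.
have l4 : (4000 <= l)%N by lia.
have y0 : (0 < y)%N by apply: leq_trans ly; rewrite expn_gt0.
have NR : 0 < N%:R :> R by rewrite ltr0n.
have yR : 0 < y%:R :> R by rewrite ltr0n.
have H0 := hsum_ge0 R N.
have HN := hsum_le_ln R N0.
have lnN : ln N%:R <= (30 * l ^ 5 * y)%:R :> R.
  apply: (@le_trans _ _ (ln ((2 ^ (30 * l ^ 5 * y))%:R))).
    by rewrite ler_ln ?posrE ?ltr0n ?expn_gt0 // ler_nat.
  rewrite natrX lnXn // -[leLHS]mulr_natl ler_piMr ?ler0n //.
  by have := ln_sublinear (ltr0n R 2); have := @ln2_bounds R; case; lra.
have Hl : hsum R N <= (31 * l ^ 5 * y)%:R.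
  apply: (le_trans HN); apply: (@le_trans _ _ (1 + (30 * l ^ 5 * y)%:R)); first by rewrite lerD2l.
  rewrite -[1]/(1%:R) -natrD ler_nat.
  have : (0 < l ^ 5 * y)%N by rewrite muln_gt0 expn_gt0 y0 andbT; apply/orP; left; lia.
  by rewrite -!mulnA; lia.
have c1 : (k * y.+1)%:R / (y ^ 3)%:R + ((y ^ 2)%:R)^-1 <= l%:R / (y ^ 2)%:R :> R.
  have -> : (k * y.+1)%:R / (y ^ 3)%:R + ((y ^ 2)%:R)^-1 = (k * y.+1 + y)%:R / (y ^ 3)%:R :> R.
    by rewrite !natrX natrD; field; rewrite gt_eqF.
  have -> : l%:R / (y ^ 2)%:R = (l * y)%:R / (y ^ 3)%:R :> R.
    by rewrite !natrX natrM; field; rewrite gt_eqF.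
  by rewrite ler_wpM2r ?invr_ge0 ?ler0n // ler_nat; nia.
have t1 : hsum R N * ((k * y.+1)%:R / (y ^ 3)%:R + ((y ^ 2)%:R)^-1) <= 1.
  apply: (@le_trans _ _ ((31 * l ^ 5 * y)%:R * (l%:R / (y ^ 2)%:R))).
    by apply: ler_pM => //; rewrite addr_ge0 ?mulr_ge0 ?invr_ge0 ?ler0n.
  rewrite mulrA ler_pdivrMr ?ltr0n ?expn_gt0 ?y0 // mul1r -natrM ler_nat.
  apply: (@leq_trans (31 * l ^ 6 * y)); first by rewrite mulnAC -[(_ * l ^ 5 * l)%N]mulnA -expnSr.
  rewrite -mulnn leq_mul2r; apply/orP; right.
  exact: leq_trans (six_power_le l4) ly.
have t2 : hsum R N ^+ 2 / N%:R <= 9.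
  rewrite ler_pdivrMr //.
  have s0 : 0 < Num.sqrt N%:R :> R by rewrite sqrtr_gt0.
  have ss : Num.sqrt N%:R ^+ 2 = N%:R :> R by rewrite sqr_sqrtr // ltW.
  have s1 : 1 <= Num.sqrt N%:R :> R.
    by rewrite -(@ler_pXn2r _ 2) ?nnegrE ?(ltW s0) // expr1n ss ler1n.
  have : hsum R N <= 3 * Num.sqrt N%:R.
    apply: (le_trans HN); rewrite -{1}ss lnXn // mulr2n.
    have := ln_sublinear s0; lra.
  move=> h3; rewrite -[in leRHS]ss; have -> : 9 * Num.sqrt N%:R ^+ 2 = (3 * Num.sqrt N%:R) ^+ 2 :> R by ring.
  by rewrite ler_pXn2r ?nnegrE // (le_trans H0).
lra.
Qed.

End Sizes.

Lemma pred_eqmod d e : (0 < d)%N -> (0 < e)%N -> (d * e).-1 = d.-1 %[mod d].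
Proof.
move=> d0 e0; have -> : ((d * e).-1 = e.-1 * d + d.-1)%N by nia.
by rewrite modnMDl.
Qed.

(** * The primitive character inducing a twist *)

Section Induced.
Variable R : realType.
Local Notation C := R[i].
Variables (y m q1 : nat) (xi : nat -> C) (neg : bool).
Hypothesis m13 : m = 1%N \/ m = 3%N.
Hypothesis y3 : (3 <= y)%N.
Hypothesis xic : natchar q1 xi.
Hypothesis q1big : forall p, prime p -> (p %| q1)%N -> (y ^ 3 < p)%N.
Local Notation D := (family_disc y m q1 neg).
Variables (j d : nat) (chi : nat -> C).
Hypothesis dq : (d %| q1 * D j)%N.
Hypothesis chic : natchar d chi.
Hypothesis chiE : forall n, coprime n (q1 * D j) -> chi n = xi n * jacC R (D j) n.

Let oD : odd (D j). Proof. exact: (odd_family_disc y neg m13 xic). Qed.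
Let om : odd m. Proof. by case: m13 => ->. Qed.
Let q10 : (0 < q1)%N. Proof. by case: xic. Qed.
Let D0 : (0 < D j)%N. Proof. exact: odd_gt0. Qed.
Let d0 : (0 < d)%N. Proof. by case: chic. Qed.

(** At - 1 the two symbols are governed by the parities of [(D j)./2] and [m./2], and [D j] is - m
    or [m] modulo 8 according to [neg]; the sign [neg] thus corrects the value of [xi] at - 1. *)
Lemma induced_minus_one : xi q1.-1 = (-1) ^+ (~~ neg) ->
  chi d.-1 * jacC R m m.-1 = -1.
Proof.
move=> xim; pose n := (q1 * D j).-1.
have qD0 : (0 < q1 * D j)%N by rewrite muln_gt0 q10.
have /dvdnP[e E] := dq.
have e0 : (0 < e)%N by move: qD0; rewrite E muln_gt0 => /andP[].
have -> : chi d.-1 = chi n.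
  by apply: (natchar_eqmod chic); rewrite /n E mulnC pred_eqmod.
rewrite chiE ?coprimePn //.
have -> : xi n = xi q1.-1 by apply: (natchar_eqmod xic); rewrite /n pred_eqmod.
rewrite /jacC jac_opp //; last by rewrite /n prednK // dvdn_mull.
rewrite jac_opp //; last by rewrite prednK // odd_gt0.
rewrite !rmorph_sign xim -!exprD.
suff E2 : odd (~~ neg + (D j)./2 + m./2) by rewrite -signr_odd E2 expr1.
have /dvdnP[a M8] := family_step_dvd8 y m q1.
have := family_discE y neg m13 xic j; rewrite M8 mulnAC.
move: (a * (m * j + 1))%N (D j) oD => b D' oD' H.
by case: m13 H => ->; case: neg => /= H; lia.
Qed.

(** Here the evenness of [k] enters: an even power removes the quadratic symbol. *)
Lemma induced_expr k n : ~~ odd k -> (forall n, coprime n q1 -> xi n ^+ k = 1) ->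
  coprime n d -> chi n ^+ k = 1.
Proof.
move=> ek xik cop; have qD0 : (0 < q1 * D j)%N by rewrite muln_gt0 q10.
have [n' En cn] := lift_coprime qD0 dq cop.
rewrite -(natchar_eqmod chic En) chiE // exprMn xik; last first.
  by move: cn; rewrite coprimeMr => /andP[].
rewrite mul1r /jacC; have -> : k = (2 * k./2)%N by lia.
rewrite exprM -rmorphXn /= jac_sqr.
by move: cn; rewrite coprimeMr => /andP[_ ->]; rewrite expr1n.
Qed.

Lemma induced_primitive k g : coprime g q1 -> k.-primitive_root (xi g) ->
  exists2 h, coprime h d & k.-primitive_root (chi h).
Proof.
move=> cg pg; have cD := coprime_disc_q1 neg m13 y3 xic q1big j.
pose h := chinese q1 (D j) g 1.
have cqD : coprime q1 (D j) by rewrite coprime_sym.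
have h1 : h = g %[mod q1] by exact: chinese_modl.
have h2 : h = 1 %[mod D j] by exact: chinese_modr.
have ch : coprime h (q1 * D j).
  by rewrite coprimeMr -coprime_modl h1 coprime_modl cg -coprime_modl h2 coprime_modl coprime1n.
exists h; first exact: coprime_dvdr dq ch.
by rewrite chiE // (natchar_eqmod xic h1) /jacC (jac_eqmod h2) jac1 // rmorph1 mulr1.
Qed.

Lemma induced_modulus_gt k : (2 <= k)%N -> (exists2 h, coprime h d & k.-primitive_root (chi h)) ->
  (y < d)%N.
Proof.
move=> k2 [h ch ph].
have d1 : (1 < d)%N.
  rewrite ltn_neqAle d0 andbT eq_sym; apply/eqP => d1.
  have h1 : chi h = 1.
    by rewrite -(natchar1 chic); apply: (natchar_eqmod chic); rewrite d1 !modn1.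
  have : (k %| 1)%N by rewrite (prim_order_dvd ph) h1 expr1n.
  by rewrite dvdn1 => /eqP; lia.
apply: leq_trans (dvdn_leq d0 (pdiv_dvd d)).
have pr := pdiv_prime d1; have := dvdn_trans (pdiv_dvd d) dq.
rewrite Euclid_dvdM // => /orP[pq|pD].
  apply: leq_trans (ltnW (q1big pr pq)).
  by rewrite -[y.+1]expn1; apply: (@leq_trans (y.+1 * 1)); rewrite ?muln1 ?expn1 // !expnS; nia.
exact: (prime_dvd_disc_gt m13 y3 xic q1big pr pD).
Qed.

Lemma induced_modulus_coprime : coprime d m /\ odd d.
Proof.
split.
  apply: (coprime_dvdl dq); rewrite coprimeMl (coprime_disc_m neg m13 y3 xic q1big) andbT.
  apply: coprime_no_prime => [p pr pq pm|]; last exact: odd_gt0.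
  have := q1big pr pq; have := dvdn_leq (odd_gt0 om) pm.
  have : (3 <= y ^ 3)%N by apply: (leq_trans y3); rewrite -{1}[y]expn1 leq_pexp2l //; lia.
  by case: m13 => ->; lia.
apply: dvdn_odd dq _; rewrite oddM oD andbT.
rewrite -[odd q1]negbK -dvdn2; apply/negP => p2; have := @q1big 2%N isT p2.
have : (3 <= y ^ 3)%N by apply: (leq_trans y3); rewrite -{1}[y]expn1 leq_pexp2l //; lia.
by lia.
Qed.

End Induced.

(** * A single character with large partial sums *)

Section LargeSum.
Variable R : realType.
Local Notation C := R[i].

(** The coefficient [m.+1./2] is 1 for m = 1 and 2 for m = 3, matching the two upper bounds for the
    first moment. The loss 81 is 60 from [first_moment_error] plus 21 from [average_error_le]; 1 -
    2/y is below (1 - 1/y)^2, one factor coming from the truncated Euler product and one from square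
    rough parts. *)
Lemma large_sum_character k m l y : (2 <= k)%N -> ~~ odd k -> m = 1%N \/ m = 3%N ->
  (2000 * k <= l)%N -> (2 ^ l <= y < 2 ^ l.+1)%N ->
  exists (d : nat) (chi : nat -> C),
  [/\ [/\ natchar d chi, separating d chi, (y < d)%N & (d <= 2 ^ (60 * l ^ 5 * y))%N],
      chi d.-1 * jacC R m m.-1 = -1,
      forall n, coprime n d -> chi n ^+ k = 1,
      exists2 h, coprime h d & k.-primitive_root (chi h) &
      forall B, (forall x, cabs (\sum_(0 <= n < x) chi n) <= B) ->
        Num.sqrt (m * d)%:R / pi *
          ((1 - 2 / y%:R) * prime_euler m (inv_nat R) y - 81) <= m.+1./2%:R * B].
Proof.
move=> k2 ek m13 kl /andP[ly yl].
have l4 : (4000 <= l)%N by lia.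
have y3 : (3 <= y)%N.
  by apply: leq_trans ly; apply: (@leq_trans (2 ^ 2)) => //; rewrite leq_exp2l //; lia.
have y0 : (0 < y)%N by lia.
have [q1 [xi [xic [q1big q1cnt] q1le xi1 [xik [g cg pg]]]]] := power_character_family R k2 kl yl.
have q10 : (0 < q1)%N by case: xic.
have q1gt1 : (1 < q1)%N.
  rewrite ltn_neqAle q10 andbT eq_sym; apply/eqP => q1E.
  have h1 : xi g = 1.
    by rewrite -(natchar1 xic); apply: (natchar_eqmod xic); rewrite q1E !modn1.
  have : (k %| 1)%N by rewrite (prim_order_dvd pg) h1 expr1n.
  by rewrite dvdn1 => /eqP; lia.
have xim2 : xi q1.-1 ^+ 2 = 1.
  rewrite -(natcharX xic) -(natchar1 xic); apply: (natchar_eqmod xic).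
  have -> : (q1.-1 ^ 2 = (q1 - 2) * q1 + 1)%N by rewrite -mulnn; nia.
  by rewrite modnMDl.
pose neg := xi q1.-1 == 1.
have xim : xi q1.-1 = (-1) ^+ (~~ neg).
  rewrite /neg; move: xim2 => /eqP; rewrite sqrf_eq1 => /orP[]/eqP->; first by rewrite eqxx.
  by case: eqP => [->|_]; rewrite ?expr0 ?expr1.
have m0 : (0 < m)%N by case: m13 => ->.
have om : odd m by case: m13 => ->.
pose M := family_step y m q1.
have M8 : (8 <= M)%N := family_step_gt0 y m xic.
pose Z := (15 * q1 * M)%N; pose F := (y`! ^ (2 * l + 2))%N.
(* The factor [Z ^ 3] gives [Q <= Z * N <= N ^ (4 / 3)], as [first_moment_error] requires. *)
pose N := (Z ^ 3 * F)%N.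
have F0 : (0 < F)%N by rewrite expn_gt0 fact_gt0.
have M0 : (0 < M)%N by exact: leq_trans M8.
have Z0 : (0 < Z)%N by rewrite /Z muln_gt0 M0 muln_gt0 q10.
have N0 : (0 < N)%N by rewrite muln_gt0 expn_gt0 Z0.
have NB : (N <= 2 ^ (30 * l ^ 5 * y))%N := construction_size m kl k2 y0 yl q1le.
pose D := family_disc y m q1 neg.
have /boolp.choice[ch chP] : forall j, exists dc : nat * (nat -> C),
  [/\ (dc.1 %| q1 * D j)%N, natchar dc.1 dc.2, separating dc.1 dc.2,
     forall n, coprime n (q1 * D j) -> dc.2 n = xi n * jacC R (D j) n &
     forall n, (0 < n)%N -> ~~ exceptional y m q1 neg j n -> dc.2 n * jacC R m n = family_char y m q1 xi neg j n].
  by move=> j; have [d [chi ?]] := induced_character neg m13 y3 xic q1big j; exists (d, chi).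
pose th j n := (ch j).2 n * jacC R m n.
have th1 j n : cabs (th j n) <= 1.
  have [_ c _ _ _] := chP j; rewrite cabsM -[leRHS]mulr1.
  apply: ler_pM; rewrite ?cabs_ge0 //; first exact: (natchar_abs_le1 c).
  by apply: (natchar_abs_le1 (q := m)); exact: natchar_jacC.
have thE j n : (0 < n)%N -> ~~ exceptional y m q1 neg j n -> th j n = family_char y m q1 xi neg j n.
  by have [_ _ _ _ H] := chP j; exact: H.
have [j [big jN]] := exists_large_partial_sum m13 y3 xic q1big xi1 N0 q1cnt th1 thE.
have [dq chic sep chiE _] := chP j.
move: big; rewrite /th; move: (ch j) dq chic sep chiE => [d chi] /= dq chic sep chiE big.
have prim := induced_primitive m13 y3 xic q1big dq chiE cg pg.
have yd := induced_modulus_gt m13 y3 xic q1big dq chic k2 prim.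
have [cdm od] := induced_modulus_coprime m13 y3 xic q1big dq chic.
have minus := induced_minus_one m13 y3 xic dq chic chiE xim.
have d1 : (1 < d)%N by lia.
have QZ : (m * d <= Z * N)%N.
  have : (d <= q1 * D j)%N by apply: dvdn_leq => //; rewrite muln_gt0 q10 odd_gt0 // (odd_family_disc y neg m13 xic).
  have : (D j <= 4 * (M * N))%N.
    rewrite /D /family_disc /family_start -/M; clearbody M N.
    have : (M * j.+1 <= M * N)%N by rewrite leq_mul2l jN orbT.
    by case: m13 => ->; case: (neg); nia.
  rewrite /Z; clearbody M N => h1 h2.
  apply: (@leq_trans (3 * (q1 * (4 * (M * N))))).
    apply: leq_mul; first by case: m13 => ->.
    by apply: (leq_trans h2); rewrite leq_mul2l h1 orbT.
  by rewrite -!mulnA; nia.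
exists d, chi; split => //.
- split => //; apply: (@leq_trans (N * N)).
    apply: (@leq_trans (Z * N)); first by apply: leq_trans QZ; rewrite leq_pmull.
    rewrite leq_mul2r; apply/orP; right; rewrite /N; apply: (@leq_trans (Z ^ 3)).
      by rewrite -{1}[Z]expn1 leq_pexp2l.
    by rewrite leq_pmulr.
  have -> : (60 * l ^ 5 * y = 30 * l ^ 5 * y + 30 * l ^ 5 * y)%N by rewrite -!mulnA -mulnDl.
  by rewrite expnD leq_mul.
- by move=> n; exact: (induced_expr m13 y3 xic dq chic chiE ek xik).
move=> B HB.
have HQ3 : ((m * d) ^ 3 <= N ^ 4)%N.
  apply: (@leq_trans ((Z * N) ^ 3)); first by rewrite leq_exp2r.
  by rewrite expnMn (expnSr N 3) mulnC leq_mul2l leq_pmulr // orbT.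
have Q1 : (1 < m * d)%N by apply: leq_trans d1 _; rewrite leq_pmull.
pose f n := chi n * jacC R m n.
have fc : natchar (m * d) f by rewrite mulnC; apply: natcharM => //; exact: natchar_jacC.
have fs : separating (m * d) f.
  rewrite mulnC; apply: separatingM => //; first exact: natchar_jacC.
  by case: m13 => ->; [exact: separating_jac1 | exact: separating_jac3].
have fodd : f (m * d).-1 = -1.
  rewrite /f -minus; congr (_ * _).
    by apply: (natchar_eqmod chic); rewrite mulnC pred_eqmod //; lia.
  by apply: (natchar_eqmod (natchar_jacC R om)); rewrite pred_eqmod //; lia.
have oQ : odd (m * d) by rewrite oddM om.
have upper : cabs (\sum_(0 <= n < m * d) n%:R * f n) / (m * d)%:R <= m.+1./2%:R * B.
  rewrite /f; case: m13 => [->|m3]; last rewrite {1 2 3 4}m3.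
    rewrite !mul1n mul1r; under eq_bigr do rewrite /jacC jac1l mulr1.
    exact: (first_moment_le d1 chic sep HB).
  by apply: (twisted_first_moment_le d1 _ chic sep HB); rewrite coprime_sym -m3.
apply: le_trans upper.
apply: le_trans (first_moment_lower Q1 fc fs oQ fodd N0).
apply: le_trans (first_moment_error _ Q1 HQ3).
rewrite ler_wpM2l ?divr_ge0 ?sqrtr_ge0 ?pi_ge0 // lerBrDr.
apply: le_trans big.
have err := average_error_le R kl k2 ly N0 NB.
have low : (1 - (y%:R)^-1) * prime_euler m (inv_nat R) y <= smooth_sum m (inv_nat R) y N.
  apply: (@smooth_inv_sum_lower R m y (2 * l + 2)) => //; last by rewrite leq_pmull // expn_gt0 Z0.
  apply: (@leq_trans ((2 ^ l.+1) ^ 2)); first by rewrite leq_exp2r // ltnW.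
  by rewrite -expnM leq_exp2l //; lia.
have PE0 : 0 < prime_euler m (inv_nat R) y.
  by apply: prime_euler_gt0 => p pr; exact: inv_nat_lt1.
have yi : 0 <= 1 - (y%:R : R)^-1 by rewrite subr_ge0 invf_le1 ?ltr0n // ler1n.
have low2 := ler_wpM2r yi low.
have sq : 0 <= (y%:R : R)^-1 ^+ 2 * prime_euler m (inv_nat R) y.
  by rewrite mulr_ge0 ?exprn_ge0 ?invr_ge0 ?ler0n // ltW.
apply: (@le_trans _ _ (smooth_sum m (inv_nat R) y N * (1 - (y%:R)^-1) - 21)); last first.
  by rewrite lerD2l lerN2; exact: err.
move: low2 sq; move: (prime_euler m _ y) (smooth_sum m _ y N) (y%:R^-1 : R) => P S t e2 e3.
have -> : (1 - 2 * t) * P = (1 - t) * P * (1 - t) - t ^+ 2 * P by ring.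
lra.
Qed.

End LargeSum.

(** * Characters on the integers *)

Section IntCharacter.
Variable R : realType.
Local Notation C := R[i].
Variables (q : nat) (f : nat -> C).
Hypothesis fc : natchar q f.
Hypothesis fs : separating q f.

Definition int_character (n : int) : C := f `|(n %% q%:Z)%Z|%N.

Lemma int_character_nat (n : nat) : int_character n%:Z = f n.
Proof. by case: fc => _ per _ _; rewrite /int_character modz_nat absz_nat per. Qed.

Lemma int_character_dirichlet : dirichlet_character q int_character.
Proof.
case: (fc) => q0 per mul nz; split => // [n|a b|n].
- by rewrite /int_character modzDr.
- have qz : q%:Z != 0 by rewrite -lt0n.
  rewrite -mul -int_character_nat /int_character PoszM.
  by rewrite !gez0_abs ?modz_ge0 // modzMm.
- by rewrite /int_character nz /coprimez -gcdz_modl.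
Qed.

Lemma dirichlet_character_modn d (psi : int -> C) (n : nat) :
  dirichlet_character d psi -> psi n%:Z = psi (n %% d)%N%:Z.
Proof.
move=> [_ per _ _]; rewrite {1}(divn_eq n d); elim: (n %/ d)%N => [|a IH] //.
by rewrite mulSn -addnA addnC PoszD per.
Qed.

Lemma dirichlet_character1 d (psi : int -> C) : dirichlet_character d psi -> psi 1 = 1.
Proof.
move=> [_ _ mul nz]; have p1 : psi 1 != 0 by rewrite nz /coprimez gcd1z.
by apply: (mulfI p1); rewrite -mul mulr1 mulr1.
Qed.

Lemma int_character_primitive : primitive_character q int_character.
Proof.
split=> [|d psi dq dlt pc ind]; first exact: int_character_dirichlet.
have [n [n1 cop fn]] := fs dq dlt.
have := ind n%:Z; rewrite /coprimez /gcdz !absz_nat => /(_ cop).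
rewrite int_character_nat (dirichlet_character_modn n pc) n1 -(dirichlet_character_modn 1 pc).
by rewrite (dirichlet_character1 pc) => /eqP; rewrite (negbTE fn).
Qed.

Lemma int_character_minus_one : (1 < q)%N -> int_character (- 1) = f q.-1.
Proof.
move=> q1; rewrite -int_character_nat /int_character; congr (f `|_|%N).
have -> : - 1 = (-1) * q%:Z + q.-1%:Z by lia.
by rewrite modzMDl.
Qed.

Lemma int_character_order k h : (0 < k)%N -> (forall n, coprime n q -> f n ^+ k = 1) ->
  coprime h q -> k.-primitive_root (f h) -> character_order q int_character k.
Proof.
move=> k0 fk ch ph; split => // [n|m /andP[m0 mk] H].
  have [_ _ _ nz] := int_character_dirichlet.
  rewrite /principal_character -nz; case: eqP => [->|/eqP n0] /=.
    by rewrite expr0n; case: k k0 {fk ph}.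
  apply: fk; case: (fc) => _ _ _ <-; exact: n0.
have := H h%:Z; rewrite int_character_nat /principal_character /coprimez /gcdz !absz_nat.
have -> : (gcdn h q)%:Z == 1 by move: ch; rewrite /coprime => /eqP->.
move=> /eqP; rewrite -(prim_order_dvd ph) => /(dvdn_leq m0); lia.
Qed.

(** Polya-Vinogradov bounds the set of absolute values, so [sup] is a genuine supremum and not its
    default value. *)
Lemma partial_sum_le_max x : (1 < q)%N ->
  cabs (\sum_(0 <= n < x) f n) <= max_character_sum int_character.
Proof.
move=> q1; have f0 : f 0%N = 0.
  by apply: (natchar_notcoprime fc); rewrite /coprime gcd0n; apply/eqP; lia.
have E z : \sum_(1 <= n < z.+1) int_character n%:Z = \sum_(0 <= n < z.+1) f n.
  rewrite [RHS]big_ltn // f0 add0r; apply: eq_bigr => n _; exact: int_character_nat.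
have Hsup : has_sup [set ComplexField.Normc.normc (\sum_(1 <= n < x.+1) int_character n%:Z)
      | x in [set: nat]]%classic.
  split; first by exists (cabs (\sum_(1 <= n < 1) int_character n%:Z)), 0%N.
  exists (Num.sqrt q%:R * hsum R q) => _ [z _ <-]; rewrite E.
  exact: polya_vinogradov.
have in_le z : cabs (\sum_(0 <= n < z.+1) f n) <= max_character_sum int_character.
  by apply: sup_upper_bound => //; exists z => //; rewrite E.
case: x => [|x]; last exact: in_le.
by rewrite big_geq // cabs0; apply: le_trans (in_le 0%N); exact: cabs_ge0.
Qed.

End IntCharacter.

Local Open Scope classical_set_scope.
Local Open Scope ring_scope.

(** * Passage to the limit *)

Section Asymptotics.
Variable R : realType.
Local Notation C := R[i].

(** For each [i] choose q_i >= i good for the error 1/(i + 1), and let - o(q) be 1/(i + 1) for the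
    least [i] with q_i = q, and 0 if there is none. Beyond q_0, ..., q_(K-1) only indices i >= K
    occur, hence o tends to 0. *)
Lemma vanishing_error (G : nat -> R -> Prop) :
  (forall e, 0 < e -> forall Q, exists2 q, (Q <= q)%N & G q e) ->
  exists o : nat -> R, o @ \oo --> (0 : R) /\ forall Q, exists2 q, (Q <= q)%N & G q (- o q).
Proof.
move=> H.
have /boolp.choice[qf qfP] : forall i : nat, exists q, (i <= q)%N /\ G q (i.+1%:R)^-1.
  by move=> i; have [|q iq Gq] := H (i.+1%:R)^-1 _ i; [rewrite invr_gt0 ltr0n | exists q].
pose P q i := qf i == q.
pose o q : R := if pselect (exists i, P q i) is left ex then - ((ex_minn ex).+1%:R)^-1 else 0.
exists o; split=> [|Q].
  apply/cvgrPdist_le => e e0; have [K Ke] : exists K : nat, (K.+1%:R : R)^-1 <= e.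
    exists (Num.bound e^-1); rewrite -[leRHS]invrK lef_pV2 ?posrE ?invr_gt0 ?ltr0n //.
    apply: ltW; apply: lt_le_trans (archi_boundP _) _; first by rewrite invr_ge0 ltW.
    by rewrite ler_nat.
  exists (\sum_(0 <= i < K) qf i).+1 => // q /= Kq; rewrite sub0r normrN /o.
  case: pselect => [ex|_]; last by rewrite normr0 ltW.
  case: ex_minnP => i /eqP qi _; rewrite normrN ger0_norm ?invr_ge0 ?ler0n //.
  apply: le_trans Ke; rewrite lef_pV2 ?posrE ?ltr0n // ler_nat ltnS leqNgt.
  apply/negP => iK; move: Kq; rewrite ltnNge -qi big_mkord => /negP; apply.
  by rewrite (bigD1 (Ordinal iK)) //= leq_addr.
have [Qq GQ] := qfP Q; exists (qf Q) => //; rewrite /o.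
case: pselect => [ex|[]]; last by exists Q; exact: eqxx.
case: ex_minnP => i /eqP E _; rewrite opprK.
by have [_] := qfP i; rewrite E.
Qed.

(** The logarithm of l^5 is at most 10 sqrt l; with [l] of the order of log y, log log d exceeds log
    y by a lower-order amount only. *)
Lemma ln_ln_le d l y : (0 < l)%N -> (0 < y)%N -> (1 < d)%N -> (d <= 2 ^ (60 * l ^ 5 * y))%N ->
  ln (ln (d%:R : R)) <= ln y%:R + (60 + 10 * Num.sqrt l%:R).
Proof.
move=> l0 y0 d1 dB.
have lR : 0 < l%:R :> R by rewrite ltr0n.
have yR : 0 < y%:R :> R by rewrite ltr0n.
have d0 : 0 < ln (d%:R : R) by rewrite ln_gt0 // ltr1n.
have lnd : ln (d%:R : R) <= 60 * l%:R ^+ 5 * y%:R.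
  apply: (@le_trans _ _ (ln ((2 ^ (60 * l ^ 5 * y))%:R))).
    by rewrite ler_ln ?posrE ?ltr0n ?expn_gt0 ?(ltnW d1) // ler_nat.
  have <- : (60 * l ^ 5 * y)%:R = 60 * l%:R ^+ 5 * y%:R :> R by rewrite natrM natrM natrX.
  rewrite natrX lnXn // -[leLHS]mulr_natl ler_piMr ?ler0n //.
  by have [] := @ln2_bounds R.
have s0 : 0 < Num.sqrt l%:R :> R by rewrite sqrtr_gt0.
apply: (@le_trans _ _ (ln (60 * l%:R ^+ 5 * y%:R))).
  by rewrite ler_ln ?posrE // (lt_le_trans d0).
rewrite !lnM ?posrE ?mulr_gt0 ?exprn_gt0 //.
rewrite addrC lerD2l lerD //; first by apply/ltW/ln_sublinear.
have -> : ln l%:R = 2 * ln (Num.sqrt l%:R) :> R.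
  by rewrite -[in LHS](sqr_sqrtr (ltW lR)) lnXn // mulr_natl.
have := ln_sublinear s0; lra.
Qed.

(** Read X = log y, s = sqrt l, T = log log q, v = 2/y and [P] as Mertens' product. The relative
    errors of [P], of 1 - v and of T against X are at most [delta] each, and e = delta (3 G + 1)
    pays for them. From 280 <= delta s follow both 60 + 10 s <= delta X and 122 <= delta X. *)
Lemma main_term_le (G e delta X s T P v : R) : 0 < G -> 0 < e ->
  delta = e / (3 * G + 1) -> 280 <= delta * s -> 1 <= s -> s ^+ 2 <= 2 * X ->
  0 <= T -> T <= X + (60 + 10 * s) -> 0 <= v -> v <= delta -> v <= 1 ->
  G * (1 - delta) * X <= P -> 0 <= G - e ->
  (G - e) * T <= (1 - v) * P - 122.
Proof.
move=> G0 e0 dE ds s1 sX T0 TX v0 vd v1 PX Ge.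
have G1 : 0 < 3 * G + 1 by lra.
have d0 : 0 < delta by rewrite dE divr_gt0.
have eE : e = delta * (3 * G + 1) by rewrite dE -mulrA mulVf ?mulr1 // gt_eqF.
have X0 : 0 <= X by have := sqr_ge0 s; lra.
have ss : 280 * s <= 2 * (delta * X).
  have : 280 * s <= delta * s * s by rewrite ler_pM2r //; lra.
  have : delta * s * s <= delta * (2 * X) by rewrite -mulrA -expr2 ler_pM2l.
  lra.
have left_le : (G - e) * T <= (G - e) * (X + delta * X) by rewrite ler_wpM2l //; lra.
have right_ge : (1 - v) * (G * (1 - delta) * X) <= (1 - v) * P by rewrite ler_wpM2l // subr_ge0.
have dX : 0 <= delta * X by rewrite mulr_ge0 // ltW.
have a1 : 0 <= e * (delta * X) by rewrite mulr_ge0 // ltW.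
have GX : 0 <= G * X by rewrite mulr_ge0 // ltW.
have a2 : 0 <= v * (G * X * delta) by rewrite !mulr_ge0 // ltW.
have a3 : v * (G * X) <= delta * (G * X) by rewrite ler_wpM2r.
have eX : e * X = 3 * (G * (delta * X)) + delta * X by rewrite eE; ring.
have L : (G - e) * (X + delta * X) = G * X + G * (delta * X) - e * X - e * (delta * X) by ring.
have Rr : (1 - v) * (G * (1 - delta) * X) = G * X - G * (delta * X) - v * (G * X) + v * (G * X * delta) by ring.
have a4 : delta * (G * X) = G * (delta * X) by ring.
lra.
Qed.

(** For m = 3 the Euler factor at 3 is lost (2/3), the modulus grows to 3 d and the first moment
    costs 2 M: sqrt 3 (2/3) / 2 = 1 / sqrt 3. Dividing the loss 81 by 2/3 gives 121.5, rounded up to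
    122. *)
Lemma moment_constants m d (v P B : R) : m = 1%N \/ m = 3%N ->
  Num.sqrt (m * d)%:R / pi * ((1 - v) * ((if m == 1%N then 1 else 2 / 3) * P) - 81) <=
    m.+1./2%:R * B ->
  (pi * Num.sqrt m%:R)^-1 * Num.sqrt d%:R * ((1 - v) * P - 122) <= B.
Proof.
have pi0 := @pi_gt0 R; have pz : pi != 0 :> R by rewrite gt_eqF.
case=> -> /=.
  rewrite sqrtr1 mulr1 !mul1n !mul1r; apply: le_trans.
  rewrite [pi^-1 * _]mulrC ler_wpM2l; [lra|by rewrite divr_ge0 ?sqrtr_ge0 ?ltW|lra].
rewrite natrM sqrtrM //; set x : R := Num.sqrt 3; set z := Num.sqrt d%:R.
have z0 : 0 <= z by rewrite sqrtr_ge0.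
have x0 : 0 < x by rewrite sqrtr_gt0.
have KE : (pi * x)^-1 = x / pi / 3.
  have <- : x ^+ 2 = 3 by rewrite sqr_sqrtr.
  have xz : x != 0 by rewrite gt_eqF.
  by move: (x : R) xz (pi : R) pz => a a0 b b0; field; rewrite a0 b0.
rewrite KE (mulrAC x z).
have : 0 <= x / pi by rewrite divr_ge0 ?ltW.
move: (x / pi) => w w0 h.
have wz : 0 <= w * z by rewrite mulr_ge0.
have E : 2 * (w / 3 * z * ((1 - v) * P - 122)) = w * z * ((1 - v) * (2 / 3 * P) - 81) - 1 / 3 * (w * z) by field.
rewrite -(@ler_pM2l _ 2) // E; lra.
Qed.

Lemma ln_ln_ge0 d : (4 <= d)%N -> 0 <= ln (ln (d%:R : R)).
Proof.
move=> d4; apply: ln_ge0; apply: (@le_trans _ _ (ln (2 ^ 2)%:R)).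
  by rewrite natrX lnXn // mulr2n; have [] := @ln2_bounds R; lra.
by rewrite ler_ln ?posrE ?ltr0n ?ler_nat //; apply: leq_trans d4.
Qed.

(** The twisted character is odd, so [chi] at - 1 is minus the symbol of - 1 over [m]: odd for m =
    1, and even for m = 3 because - 1 is a nonresidue modulo 3. *)
Lemma large_max_character_sum k m (e : R) (Q0 : nat) : (2 <= k)%N -> ~~ odd k ->
  m = 1%N \/ m = 3%N -> 0 < e ->
  exists2 q, (Q0 <= q)%N & exists chi : int -> C,
    [/\ primitive_character q chi, chi (- 1) = - jacC R m m.-1,
        character_order q chi k &
        (expR (euler_gamma R) / (pi * Num.sqrt m%:R) - e) * Num.sqrt (q%:R : R) *
          ln (ln (q%:R : R)) <= max_character_sum chi].
Proof.
move=> k2 ek m13 e0.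
pose K : R := (pi * Num.sqrt m%:R)^-1.
have mR : 0 < m%:R :> R by case: m13 => ->; rewrite ltr0n.
have K0 : 0 < K by rewrite invr_gt0 mulr_gt0 ?pi_gt0 // sqrtr_gt0.
pose G := expR (euler_gamma R).
have G0 : 0 < G := expR_gt0 _.
pose e1 := e / K; have e10 : 0 < e1 by rewrite divr_gt0.
pose delta := e1 / (3 * G + 1).
have d0 : 0 < delta by rewrite divr_gt0 //; lra.
have [t [t1 td]] : exists t : nat, (0 < t)%N /\ 280 <= delta * t%:R.
  exists (Num.bound (280 / delta)).+1; split=> //.
  rewrite mulrC -ler_pdivrMr // ltW //; apply: lt_le_trans (archi_boundP _) _.
    exact: divr_ge0 (ler0n _ _) (ltW d0).
  by rewrite ler_nat.
(* Each entry serves once: t^2 makes sqrt l large against 1/delta, 2000 k feeds the count of primes,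
   and [Q0] makes the modulus large. *)
pose L := maxn (t ^ 2) (maxn (2000 * k) Q0).
have [y yL mert] := mertens_infinitely_often (2 ^ L) d0.
have L2 : (L < 2 ^ L)%N by exact: ltn_expl.
have kL : (2000 * k <= L)%N by rewrite /L !leq_max leqnn orbT.
have k4 : (4 <= L)%N by apply: leq_trans kL; exact: (@leq_mul 2 2).
have y4 : (4 <= y)%N by apply: leq_trans yL; apply: leq_trans k4 (ltnW L2).
have y0 : (0 < y)%N by apply: leq_trans y4.
have Qy : (Q0 <= y)%N.
  by apply: leq_trans yL; apply: leq_trans (ltnW L2); rewrite /L !leq_max leqnn !orbT.
pose l := trunc_log 2 y.
have lP : (2 ^ l <= y < 2 ^ l.+1)%N by exact: trunc_log_bounds.
have lL : (L <= l)%N by exact: trunc_log_max.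
have kl : (2000 * k <= l)%N by exact: leq_trans kL lL.
have [d [chi [[chic sep yd dB] chim fk [h ch ph] bound]]] := large_sum_character R k2 ek m13 kl lP.
have d4 : (4 <= d)%N by apply: leq_trans (ltnW yd); apply: leq_trans y4.
have d1 : (1 < d)%N by apply: leq_trans d4.
exists d; first exact: leq_trans Qy (ltnW yd).
exists (int_character d chi); split.
- exact: int_character_primitive.
- have sqr : jacC R m m.-1 * jacC R m m.-1 = 1.
    by case: m13 => ->; rewrite /jacC ?jac1l ?jac3 /= -rmorphM -?expr2.
  by rewrite int_character_minus_one // -[LHS]mulr1 -sqr mulrA chim mulN1r.
- by apply: (int_character_order chic _ fk ch ph); apply: leq_trans k2.
have {}bound := bound _ (fun x => partial_sum_le_max chic sep x d1).
move: bound; set B := max_character_sum _; set P := prime_euler 1 (inv_nat R) y in mert *.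
move=> bound.
have B0 : 0 <= B.
  by apply: le_trans (partial_sum_le_max chic sep 0 d1); exact: cabs_ge0.
have sd0 : 0 < Num.sqrt d%:R :> R by rewrite sqrtr_gt0 ltr0n; apply: leq_trans d4.
have PE : prime_euler m (inv_nat R) y = (if m == 1%N then 1 else 2 / 3) * P.
  case: (m13) => -> /=; first by rewrite mul1r.
  rewrite prime_euler_three ?(leq_trans _ y4) // /inv_nat; last by rewrite invf_lt1 ?ltr1n.
  by congr (_ * _); field.
rewrite PE in bound.
have key := moment_constants m13 bound.
rewrite -/K in key.
set T := ln (ln d%:R).
have T0 : 0 <= T := ln_ln_ge0 d4.
have -> : G / (pi * Num.sqrt m%:R) - e = K * (G - e1).
  by rewrite /e1 mulrBr mulrCA mulfV ?gt_eqF // mulr1 mulrC.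
have [Ge|Ge] := leP 0 (G - e1); last first.
  apply: le_trans B0; rewrite -!mulrA pmulr_rle0 // nmulr_rle0 //.
  by rewrite mulr_ge0 // ltW.
apply: le_trans key.
have -> : K * (G - e1) * Num.sqrt d%:R * T = K * Num.sqrt d%:R * ((G - e1) * T) by ring.
rewrite ler_pM2l ?mulr_gt0 //.
have lR : (L%:R : R) <= l%:R by rewrite ler_nat.
have tl : t%:R <= Num.sqrt l%:R :> R.
  rewrite -[leLHS]ger0_norm ?ler0n // -sqrtr_sqr ler_sqrt ?ler0n //.
  by rewrite -natrX ler_nat; apply: leq_trans lL; rewrite /L leq_maxl.
have ty : (t <= y)%N.
  apply: leq_trans yL; apply: leq_trans (ltnW L2); apply: (@leq_trans (t ^ 2)).
    by rewrite -{1}[t]expn1 leq_pexp2l.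
  by rewrite /L leq_maxl.
have yR : 0 < y%:R :> R by rewrite ltr0n.
have lX : l%:R <= 2 * ln (y%:R : R).
  apply: (@le_trans _ _ (2 * ln (2 ^ l)%:R)).
    rewrite natrX lnXn // -[X in _ <= 2 * X]mulr_natl mulrCA ler_peMr ?ler0n //.
    by have [h2 _] := @ln2_bounds R; rewrite -ler_pdivrMl // mulrC.
  by rewrite ler_pM2l // ler_ln ?posrE ?ltr0n ?expn_gt0 // ler_nat; case/andP: lP.
apply: (@main_term_le G e1 delta (ln y%:R) (Num.sqrt l%:R)) => //.
- by apply: (le_trans td); rewrite ler_pM2l.
- by apply: le_trans tl; rewrite ler1n.
- by rewrite sqr_sqrtr.
- apply: ln_ln_le => //; apply: leq_trans lL; exact: leq_trans k4.
- rewrite ler_pdivrMr //; apply: (@le_trans _ _ (delta * t%:R)).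
    by apply: le_trans td; rewrite ler_nat.
  by rewrite ler_pM2l // ler_nat.
- by rewrite ler_pdivrMr // mul1r ler_nat; apply: leq_trans y4.
apply: le_trans mert; rewrite expRD ler_wpM2r ?ln_ge0 ?ler1n //.
by rewrite ler_pM2l // expR_ge1Dx.
Qed.

End Asymptotics.

Theorem theorem1p4 (R : realType) (k : nat) (hk2 : (2 <= k)%N)
    (hkeven : ~~ odd k) :
  (exists o : nat -> R, o @ \oo --> (0 : R) /\
    forall Q : nat, exists (q : nat) (chi : int -> R[i]),
      [/\ (Q <= q)%N,
          primitive_character q chi,
          odd_character chi,
          character_order q chi k &
          (expR (euler_gamma R) / pi + o q) * Num.sqrt (q%:R : R) *
            ln (ln (q%:R : R)) <= max_character_sum chi]) /\
  (exists o : nat -> R, o @ \oo --> (0 : R) /\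
    forall Q : nat, exists (q : nat) (chi : int -> R[i]),
      [/\ (Q <= q)%N,
          primitive_character q chi,
          even_character chi,
          character_order q chi k &
          (expR (euler_gamma R) / (pi * Num.sqrt (3 : R)) + o q) *
            Num.sqrt (q%:R : R) * ln (ln (q%:R : R)) <= max_character_sum chi]).
Proof.
split.
  have [e e0 Q|o [cvo oP]] := @vanishing_error R (fun q e => exists chi : int -> R[i],
    [/\ primitive_character q chi, odd_character chi, character_order q chi k &
    (expR (euler_gamma R) / pi - e) * Num.sqrt (q%:R : R) *
            ln (ln (q%:R : R)) <= max_character_sum chi]).
    have [q Qq [chi [pc chim oc]]] := large_max_character_sum Q hk2 hkeven (or_introl erefl) e0.
    rewrite sqrtr1 mulr1 => big; exists q => //; exists chi; split => //.
    by rewrite /odd_character chim /jacC jac1l.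
  exists o; split => // Q; have [q Qq [chi [pc oc kc]]] := oP Q.
  by rewrite opprK; exists q, chi.
have [e e0 Q|o [cvo oP]] := @vanishing_error R (fun q e => exists chi : int -> R[i],
  [/\ primitive_character q chi, even_character chi, character_order q chi k &
  (expR (euler_gamma R) / (pi * Num.sqrt (3 : R)) - e) * Num.sqrt (q%:R : R) *
          ln (ln (q%:R : R)) <= max_character_sum chi]).
  have [q Qq [chi [pc chim oc big]]] := large_max_character_sum Q hk2 hkeven (or_intror erefl) e0.
  exists q => //; exists chi; split => //.
  by rewrite /even_character chim /jacC jac3 /= sub0r rmorphN opprK.
exists o; split => // Q; have [q Qq [chi [pc oc kc]]] := oP Q.
by rewrite opprK; exists q, chi.
Qed.
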